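(* Let $(\Omega,\mathcal F,\mathbb P)$ be a probability space, let $p>1$, let $\mathcal E=L^p(\Omega\times(0,T)\times I_{x^\perp})$, and let $F\in L^p(I_x;\mathcal E)$ be given. Let $u$ be a random process with $u\in L^2(\Omega;L^2(0,T;H^1(\mathcal M)))$ which satisfies almost surely the linear equation $$u_t+\Delta u_x+cu_x=F,$$ that is, almost surely $$u(t)+\int_0^t(\Delta u_x+cu_x)\,ds=u(0)+\int_0^tF\,ds$$ in the sense of distributions on $\mathcal M$, for every $0\le t\le T$. Then $$u_x,\ u_{xx}\in\mathcal C_x(I_x;\mathcal B),\qquad \mathcal B=L^2(\Omega;H^{-2}((0,T)\times I_{x^\perp}))+\mathcal E,$$ and, in particular, $u_x|_{x=0,1}$ and $u_{xx}|_{x=0,1}$ are well defined in $\mathcal B$.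
   Context: $T>0$ and $c\in\mathbb R$ are fixed; $d\in\{1,2\}$; $\mathcal M=I_x\times I_{x^\perp}$ with $I_x=(0,1)$ and $I_{x^\perp}=(-\pi/2,\pi/2)^d$; the variable in $I_{x^\perp}$ is $x^\perp=y$ if $d=1$ and $x^\perp=(y,z)$ if $d=2$. $\Delta=\partial_x^2+\Delta^\perp$, with $\Delta^\perp=\partial_y^2$ or $\partial_y^2+\partial_z^2$. $\mathcal C_x(I_x;\mathcal B)$ denotes the continuous functions of $x$, up to the endpoints $x=0,1$, with values in $\mathcal B$. *)

(* Defs.v *)
From HB Require Import structures.
From mathcomp Require Import all_boot all_order all_algebra.
From mathcomp Require Import all_classical all_reals all_analysis.

Set Implicit Arguments.
Unset Strict Implicit.
Unset Printing Implicit Defensive.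

Import Order.TTheory GRing.Theory Num.Theory.
Import numFieldNormedType.Exports.

Local Open Scope classical_set_scope.
Local Open Scope ring_scope.

(* Spaces carrying both a sigma-algebra and a norm. *)
#[short(type=measNormedType)]
HB.structure Definition MeasNormed (d : measure_display) (R : realType) :=
  { V of Measurable d V & NormedModule R V }.

(* [line R] is R with the Borel sigma-algebra on which [lebesgue_measure] is
   defined and, in addition, its usual norm; the alias only serves inference. *)
Definition line (R : realType) : Type := measurableTypeR R.
HB.instance Definition _ (R : realType) :=
  Measurable.copy (line R) (measurableTypeR R).
HB.instance Definition _ (R : realType) := NormedModule.copy (line R) R^o.
HB.instance Definition _ (R : realType) (d1 d2 : measure_display)
  (X : measNormedType d1 R) (Y : measNormedType d2 R) :=
  NormedModule.on (X * Y)%type.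

Definition leb (R : realType) :
  {sigma_finite_measure set (line R) -> \bar R} := @lebesgue_measure R.

(* The product measure of the library, under a name for which inference finds
   sigma-finiteness. *)
Section ProductMeasure.
Context (d1 d2 : measure_display) (T1 : measurableType d1)
  (T2 : measurableType d2) (R : realType).
Context (m1 : {sigma_finite_measure set T1 -> \bar R})
  (m2 : {sigma_finite_measure set T2 -> \bar R}).
Local Open Scope ereal_scope.

Definition prod_measure : set (T1 * T2) -> \bar R := m1 \x m2.
HB.instance Definition _ := Measure.copy prod_measure (m1 \x m2).

Lemma prod_measure_sigma_finite : sigma_finite setT prod_measure.
Proof.
have /sigma_finiteP[F [TF ndF Foo]] := sigma_finiteT m1.
have /sigma_finiteP[G [TG ndG Goo]] := sigma_finiteT m2.
exists (fun n => F n `*` G n).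
  rewrite -setXTT TF TG predeqE => -[x y]; split.
    move=> [/= [n _ Fnx] [k _ Gky]]; exists (maxn n k) => //; split.
    - by move: x Fnx; exact/subsetPset/ndF/leq_maxl.
    - by move: y Gky; exact/subsetPset/ndG/leq_maxr.
  by move=> [n _ []/= ? ?]; split; exists n.
move=> k; have [? ?] := Foo k; have [? ?] := Goo k.
split; first exact: measurableX.
by rewrite /prod_measure product_measure1E// lte_mul_pinfty// ge0_fin_numE.
Qed.

HB.instance Definition _ := Measure_isSigmaFinite.Build _ _ _ prod_measure
  prod_measure_sigma_finite.
End ProductMeasure.

Record crossSection (R : realType) := CrossSection {
  cs_disp : measure_display ;
  cs_space :> measNormedType cs_disp R ;
  cs_measure : {sigma_finite_measure set cs_space -> \bar R} ;
  cs_basis : seq cs_space ;  (* coordinate directions *)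
  cs_dom : set cs_space }.   (* the domain I_{x^\perp} *)
Arguments cs_space {R}.
Arguments cs_measure {R}.
Arguments cs_basis {R}.
Arguments cs_dom {R}.

Definition half_pi_itv (R : realType) : set (line R) :=
  [set` `]- (pi / 2), pi / 2[%R].

(* The space of the variable x^\perp : y when d = 1, (y, z) when d = 2
   (values of d other than 1 and 2 are irrelevant). *)
Definition cross (R : realType) (d : nat) : crossSection R :=
  if d == 1%N then
    CrossSection (leb R) [:: (1 : R) : line R] (half_pi_itv (R := R))
  else
    @CrossSection R _ (line R * line R)%type (prod_measure (leb R) (leb R))
      [:: ((1 : R) : line R, 0); (0, (1 : R) : line R)]
      (half_pi_itv (R := R) `*` half_pi_itv (R := R)).

Section TestFunctions.
Context (R : realType) (V : normedModType R).
Implicit Types (f phi : V -> R) (vs : seq V) (U : set V).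

Definition iter_derive vs f : V -> R := foldr (fun v g => 'D_v g) f vs.

(* C^infty, since V is finite-dimensional wherever this is used. *)
Definition smooth f := forall vs, continuous (iter_derive vs f) /\
  forall x v, derivable (iter_derive vs f) x v.

(* D(U) *)
Definition test U phi := smooth phi /\ exists K : set V,
  [/\ compact K, K `<=` U & forall x, ~ K x -> phi x = 0].

Definition linear_on U (L : (V -> R) -> R) := forall a phi psi,
  test U phi -> test U psi ->
  L (fun x => a * phi x + psi x) = a * L phi + L psi.

(* D'(U), through the seminorm characterization of continuity on D(U);
   e is the list of coordinate directions of V. *)
Definition distribution (e : seq V) U (L : (V -> R) -> R) :=
  linear_on U L /\
  forall K : set V, compact K -> K `<=` U -> exists (C : R) (N : nat),
    forall phi (b : R), test U phi -> (forall x, ~ K x -> phi x = 0) ->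
      (forall vs x, {subset vs <= e} -> (size vs <= N)%N ->
         `|iter_derive vs phi x| <= b) ->
      `|L phi| <= C * b.

Definition ddistr (v : V) (L : (V -> R) -> R) : (V -> R) -> R :=
  fun phi => - L ('D_v phi).

Definition laplace (e : seq V) (L : (V -> R) -> R) : (V -> R) -> R :=
  fun phi => \sum_(v <- e) ddistr v (ddistr v L) phi.

End TestFunctions.

Section Setting.
Context (R : realType) (T : R) (Y : crossSection R).
Context (dO : measure_display) (Omega : measurableType dO)
  (P : probability Omega R).

(* The type of the points (x, x^\perp) of M, and also of the points
   (t, x^\perp) of (0,T) x I_{x^\perp}. *)
Definition pt : measNormedType _ R := (line R * cs_space Y)%type.
Definition mupt : {sigma_finite_measure set pt -> \bar R} :=
  prod_measure (leb R) (cs_measure Y).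
Definition dir1 : pt := ((1 : R) : line R, 0).
Definition dirs : seq pt := dir1 :: [seq ((0 : line R), v) | v <- cs_basis Y].

Definition itvoo (b : R) : set (line R) := [set` `]0, b[%R].
Definition itvcc (b : R) : set (line R) := [set` `[0, b]%R].
Definition M : set pt := itvoo 1 `*` cs_dom Y.
Definition Q : set pt := itvoo T `*` cs_dom Y.

Definition regular (U : set pt) (f phi : pt -> R) : R :=
  \int[mupt]_(z in U) (f z * phi z).

(* Functions of (omega, t, (x, x^\perp)) and their joint domain. *)
Definition process := Omega -> line R -> pt -> R.
Definition jdom : set (Omega * (line R * pt)) := setT `*` (itvoo T `*` M).
Definition jfun (u : process) : Omega * (line R * pt) -> R :=
  fun z => u z.1 z.2.1 z.2.2.

(* L^2(Omega; L^2(0,T; H^1(M))); g v is the weak derivative in the coordinate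
   direction v.  As H^1(M) is separable, Bochner measurability amounts to the
   existence of jointly measurable versions of u and of its gradient. *)
Definition L2L2H1 (u : process) := measurable_fun jdom (jfun u) /\
  exists g : pt -> process,
  [/\ forall v, v \in dirs -> measurable_fun jdom (jfun (g v)),
      {ae P, forall w, {ae leb R, forall t, itvoo T t ->
         forall v phi, v \in dirs -> test M phi ->
         ddistr v (regular M (u w t)) phi = regular M (g v w t) phi}} &
      (\int[P]_w \int[leb R]_(t in itvoo T) \int[mupt]_(z in M)
         ((u w t z) ^+ 2 + \sum_(v <- dirs) (g v w t z) ^+ 2)%:E < +oo)%E].

(* E = L^p(Omega x (0,T) x I_{x^\perp}) *)
Definition normE (p : R) (f : Omega -> pt -> R) : \bar R :=
  ('N[P \x mupt]_(p%:E)[(fun z => (f z.1 z.2)%:E) \_ (setT `*` Q)])%E.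

Definition inE (p : R) (f : Omega -> pt -> R) :=
  measurable_fun (setT `*` Q) (fun z : Omega * pt => f z.1 z.2) /\
  (normE p f < +oo)%E.

(* f at fixed x, as a function of (omega, (t, x^\perp)) *)
Definition slice (f : process) (x : line R) : Omega -> pt -> R :=
  fun w z => f w z.1 (x, z.2).

(* L^p(I_x; E) *)
Definition LpE (p : R) (F : process) := measurable_fun jdom (jfun F) /\
  (\int[leb R]_(x in itvoo 1) (normE p (slice F x) `^ p) < +oo)%E.

(* u_t + Delta u_x + c u_x = F almost surely, integrated in time.  The values
   u(t), 0 <= t <= T, are distributions on M given by a version ut of u. *)
Definition solves (c : R) (F u : process) :=
  exists ut : Omega -> line R -> (pt -> R) -> R,
  {ae P, forall w,
    [/\ forall t, itvcc T t -> distribution dirs M (ut w t),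
        {ae leb R, forall t, itvoo T t -> forall phi, test M phi ->
           ut w t phi = regular M (u w t) phi} &
        forall t phi, itvcc T t -> test M phi ->
          ut w t phi
          + \int[leb R]_(s in itvoo t)
              (let ux := ddistr dir1 (regular M (u w s)) in
               laplace dirs ux phi + c * ux phi)
          = ut w 0 phi + \int[leb R]_(s in itvoo t) regular M (F w s) phi]}.

(* A random distribution on Q = (0,T) x I_{x^\perp}, possibly known only up to
   modification. *)
Definition rdistr := Omega -> (pt -> R) -> R.

Definition rsub (G H : rdistr) : rdistr := fun w psi => G w psi - H w psi.

Definition normH2 (psi : pt -> R) : R :=
  Num.sqrt (\int[mupt]_(z in Q) (psi z) ^+ 2
    + \sum_(v <- dirs) \int[mupt]_(z in Q) ('D_v psi z) ^+ 2
    + \sum_(v <- dirs) \sum_(v2 <- dirs)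
        \int[mupt]_(z in Q) ('D_v ('D_v2 psi) z) ^+ 2).

(* H^{-2}(Q) is the dual of H^2_0(Q), the closure of D(Q) in H^2(Q); its
   elements are determined by their values on D(Q). *)
Definition normHm2 (L : (pt -> R) -> R) : \bar R :=
  ereal_sup [set (`|L psi|)%:E | psi in
               [set psi | test Q psi /\ normH2 psi <= 1]].

Definition inHm2 (L : (pt -> R) -> R) :=
  linear_on Q L /\ (normHm2 L < +oo)%E.

(* L^2(Omega; H^{-2}(Q)).  H^{-2}(Q) is a separable Hilbert space whose dual
   contains D(Q) densely, so strong measurability is measurability of all the
   pairings with D(Q) (Pettis). *)
Definition normL2Hm2 (g : rdistr) : \bar R :=
  ('N[P]_(2%:E)[(fun w => normHm2 (g w))])%E.

Definition inL2Hm2 (g : rdistr) :=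
  [/\ forall psi, test Q psi -> measurable_fun setT (fun w => g w psi),
      {ae P, forall w, inHm2 (g w)} & (normL2Hm2 g < +oo)%E].

(* B = L^2(Omega; H^{-2}(Q)) + E, with the norm of a sum of Banach spaces:
   the infimum of |g| + |e| over the decompositions G = g + e
   (+oo if there is none). *)
Definition normB (p : R) (G : rdistr) : \bar R :=
  ereal_inf [set r | exists (g : rdistr) (e : Omega -> pt -> R),
    [/\ inL2Hm2 g, inE p e,
        forall psi, test Q psi ->
          {ae P, forall w, G w psi = g w psi + regular Q (e w) psi} &
        r = (normL2Hm2 g + normE p e)%E]].

Definition inB (p : R) (G : rdistr) :=
  (forall psi, test Q psi -> measurable_fun setT (fun w => G w psi)) /\
  (normB p G < +oo)%E.

(* C_x(I_x; B), up to the endpoints *)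
Definition CxB (p : R) (v : line R -> rdistr) :=
  forall x, itvcc 1 x ->
    inB p (v x) /\
    (fun x' => normB p (rsub (v x') (v x))) @ within (itvcc 1) (nbhs x)
      --> (0 : \bar R).

(* u as the function x |-> u(., x, .), with values in the random distributions
   on Q *)
Definition in_x (u : process) : line R -> rdistr :=
  fun x w psi => regular Q (slice u x w) psi.

(* d^k V / dx^k = v in the sense of vector-valued distributions on I_x.  Values
   are compared through the pairings G |-> E[1_A <G, psi>], which separate
   random distributions (up to modification) and are continuous on B. *)
Definition weak_dx (k : nat) (V v : line R -> rdistr) :=
  forall (A : set Omega) (phi : line R -> R) (psi : pt -> R),
    measurable A -> test (itvoo 1) phi -> test Q psi ->
    \int[leb R]_(x in itvoo 1) (derive1n k phi x * \int[P]_(w in A) V x w psi)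
    = (-1) ^+ k *
      \int[leb R]_(x in itvoo 1) (phi x * \int[P]_(w in A) v x w psi).

(* v is a representative of d^k u / dx^k in C_x(I_x; B) *)
Definition dx_in_CxB (p : R) (k : nat) (u : process) (v : line R -> rdistr) :=
  CxB p v /\ weak_dx k (in_x u) v.

(* b in B is the value at x of every continuous representative *)
Definition trace (p : R) (k : nat) (u : process) (x : line R) (b : rdistr) :=
  inB p b /\ forall v, dx_in_CxB p k u v -> normB p (rsub (v x) b) = 0%E.

End Setting.

(* Main.v *)
From mathcomp Require Import all_boot all_order all_algebra.
From mathcomp Require Import ring lra.
From mathcomp Require Import all_classical all_reals all_analysis.
From mathcomp Require Import measurable_realfun.
Require Import Defs.

Set Implicit Arguments.
Unset Strict Implicit.
Unset Printing Implicit Defensive.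

Import Order.TTheory GRing.Theory Num.Theory.
Import numFieldNormedType.Exports.

Local Open Scope classical_set_scope.
Local Open Scope ring_scope.

(** The equation reads u_xxx = F - u_t - Delta^perp u_x - c u_x: the third
    x-derivative of u lies in L^2(I_x; L^2(Omega; H^{-2})) + L^p(I_x; E).
    Pairing with 1_A(omega) psi(t, x^perp) reduces everything to scalar
    functions of x.  A scalar W is recovered from its derivative by
    W(x) = int rho W + int k(x, s) W'(s) ds, where rho is a bump of mass one
    and k(x, s) = int_0^s rho - 1_{x <= s}.  Applied to u_xx, and once more to
    u_x, this expresses both as averages in x of u, u_x and F against bounded
    kernels that are Lipschitz in x with values in L^1(I_x).  Jensen's
    inequality bounds such an average in L^q by a constant times
    ||k||_1^{1-1/q}, which gives continuity in B.  Conversely the B-norm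
    controls E|<G, psi>|, so two continuous representatives have the same
    pairings at every x of [0, 1]. *)

(** * Smooth functions and test functions *)

(** The kernel [k(x, s)] jumps across [s = x], so kernels at neighbouring [x] are close in [L^1] but
    not uniformly. Raised to the power [q], Jensen's bound carries the factor [||k||_1^(q-1)], which
    becomes small precisely because [q > 1]; it is used for [q = 2] and for [q = p]. Time is the
    other obstacle. The equation is pathwise and integrated: [ut 0] is merely a distribution, and
    [ut] is tied to [u] at almost every time only. Testing at time [t] with
    [phi(x) psi_t(t, x^perp)] and integrating in [t] would require an integrable initial term.
    Subtracting the equation at one good time [t0] removes [ut 0], and the remaining term with
    [u(t0)] integrates to zero because [psi] has compact support in time. Finally [u_t] and
    [Delta^perp u_x] are no functions to be averaged in [x]. Only [u], [u_x] and [F] are averaged,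
    the other derivatives stay on [psi]; apart from the average of [F], this leaves
    [f1 - d_t f2 - (Delta^perp + c) f3] with square-integrable [f_i], which is where the order -2
    comes from. *)

Section SmoothFunctions.
Context (R : realType).

Lemma norm_sub_le_half (a b c e : R) :
  `|a - c| <= e / 2 -> `|b - c| <= e / 2 -> `|a - b| <= e.
Proof.
move=> ac bc; rewrite (le_trans (ler_distD c a b))// [leRHS]splitr.
by apply: lerD => //; rewrite distrC.
Qed.

(** [smooth] speaks of all iterated derivatives at once. A class stable under every directional
    derivative contains them all, by induction on the list of directions, so exhibiting such a class
    replaces computing them. *)
Lemma smooth_coind (V : normedModType R) (S : set (V -> R)) :
  (forall f, S f -> [/\ continuous f, forall x v, derivable f x v &
                        forall v, S ('D_v f)]) ->
  forall f, S f -> smooth f.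
Proof.
move=> HS f Sf vs.
have H : S (iter_derive vs f) by elim: vs => //= v vs /HS[].
by have [] := HS _ H.
Qed.

Section OneSpace.
Context (V : normedModType R).
Implicit Types (f g : V -> R).

Lemma smooth_continuous f : smooth f -> continuous f.
Proof. by move=> /(_ [::])[]. Qed.

Lemma smooth_derivable f x v : smooth f -> derivable f x v.
Proof. by move=> /(_ [::])[]. Qed.

Lemma smooth_derive f v : smooth f -> smooth ('D_v f).
Proof.
by move=> sf vs; have := sf (rcons vs v); rewrite /iter_derive -cats1 foldr_cat.
Qed.

Lemma is_derive_smooth f x v : smooth f -> is_derive x v f ('D_v f x).
Proof. by move=> sf; apply: derivableP; exact: smooth_derivable. Qed.

Lemma smooth_cst (a : R) : smooth (fun _ : V => a).
Proof.
apply: (@smooth_coind _ [set f | exists b, f = cst b]); last by exists a.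
move=> _ [b ->]; split.
- exact: cst_continuous.
- by move=> x v; exact: derivable_cst.
- by move=> v; exists 0; apply/funext => x; rewrite derive_cst.
Qed.

(** The Leibniz rule turns a product into a sum of two products. Closing products under sums gives a
    class stable under derivatives, as [smooth_coind] requires. *)
Inductive sums_of_products : (V -> R) -> Prop :=
| Prod f g : smooth f -> smooth g -> sums_of_products (fun x => f x * g x)
| Sum f g : sums_of_products f -> sums_of_products g ->
    sums_of_products (fun x => f x + g x).

Lemma smooth_sums_of_products f : sums_of_products f -> smooth f.
Proof.
apply: smooth_coind => {}f; elim=> [a b sa sb|a b _ [ca da Da] _ [cb db Db]].
  have E x v : is_derive x v (fun x => a x * b x)
      (a x * 'D_v b x + b x * 'D_v a x).
    by have := is_derive_smooth x v sa; have := is_derive_smooth x v sb => ? ?;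
      exact: is_deriveM.
  split.
  - by move=> x; apply: cvgM; exact: smooth_continuous.
  - by move=> x v; have [] := E x v.
  - move=> v; rewrite (_ : 'D_v _ = fun x => a x * 'D_v b x + b x * 'D_v a x).
      exact: (Sum (Prod sa (smooth_derive v sb)) (Prod sb (smooth_derive v sa))).
    by apply/funext => x; rewrite derive_val.
split.
- by move=> x; apply: cvgD; [exact: ca|exact: cb].
- by move=> x v; apply: derivableD.
- move=> v; rewrite (_ : 'D_v _ = fun x => 'D_v a x + 'D_v b x).
    exact: Sum.
  by apply/funext => x; rewrite deriveD.
Qed.

Lemma smoothM f g : smooth f -> smooth g -> smooth (fun x => f x * g x).
Proof. by move=> sf sg; apply: smooth_sums_of_products; exact: Prod. Qed.

Lemma smoothD f g : smooth f -> smooth g -> smooth (fun x => f x + g x).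
Proof.
move=> sf sg; apply: smooth_sums_of_products.
rewrite (_ : (fun _ => _) = (fun x => f x * 1 + g x * 1)).
  exact: (Sum (Prod sf (smooth_cst 1)) (Prod sg (smooth_cst 1))).
by apply/funext => x; rewrite !mulr1.
Qed.

Lemma smoothZ (a : R) f : smooth f -> smooth (fun x => a * f x).
Proof. by apply: smoothM; exact: smooth_cst. Qed.

Lemma derive_smoothM f g x v : smooth f -> smooth g ->
  'D_v (fun x => f x * g x) x = f x * 'D_v g x + g x * 'D_v f x.
Proof.
by move=> sf sg; rewrite deriveM//; exact: smooth_derivable.
Qed.

Lemma derive_smoothD f g x v : smooth f -> smooth g ->
  'D_v (fun x => f x + g x) x = 'D_v f x + 'D_v g x.
Proof.
by move=> sf sg; rewrite deriveD//; exact: smooth_derivable.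
Qed.

Lemma derive_smoothZ (a : R) f x v : smooth f ->
  'D_v (fun x => a * f x) x = a * 'D_v f x.
Proof.
by move=> sf; rewrite deriveZ//; exact: smooth_derivable.
Qed.

Lemma is_derive_along f x v (t : R) : smooth f ->
  is_derive t (1 : R) (fun t : R => f (x + t *: v)) ('D_v f (x + t *: v)).
Proof.
move=> sf.
have E : (fun h : R => h^-1 *: (((fun t : R => f (x + t *: v)) \o shift t) (h *: 1)
          - f (x + t *: v))) =
    (fun h : R => h^-1 *: ((f \o shift (x + t *: v)) (h *: v) - f (x + t *: v))).
  apply/funext => h /=; congr (_ *: (f _ - _)).
  by rewrite scaler1 scalerDl addrCA.
apply: DeriveDef; last by rewrite /derive E.
by rewrite /derivable E; exact: smooth_derivable.
Qed.

(** The mean value theorem twice: to the increment in direction [w] as a function of the position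
    along [v], then to ['D_v f] along [w]. *)
Lemma mixed_difference f x v w (h : R) : smooth f -> 0 < h ->
  exists a b : R, [/\ 0 < a < h, 0 < b < h &
   f (x + h *: v + h *: w) - f (x + h *: v) - f (x + h *: w) + f x =
   h ^+ 2 * 'D_w ('D_v f) (x + a *: v + b *: w)].
Proof.
move=> sf h0.
pose P (s : R) := f (x + h *: w + s *: v) - f (x + s *: v).
have PD (s : R) : is_derive s (1 : R) P
    ('D_v f (x + h *: w + s *: v) - 'D_v f (x + s *: v)).
  by have := is_derive_along (x + h *: w) v s sf; have := is_derive_along x v s sf
    => ? ?; exact: is_deriveB.
have contP : {within `[0, h], continuous P}.
  apply: continuous_subspaceT => s.
  by apply: differentiable_continuous; apply/derivable1_diffP.
have [a aI Ea] := @MVT _ P _ 0 h h0 (fun s _ => PD s) contP.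
have PD2 (s : R) : is_derive s (1 : R) (fun s : R => 'D_v f (x + a *: v + s *: w))
    ('D_w ('D_v f) (x + a *: v + s *: w)).
  by apply: is_derive_along; exact: smooth_derive.
have cont2 : {within `[0, h], continuous (fun s : R => 'D_v f (x + a *: v + s *: w))}.
  apply: continuous_subspaceT => s.
  by apply: differentiable_continuous; apply/derivable1_diffP.
have [b bI Eb] := @MVT _ _ _ 0 h h0 (fun s _ => PD2 s) cont2.
exists a, b; split; [by move: aI; rewrite in_itv|by move: bI; rewrite in_itv|].
move: Ea; rewrite /P !scale0r !addr0 subr0.
rewrite -(addrA x (h *: w)) (addrC (h *: w)) addrA.
move: Eb; rewrite scale0r addr0 subr0.
rewrite -(addrA x (h *: w)) (addrC (h *: w)) addrA.
move=> -> E; rewrite expr2 -mulrA (mulrC h) (mulrC h) -E opprB addrA.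
ring.
Qed.

(** The second difference of [mixed_difference] is symmetric in [v] and [w]. The two mixed
    derivatives therefore agree at two points as close to [x] as desired, and continuity concludes.
    This is what lets [lap_perp] commute with the time derivative. *)
Lemma deriveC_smooth f x v w : smooth f -> 'D_w ('D_v f) x = 'D_v ('D_w f) x.
Proof.
move=> sf; apply/eqP; rewrite -subr_eq0 -normr_le0; apply/ler_addgt0Pl => e e0.
rewrite addr0.
have near0 v1 w1 : exists2 d : R, 0 < d & forall a b : R, 0 < a < d -> 0 < b < d ->
    `|'D_w1 ('D_v1 f) x - 'D_w1 ('D_v1 f) (x + a *: v1 + b *: w1)| < e / 2.
  have c1 : continuous ('D_w1 ('D_v1 f)).
    by apply: smooth_continuous; do 2 apply: smooth_derive.
  have c2 : continuous (fun z : R * R => x + z.1 *: v1 + z.2 *: w1).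
    move=> z; apply: cvgD; first apply: cvgD.
    - exact: cvg_cst.
    - by apply: cvgZr_tmp; exact: cvg_fst.
    - by apply: cvgZr_tmp; exact: cvg_snd.
  have : {for (0, 0), continuous ('D_w1 ('D_v1 f) \o (fun z : R * R => x + z.1 *: v1 + z.2 *: w1))}.
    by apply: continuous_comp; [exact: c2|exact: c1].
  move=> /cvgr_dist_lt/(_ (e / 2)).
  rewrite /= !scale0r !addr0 => /(_ _)[|[A B]/= [/nbhs_ballP[dA/= dA0 HA] /nbhs_ballP[dB/= dB0 HB]] Hd].
    by rewrite divr_gt0.
  exists (Num.min dA dB) => [|a b /andP[a0]]; first by rewrite lt_min dA0 dB0.
  rewrite lt_min => /andP[aA aB] /andP[b0]; rewrite lt_min => /andP[bA bB].
  apply: (Hd (a, b)); split => /=; [apply: HA|apply: HB].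
    by rewrite /ball/= sub0r normrN gtr0_norm.
  by rewrite /ball/= sub0r normrN gtr0_norm.
have [d1 d10 H1] := near0 v w; have [d2 d20 H2] := near0 w v.
pose h := Num.min d1 d2; have h0 : 0 < h by rewrite lt_min d10 d20.
have [a [b [/andP[a0 ah] /andP[b0 bh] E1]]] := mixed_difference x v w sf h0.
have [a' [b' [/andP[a0' ah'] /andP[b0' bh'] E2]]] := mixed_difference x w v sf h0.
have {E1 E2}E : 'D_w ('D_v f) (x + a *: v + b *: w) = 'D_v ('D_w f) (x + a' *: w + b' *: v).
  apply: (@mulfI _ (h ^+ 2)); first by rewrite expf_neq0// gt_eqF.
  rewrite (addrAC x (h *: w)) in E2.
  have aux (p q r s : R) : p - q - r + s = p - r - q + s by rewrite (addrAC p).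
  exact: (etrans (esym E1) (etrans (aux _ _ _ _) E2)).
have lt1 z : z < h -> z < d1 by move=> /lt_le_trans; apply; rewrite ge_min lexx.
have lt2 z : z < h -> z < d2 by move=> /lt_le_trans; apply; rewrite ge_min lexx orbT.
have {}H1 := H1 a b; have {}H2 := H2 a' b'; rewrite -E in H2.
have {}H1 : `|'D_w ('D_v f) x - 'D_w ('D_v f) (x + a *: v + b *: w)| <= e / 2.
  by apply: ltW; apply: H1; rewrite ?a0 ?b0/=; exact: lt1.
have {}H2 : `|'D_v ('D_w f) x - 'D_w ('D_v f) (x + a *: v + b *: w)| <= e / 2.
  by apply: ltW; apply: H2; rewrite ?a0' ?b0'/=; exact: lt2.
exact: norm_sub_le_half H1 H2.
Qed.

End OneSpace.

Section AffineComposition.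
Context (U V : normedModType R) (A l : U -> V).
Hypothesis Al : forall (h : R) x v, A (h *: v + x) = h *: l v + A x.
Hypothesis cA : continuous A.

(** By [Al], the difference quotients of the composite at [x] along [v] are literally those of [f]
    at [A x] along [l v]. Projections, slices and sections are all of this form. *)
Lemma is_derive_affine (f : V -> R) x v : smooth f ->
  is_derive x v (fun x => f (A x)) ('D_(l v) f (A x)).
Proof.
move=> sf.
have E : (fun h : R => h^-1 *: (((fun x => f (A x)) \o shift x) (h *: v)
          - f (A x))) =
    (fun h : R => h^-1 *: ((f \o shift (A x)) (h *: l v) - f (A x))).
  by apply/funext => h /=; rewrite Al.
apply: DeriveDef; last by rewrite /derive E.
by rewrite /derivable E; exact: smooth_derivable.
Qed.

Lemma derive_affine (f : V -> R) v : smooth f ->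
  'D_v (fun x => f (A x)) = (fun x => 'D_(l v) f (A x)).
Proof.
by move=> sf; apply/funext => x; have [] := is_derive_affine x v sf.
Qed.

Lemma smooth_affine (f : V -> R) : smooth f -> smooth (fun x => f (A x)).
Proof.
move=> sf; apply: (@smooth_coind _ [set g | exists2 f, smooth f & g = fun x => f (A x)]);
  last by exists f.
move=> _ [{sf}f sf ->]; split.
- move=> x; apply: (@continuous_comp _ _ _ A f); first exact: cA.
  exact: smooth_continuous.
- by move=> x v; have [] := is_derive_affine x v sf.
- move=> v; exists ('D_(l v) f); first exact: smooth_derive.
  exact: derive_affine.
Qed.
End AffineComposition.

Section TestFunctionTheory.
Context (V : normedModType R) (U : set V).
Implicit Types phi psi : V -> R.

Lemma test_smooth phi : test U phi -> smooth phi. Proof. by case. Qed.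

Lemma test_continuous phi : test U phi -> continuous phi.
Proof. by move=> /test_smooth/smooth_continuous. Qed.

Lemma test_out phi x : test U phi -> ~ U x -> phi x = 0.
Proof. by move=> [_ [K [_ KU K0]]] Ux; apply: K0 => /KU. Qed.

Lemma test0 : test U (fun _ => 0).
Proof.
split; first exact: smooth_cst.
by exists set0; split => //; exact: compact0.
Qed.

Lemma testZ (a : R) phi : test U phi -> test U (fun x => a * phi x).
Proof.
move=> [sp [K [cK KU K0]]]; split; first exact: smoothZ.
by exists K; split => // x /K0->; rewrite mulr0.
Qed.

Lemma testD phi psi : test U phi -> test U psi -> test U (fun x => phi x + psi x).
Proof.
move=> [sp [K [cK KU K0]]] [sp' [K' [cK' KU' K0']]]; split; first exact: smoothD.
exists (K `|` K'); split.
- exact: compactU.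
- by rewrite subUset.
- by move=> x /not_orP[/K0-> /K0'->]; rewrite addr0.
Qed.

(** The complement of [K] is open, so near a point outside [K] the function coincides with zero; the
    same [K] serves for the derivative. *)
Lemma test_derive v phi : test U phi -> test U ('D_v phi).
Proof.
move=> [sp [K [cK KU K0]]]; split; first exact: smooth_derive.
exists K; split => // x Kx.
have oK : open (~` K) by apply: closed_openC; apply: compact_closed => //; exact: norm_hausdorff.
have nK : nbhs x (~` K) by move: oK; rewrite openE; exact.
rewrite (@near_eq_derive _ _ _ phi (cst 0) x v).
  by rewrite derive_cst.
near=> y; rewrite K0//.
by near: y.
Unshelve. all: by end_near. Qed.

Lemma test_bounded phi : test U phi -> exists2 b : R, 0 <= b & forall x, `|phi x| <= b.
Proof.
move=> [sp [K [cK KU K0]]].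
have [K_|/set0P[x0 Kx0]] := eqVneq K set0.
  by exists 0 => // x; rewrite K0 ?normr0// K_.
have cp : {within K, continuous (fun x => `|phi x|)}.
  apply: continuous_subspaceT => x.
  by apply: cvg_norm; exact: smooth_continuous.
have [c _ Hc] := compact_EVT_max (ex_intro _ _ Kx0) cK cp.
exists `|phi c| => // x; have [Kx|Kx] := pselect (K x); first exact/Hc/mem_set.
by rewrite K0// normr0.
Qed.
End TestFunctionTheory.

Section Tensor.
Context (Y : crossSection R).

(** The type [pt] serves both for [(x, x^perp)] in [M] and for [(t, x^perp)] in [Q]. Freezing the
    time in [psi] turns a test function in [x] and a test function on [Q] into one on [M], for each
    [t]. *)
Definition tensor (phi : line R -> R) (psi : pt Y -> R) (t : line R) : pt Y -> R :=
  fun z => phi z.1 * psi (t, z.2).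

Lemma smooth_fst (phi : line R -> R) : smooth phi -> smooth (fun z : pt Y => phi z.1).
Proof.
apply: (@smooth_affine (pt Y) (line R) fst fst) => // z; exact: cvg_fst.
Qed.

Lemma derive_fst (phi : line R -> R) (v z : pt Y) : smooth phi ->
  'D_v (fun z : pt Y => phi z.1) z = 'D_(v.1) phi z.1.
Proof.
move=> sp.
by have [] := @is_derive_affine (pt Y) (line R) fst fst (fun _ _ _ => erefl) phi z v sp.
Qed.

Lemma affine_slice (t : line R) (h : R) (x v : pt Y) :
  ((t, (h *: v + x).2) : pt Y) = h *: ((0, v.2) : pt Y) + ((t, x.2) : pt Y).
Proof. by congr pair; rewrite /= scaler0 add0r. Qed.

Lemma smooth_slice (psi : pt Y -> R) t :
  smooth psi -> smooth (fun z : pt Y => psi (t, z.2)).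
Proof.
apply: (smooth_affine (affine_slice t)) => z.
apply: (@cvg_pair (pt Y) (line R) Y (nbhs z) (nbhs t) (nbhs z.2) _ _ _ (fun=> t) snd).
  exact: cvg_cst.
exact: cvg_snd.
Qed.

Lemma derive_slice (psi : pt Y -> R) t (v z : pt Y) : smooth psi ->
  'D_v (fun z : pt Y => psi (t, z.2)) z = 'D_((0, v.2) : pt Y) psi (t, z.2).
Proof.
by move=> sp; have [] := is_derive_affine (affine_slice t) z v sp.
Qed.

Lemma smooth_tensor phi psi t : smooth phi -> smooth psi -> smooth (tensor phi psi t).
Proof.
by move=> sp ss; apply: smoothM; [exact: smooth_fst|exact: smooth_slice].
Qed.

Lemma derive_tensor phi psi t (v z : pt Y) : smooth phi -> smooth psi ->
  'D_v (tensor phi psi t) z =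
  tensor ('D_(v.1) phi) psi t z + tensor phi ('D_((0, v.2) : pt Y) psi) t z.
Proof.
move=> sp ss; rewrite derive_smoothM; [|exact: smooth_fst|exact: smooth_slice].
rewrite derive_fst// derive_slice// addrC; congr (_ + _).
by rewrite mulrC.
Qed.

Lemma test_tensor (I J : set (line R)) (D : set Y) phi psi t :
  test I phi -> test (J `*` D) psi -> test (I `*` D) (tensor phi psi t).
Proof.
move=> [sp [K [cK KU K0]]] [ss [L [cL LU L0]]]; split; first exact: smooth_tensor.
exists (K `*` (snd @` L)); split.
- apply: compact_setX => //; apply: continuous_compact => //.
  by apply: continuous_subspaceT => z; exact: cvg_snd.
- by move=> [x y] [/= /KU Kx [[s y'] /LU[/= _ Dy] <-]].
- move=> [x y] Kxy; rewrite /tensor/=.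
  have [Kx|/K0->] := pselect (K x); last by rewrite mul0r.
  rewrite L0 ?mulr0// => Lty; apply: Kxy; split => //=.
  by exists (t, y).
Qed.
End Tensor.

End SmoothFunctions.

(** * Calculus on the line *)

Section LineCalculus.
Context (R : realType).
Local Notation L := (line R).

Lemma continuous_line_measurable (f : L -> R) : continuous f -> measurable_fun setT f.
Proof. exact: (@measurable_realfun.continuous_measurable_fun R f). Qed.

Lemma bounded_support_integrable (f : L -> R) (a b c : R) :
  measurable_fun setT f -> (forall x, `|f x| <= c) ->
  (forall x : L, ~ (a <= x <= b) -> f x = 0) ->
  (leb R).-integrable setT (EFin \o f).
Proof.
move=> mf bf sf.
have E : EFin \o f = (EFin \o f) \_ `[a, b].
  apply/funext => x; rewrite patchE; case: ifPn => // /negP; rewrite in_setE/= in_itv/=.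
  by move=> /sf /= ->.
rewrite E; apply/(@integrable_restrict _ _ _ (leb R)) => //=; rewrite setTI.
apply: (@measurable_bounded_integrable _ _ _ (leb R)) => //.
- by rewrite /leb/= lebesgue_measure_itv/=; case: ifPn => // _; rewrite -EFinB ltry.
- exact: measurable_funTS.
- by exists c; split; [exact: num_real|move=> y cy x _ /=; rewrite (le_trans (bf x))// ltW].
Qed.

Definition prim (f : L -> R) (x : L) : R := \int[leb R]_(t in `]-oo, (x : R)]) f t.

Lemma is_derive_prim (f : L -> R) (x : L) : continuous f ->
  (leb R).-integrable setT (EFin \o f) -> is_derive x (1 : R) (prim f) (f x).
Proof.
move=> cf fi.
have [| | | |d e] := @continuous_FTC1 R f (BInfty _ true) x (x + 1).
- by rewrite ltrDl.
- exact: (@integrableS _ _ _ (leb R) setT).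
- by rewrite ltNyr.
- exact: cf.
- by apply: DeriveDef; [exact: d|rewrite -derive1E; exact: e].
Qed.

(** [smooth] and [test] quantify over all directions [v] of [line R], whereas calculus on the line
    yields the derivative in direction 1. *)
Lemma is_derive_line (f : L -> R) (x v d : L) :
  is_derive x (1 : R) f d -> is_derive x v f (v * d).
Proof.
move=> fd.
have df : differentiable (f : R^o -> R) (x : R^o) by apply/derivable1_diffP; case: fd.
apply: DeriveDef; first exact: (@diff_derivable R R^o R f).
rewrite (@deriveE R R^o R)//.
have [_ <-] := fd; rewrite (@deriveE R R^o R)//.
by rewrite -[in LHS](mulr1 v) -[v * 1]/(v *: (1 : R^o)) linearZ.
Qed.

Lemma smooth_prim (f : L -> R) : smooth f ->
  (leb R).-integrable setT (EFin \o f) -> smooth (prim f).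
Proof.
move=> sf fi.
apply: (@smooth_coind R L [set g | g = prim f \/ smooth g]); last by left.
move=> g [->|sg].
- have D (x : L) (v : L) : is_derive x v (prim f) (v * f x).
    by apply: is_derive_line; apply: is_derive_prim => //; exact: smooth_continuous.
  split.
  + move=> x; apply: (@differentiable_continuous R R^o R).
    by apply/derivable1_diffP; have [] := D x 1.
  + by move=> x v; have [] := D x v.
  + move=> v; right; rewrite (_ : 'D_v _ = fun x => v * f x); first exact: smoothZ.
    by apply/funext => x; have [] := D x v.
- split.
  + exact: smooth_continuous.
  + by move=> x v; exact: smooth_derivable.
  + by move=> v; right; exact: smooth_derive.
Qed.

Lemma prim_left (f : L -> R) (a x : R) : (forall y : L, y <= a -> f y = 0) -> x <= a ->
  prim f x = 0.
Proof.
move=> f0 xa; rewrite /prim (@eq_Rintegral _ _ _ (leb R) _ (fun=> 0)).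
  by rewrite Rintegral_cst// mul0r.
by move=> y; rewrite in_setE/= in_itv/= => yx; rewrite f0// (le_trans yx).
Qed.

Lemma prim_right (f : L -> R) (b x : R) : (forall y : L, b <= y -> f y = 0) -> b <= x ->
  prim f x = \int[leb R]_t f t.
Proof.
move=> f0 bx; rewrite /prim [LHS]Rintegral_mkcond; congr (Rintegral _ _ _).
apply/funext => y; rewrite patchE; case: ifPn => // /negP; rewrite in_setE/= in_itv/=.
by move=> /negP; rewrite -ltNge => xy; rewrite f0// (le_trans bx)// ltW.
Qed.

(** The difference of the two functions has derivative zero, hence is constant, and it vanishes far
    to the left. *)
Lemma prim_derive (f : L -> R) (a b : R) : smooth f ->
  (forall x : L, ~ (a <= x <= b) -> f x = 0) ->
  (leb R).-integrable setT (EFin \o 'D_(1 : R) f) /\ prim ('D_(1 : R) f) = f.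
Proof.
move=> sf f0.
have sf' : smooth ('D_(1 : R) f : L -> R) by exact: smooth_derive.
have tf : test [set` `[a - 1, b + 1]] f.
  split; first exact: sf.
  exists [set` `[a - 1, b + 1]]; split; [exact: (@segment_compact R)|by []|].
  move=> x; rewrite /= in_itv/= => H; apply: f0 => /andP[ax xb]; apply: H.
  by rewrite lerBlDr (le_trans ax) ?lerDl// (le_trans xb)// lerDl.
have f'0 (x : L) : ~ (a - 1 <= x <= b + 1) -> 'D_(1 : R) f x = 0.
  by move=> H; apply: (test_out (test_derive _ tf)); rewrite /= in_itv.
have fi : (leb R).-integrable setT (EFin \o 'D_(1 : R) f).
  have [c _ fc] := test_bounded (test_derive (1 : R) tf).
  apply: (@bounded_support_integrable _ (a - 1) (b + 1) c) => //.
  by apply: continuous_line_measurable; exact: smooth_continuous.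
split => //.
have D (x : L) : is_derive x (1 : R) (fun x : L => prim ('D_(1 : R) f) x - f x) (0 : R).
  rewrite -(subrr ('D_(1 : R) f x)); apply: is_deriveB.
    by apply: is_derive_prim => //; exact: smooth_continuous.
  exact: is_derive_smooth.
have Z (x y : R) := @is_derive_0_is_cst R (fun x : L => prim ('D_(1 : R) f) x - f x) x y D.
apply/funext => x; apply/eqP; rewrite -subr_eq0; apply/eqP.
(* A comparison point to the left of [[a - 1, b + 1]], where both functions are zero. *)
pose y := Num.min (x : R) (a - 2).
have ya : y <= a - 2 by rewrite ge_min lexx orbT.
have -> := Z x y.
rewrite (@prim_left _ (a - 2))// ?sub0r ?f0 ?oppr0//.
  by move=> /andP[ay]; move: (le_trans ay ya); lra.
by move=> z za; apply: f'0 => /andP[az]; move: (le_trans az za); lra.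
Qed.

Lemma compact_in_itvoo (K : set L) (T : R) : 0 < T -> compact K -> K `<=` itvoo T ->
  exists a b : R, [/\ 0 < a, a <= b, b < T & K `<=` `[a, b]].
Proof.
move=> T0 cK KT; have [K_|/set0P K_] := eqVneq K set0.
  exists (T / 2), (T / 2); split => //; [by rewrite divr_gt0|by lra|by rewrite K_].
have ci : {within K, continuous (fun x : L => x : R)}.
  by apply: continuous_subspaceT => x; exact: cvg_id.
have [b /set_mem Kb Hb] := compact_EVT_max K_ cK ci.
have [a /set_mem Ka Ha] := compact_EVT_min K_ cK ci.
have := KT _ Ka; have := KT _ Kb; rewrite /itvoo/= !in_itv/= => /andP[b0 bT] /andP[a0 aT].
exists a, b; split => //; first by apply: Ha; exact: mem_set.
move=> x Kx /=; rewrite in_itv/=; apply/andP; split; [apply: Ha|apply: Hb]; exact: mem_set.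
Qed.

Lemma test_support (T : R) (phi : L -> R) : 0 < T -> test (itvoo T) phi ->
  exists a b : R, [/\ 0 < a, a <= b, b < T & forall x : L, ~ (a <= x <= b) -> phi x = 0].
Proof.
move=> T0 [sp [K [cK KU K0]]]; have [a [b [a0 ab bT Kab]]] := compact_in_itvoo T0 cK KU.
exists a, b; split => // x H; apply: K0 => /Kab; rewrite /= in_itv/=; exact: H.
Qed.

Lemma test_integrable (T : R) (phi : L -> R) : 0 < T -> test (itvoo T) phi ->
  (leb R).-integrable setT (EFin \o phi).
Proof.
move=> T0 tp; have [a [b [_ _ _ H]]] := test_support T0 tp.
have [c _ fc] := test_bounded tp.
apply: (bounded_support_integrable _ fc H).
by apply: continuous_line_measurable; exact: test_continuous tp.
Qed.

(** To the right of the support the primitive equals the total integral, so vanishing mean is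
    exactly what gives it compact support. *)
Lemma test_prim (T : R) (phi : L -> R) : 0 < T -> test (itvoo T) phi ->
  \int[leb R]_t phi t = 0 -> test (itvoo T) (prim phi) /\ 'D_(1 : R) (prim phi) = phi.
Proof.
move=> T0 tp p0; have [a [b [a0 ab bT H]]] := test_support T0 tp.
have ip := test_integrable T0 tp.
split; last first.
  apply/funext => x.
  by have [] := is_derive_prim x (test_continuous tp) ip.
split; first by apply: smooth_prim => //; exact: test_smooth tp.
(* [phi] need not vanish at [a] and [b]; moving the endpoints halfway to [0] and [T] leaves room
   while staying inside the open interval. *)
pose a' := a / 2; pose b' := (b + T) / 2.
exists [set` `[a', b']]; split.
- exact: (@segment_compact R).
- move=> x; rewrite /itvoo/= !in_itv/= /a' /b' => /andP[ax xb]; apply/andP; split; lra.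
- move=> x; rewrite /= in_itv/= => /negP; rewrite negb_and -!ltNge => /orP[xa|bx].
    apply: (@prim_left _ a') => [y ya|]; last exact: ltW.
    by apply: H => /andP[ay _]; move: (le_trans ay ya); rewrite /a'; lra.
  rewrite (@prim_right _ b')//; last exact: ltW.
  move=> y yb; apply: H => /andP[_ by_]; move: (le_trans yb by_); rewrite /b'; lra.
Qed.

End LineCalculus.

(** * Smooth bump functions *)

Section Bumps.
Context (R : realType).
Local Notation L := (line R).

(** The power [y ^+ n] is there for the induction on [q]: the part divisible by ['X] is absorbed by
    raising [n], and the constant coefficient is controlled by [y^n / n! <= e^y]. *)
Lemma exprM_expRN_bounded (q : {poly R}) (n : nat) :
  exists2 C : R, 0 <= C & forall y : R, 0 <= y -> `|y ^+ n * q.[y] * expR (- y)| <= C.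
Proof.
elim/poly_ind: q n => [|q c IH] n.
  by exists 0 => // y _; rewrite horner0 mulr0 mul0r normr0.
have [C C0 HC] := IH n.+1.
exists (C + `|c| * n`!%:R); first by rewrite addr_ge0// mulr_ge0.
move=> y y0; rewrite hornerMXaddC mulrDr mulrDl (le_trans (ler_normD _ _))//.
apply: lerD.
  by have := HC y y0; rewrite (_ : y ^+ n.+1 * _ = y ^+ n * (q.[y] * y))// exprSr; ring.
rewrite (mulrC _ c) -mulrA normrM ler_wpM2l// ger0_norm; last first.
  by rewrite mulr_ge0 ?exprn_ge0 ?expR_ge0.
rewrite expRN ler_pdivrMr ?expR_gt0//.
case: n {IH HC} => [|n]; first by rewrite expr0 fact0 mul1r (le_trans _ (expR_ge1Dx _))// lerDl.
rewrite -ler_pdivrMl ?ltr0n ?fact_gt0// mulrC.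
by apply: le_trans (expR_ge1Dxn n y0); rewrite lerDr.
Qed.

(** The classical function [e^(-1/x)], flat at 0, with a polynomial in [1/x] in front:
    differentiation acts on the polynomial by [q |-> 'X^2 * (q - q')], so the family is stable under
    derivatives. *)
Definition flat (q : {poly R}) : L -> R :=
  fun x : R => if 0 < x then q.[x^-1] * expR (- x^-1) else 0.

Lemma flat_bounded (q : {poly R}) : exists2 C : R, 0 <= C & forall x, `|flat q x| <= C.
Proof.
have [C C0 HC] := exprM_expRN_bounded q 0.
exists C => // x; rewrite /flat; case: ifPn => x0; last by rewrite normr0.
by have := HC (x^-1); rewrite expr0 mul1r; apply; rewrite invr_ge0 ltW.
Qed.

(** Extracting [x ^+ 2] shows that the difference quotient at 0 is [h] times a bounded function,
    which is how the derivative at 0 is found. *)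
Lemma flatX2 (q : {poly R}) (x : R) : flat q x = x ^+ 2 * flat ('X^2 * q) x.
Proof.
rewrite /flat; case: ifPn => x0; last by rewrite mulr0.
have E : x ^+ 2 * x^-1 ^+ 2 = 1 by rewrite -exprMn mulfV ?gt_eqF// expr1n.
by rewrite hornerM hornerXn -[LHS]mul1r -E; ring.
Qed.

Lemma is_derive_flat (q : {poly R}) (x : L) :
  is_derive x (1 : R) (flat q) (flat ('X^2 * (q - q^`())) x).
Proof.
have [x0|x0|x0] := ltgtP 0 (x : R).
- apply: (@near_eq_is_derive R R^o R (fun x : R => q.[x^-1] * expR (- x^-1))).
    near=> y; rewrite /flat ifT//; near: y; exact: lt_nbhsr.
  rewrite /flat x0.
  have xn0 : x != 0 :> R by rewrite gt_eqF.
  have H1 : is_derive (x : R) (1 : R) (fun x : R => x^-1) (- x ^- 2).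
    by have := @is_deriveV R id x 1 1 xn0 (is_derive_id _ _); rewrite scaler1.
  have H2 := is_derive1_comp (is_derive_poly q (x^-1)) H1.
  have H3 : is_derive (x : R) (1 : R) (fun x : R => - x^-1) (x ^- 2).
    by have := is_deriveN H1; rewrite opprK.
  have H4 := @is_derive1_comp R _ (fun x : R => - x^-1) x _ _ (is_derive_expR (- x^-1)) H3.
  have H5 := is_deriveM H2 H4.
  suff -> : ('X^2 * (q - q^`())).[x^-1] * expR (- x^-1) =
    q.[x^-1] *: (expR (- x^-1) / x ^+ 2) + expR (- x^-1) *: (q^`().[x^-1] * - x ^- 2).
    exact: H5.
  rewrite hornerM hornerD hornerN hornerXn /GRing.scale/=.
  by rewrite -exprVn; ring.
- apply: (@near_eq_is_derive R R^o R (cst 0)).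
    near=> y; rewrite /flat ifF//; apply/negbTE; rewrite -leNgt ltW//; near: y; exact: lt_nbhsl.
  by rewrite /flat ltNge ltW//=; exact: is_derive_cst.
- rewrite -x0 [flat _ 0]/flat ltxx.
  have [C C0 HC] := flat_bounded ('X^2 * q).
  have H : (fun h : R => h^-1 *: ((flat q \o shift (0 : R)) (h *: (1 : R)) - flat q (0 : R)))
     @ (0 : R)^' --> (0 : R).
    apply/cvgr0Pnorm_le => e e0; near=> h.
    rewrite /= /shift/= addr0 [X in flat q X]mulr1 {2}/flat ltxx subr0 flatX2.
    have h0 : h != 0 by near: h; exact: nbhs_dnbhs_neq.
    rewrite [X in `|X|](_ : _ = h * flat ('X^2 * q) h); last first.
      by rewrite /GRing.scale/= expr2 !mulrA mulVf// mul1r.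
    rewrite normrM (le_trans (ler_wpM2l _ (HC h)))//.
    have : `|h| <= e / (C + 1).
      near: h; apply: dnbhs0_le; rewrite divr_gt0// ltr_wpDl//.
    move=> /(ler_wpM2r C0)/le_trans; apply.
    rewrite mulrAC ler_pdivrMr ?ltr_wpDl// ler_wpM2l ?lerDl//; exact: ltW.
  apply: DeriveDef; first by apply/cvg_ex; exists 0.
  exact/cvg_lim.
Unshelve. all: by end_near. Qed.

Lemma smooth_flat (q : {poly R}) : smooth (flat q).
Proof.
apply: (@smooth_coind R L [set f | exists q, f = flat q]); last by exists q.
move=> f [p ->].
have D (x v : L) : is_derive x v (flat p) (v * flat ('X^2 * (p - p^`())) x).
  by apply: is_derive_line; exact: is_derive_flat.
split.
- move=> x; apply: (@differentiable_continuous R R^o R).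
  by apply/derivable1_diffP; have [] := D x 1.
- by move=> x v; have [] := D x v.
- move=> v; exists (v%:P * ('X^2 * (p - p^`()))); apply/funext => x.
  have [_ ->] := D x v; rewrite /flat; case: ifPn => _; last by rewrite mulr0.
  by rewrite [in RHS]hornerM hornerC mulrA.
Qed.

Lemma smooth_bump (a b : R) : exists2 f : L -> R, smooth f &
  forall x : R, if a < x < b then 0 < f x else f x == 0.
Proof.
pose A (x : L) : L := x - a; pose B (x : L) : L := b - x.
exists (fun x : L => flat 1 (A x) * flat 1 (B x)).
  apply: smoothM.
    apply: (@smooth_affine R L L A id); last exact: smooth_flat.
      by move=> h x v; rewrite /A addrA.
    by move=> x; apply: (@cvgB R R^o); [exact: cvg_id|exact: cvg_cst].
  apply: (@smooth_affine R L L B -%R); last exact: smooth_flat.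
    by move=> h x v; rewrite /B opprD scalerN addrCA.
  by move=> x; apply: (@cvgB R R^o); [exact: cvg_cst|exact: cvg_id].
move=> x; rewrite /flat /A /B !subr_gt0.
case: ifPn => [/andP[-> ->]|].
  by rewrite !hornerC !mul1r mulr_gt0 ?expR_gt0.
by rewrite negb_and => /orP[] /negbTE->; rewrite ?mul0r ?mulr0.
Qed.

Lemma test_bump (a b : R) : 0 < a -> a < b -> b < 1 -> exists f : L -> R,
  [/\ test (itvoo 1) f, forall x, 0 <= f x, forall x : R, ~~ (a < x < b) -> f x = 0 &
      0 < \int[leb R]_x f x].
Proof.
move=> a0 ab b1; have [f sf H] := smooth_bump a b.
have f0 x : 0 <= f x by have := H x; case: ifPn => [_ /ltW//|_ /eqP->].
have fE (x : R) : ~~ (a < x < b) -> f x = 0.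
  by move=> /negbTE xab; have := H x; rewrite xab => /eqP.
have tf : test (itvoo 1) f.
  split => //; exists [set` `[a, b]]; split; first exact: (@segment_compact R).
    move=> x; rewrite /itvoo/= !in_itv/= => /andP[ax xb].
    by rewrite (lt_le_trans a0)//= (le_lt_trans xb).
  move=> x; rewrite /= in_itv/= => /negP; apply: contraNeq => fx.
  apply/negP => /negP; rewrite negb_and -!ltNge => xab; move: fx; rewrite fE ?eqxx//.
  by rewrite negb_and -!leNgt; case/orP: xab => /ltW ->; rewrite ?orbT.
exists f; split => //.
(* A zero integral would force [f = 0] almost everywhere, yet [f > 0] on []a, b[], which has
   positive measure. *)
rewrite lt_neqAle Rintegral_ge0// andbT eq_sym; apply/eqP => I0.
have ci : (leb R).-integrable setT (EFin \o f) by apply: test_integrable tf.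
have : {ae leb R, forall x, setT x -> (EFin \o f) x = cst 0%E x}.
  apply/(ae_eq_integral_abs (leb R) measurableT); first by case/integrableP: ci.
  have : (\int[leb R]_x (EFin \o f) x)%E \is a fin_num by exact: integrable_fin_num.
  move=> /fineK; rewrite -/(Rintegral _ _ _) I0 => I0'; rewrite [RHS]I0'.
  by apply: eq_integral => x _; rewrite /= ger0_norm.
move=> [N [mN N0 HN]].
have : (leb R [set` `]a, b[] <= leb R N)%E.
  apply: le_measure; rewrite ?in_setE//.
  move=> x xab; apply: HN => /= /(_ I) [fx0].
  by have := H x; rewrite /= in_itv/= in xab; rewrite xab fx0 ltxx.
rewrite N0 /leb/= lebesgue_measure_itv/= lte_fin ab -EFinB lee_fin leNgt.
by rewrite subr_gt0 ab.
Qed.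

End Bumps.

(** * Fubini for real-valued integrals *)

Section ProductIntegrals.
Context (d1 d2 : measure_display) (T1 : measurableType d1) (T2 : measurableType d2)
  (R : realType).
Context (m1 : {sigma_finite_measure set T1 -> \bar R})
  (m2 : {sigma_finite_measure set T2 -> \bar R}).
Implicit Type f : T1 * T2 -> R.

(** Measurability of [f] suffices: the extended integral is the difference of the integrals of the
    positive and negative parts, each measurable in [x] by Tonelli, and [fine] is measurable. *)
Lemma measurable_Rintegral1 f : measurable_fun setT f ->
  measurable_fun setT (fun x => \int[m2]_y f (x, y)).
Proof.
move=> mf; rewrite /Rintegral.
have mEf : measurable_fun setT (EFin \o f) by exact/measurable_EFinP.
apply: (measurableT_comp (fine_measurable measurableT)).
rewrite (_ : (fun x => _) = (fubini_F m2 ((EFin \o f)^\+)%E \- fubini_F m2 ((EFin \o f)^\-)%E)%E).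
  apply: emeasurable_funB; apply: measurable_fun_fubini_tonelli_F => //.
    exact: measurable_funepos.
  exact: measurable_funeneg.
by apply/funext => x; rewrite [LHS]integralE/=; congr (_ - _)%E;
  apply: eq_integral => y _; rewrite /fubini_F /fubini_G ?(funeposE, funenegE).
Qed.

Lemma Rfubini1 f : (m1 \x m2)%E.-integrable setT (EFin \o f) ->
  m1.-integrable setT (EFin \o (fun x => \int[m2]_y f (x, y))) /\
  \int[m1]_x (\int[m2]_y f (x, y)) = \int[(m1 \x m2)%E]_z f z.
Proof.
move=> fi; have mf : measurable_fun setT f.
  by apply/measurable_EFinP; exact: measurable_int _ fi.
have iF := integrable_fubini_F fi.
have mg : measurable_fun setT (EFin \o (fun x => \int[m2]_y f (x, y))).
  by apply/measurable_EFinP; exact: measurable_Rintegral1.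
split.
  apply: (le_integrable measurableT mg _ iF) => x _ /=.
  (* [fine] sends an infinite inner integral to 0, so the domination holds at those points as
     well. *)
  rewrite /Rintegral /fubini_F; set a := (\int[m2]_y _)%E.
  by case: a => [r| |] //=; rewrite normr0 ?leey.
rewrite {1 3}/Rintegral -integral12_prod_meas1//; congr fine.
apply: ae_eq_integral => //; first exact: measurable_int _ iF.
apply: filterS (integrable_ae measurableT iF) => x /= /(_ I) H _.
by rewrite /Rintegral fineK.
Qed.

Lemma measurable_Rintegral2 f : measurable_fun setT f ->
  measurable_fun setT (fun y => \int[m1]_x f (x, y)).
Proof.
move=> mf; rewrite /Rintegral.
have mEf : measurable_fun setT (EFin \o f) by exact/measurable_EFinP.
apply: (measurableT_comp (fine_measurable measurableT)).
rewrite (_ : (fun x => _) = (fubini_G m1 ((EFin \o f)^\+)%E \- fubini_G m1 ((EFin \o f)^\-)%E)%E).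
  apply: emeasurable_funB; apply: measurable_fun_fubini_tonelli_G => //.
    exact: measurable_funepos.
  exact: measurable_funeneg.
by apply/funext => x; rewrite [LHS]integralE/=; congr (_ - _)%E;
  apply: eq_integral => y _; rewrite /fubini_F /fubini_G ?(funeposE, funenegE).
Qed.

Lemma integrable_fubini_G f : (m1 \x m2)%E.-integrable setT (EFin \o f) ->
  m2.-integrable setT (fubini_G m1 (EFin \o f)).
Proof.
move=> fi; have mf := measurable_int _ fi.
apply/integrableP; split; first exact: (measurable_fubini_G (m1 := m1) (m2 := m2) fi).
apply: le_lt_trans ((integrable21ltyP m1 m2 mf).1 fi).
apply: ge0_le_integral => //.
- by apply: measurableT_comp => //; exact: (measurable_fubini_G (m1 := m1) (m2 := m2) fi).
- by apply: (measurable_fun_fubini_tonelli_G (abse \o (EFin \o f))) => //=; exact: measurableT_comp.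
- by move=> y _; apply: le_abse_integral => //; exact: measurableT_comp.
Qed.

Lemma Rfubini2 f : (m1 \x m2)%E.-integrable setT (EFin \o f) ->
  m2.-integrable setT (EFin \o (fun y => \int[m1]_x f (x, y))) /\
  \int[m2]_y (\int[m1]_x f (x, y)) = \int[(m1 \x m2)%E]_z f z.
Proof.
move=> fi; have mf : measurable_fun setT f.
  by apply/measurable_EFinP; exact: measurable_int _ fi.
have iG := integrable_fubini_G fi.
have mg : measurable_fun setT (EFin \o (fun y => \int[m1]_x f (x, y))).
  by apply/measurable_EFinP; exact: measurable_Rintegral2.
split.
  apply: (le_integrable measurableT mg _ iG) => x _ /=.
  rewrite /Rintegral /fubini_G; set a := (\int[m1]_y _)%E.
  by case: a => [r| |] //=; rewrite normr0 ?leey.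
rewrite {1 3}/Rintegral -integral21_prod_meas1//; congr fine.
apply: ae_eq_integral => //; first exact: measurable_int _ iG.
apply: filterS (integrable_ae measurableT iG) => x /= /(_ I) H _.
by rewrite /Rintegral fineK.
Qed.

End ProductIntegrals.

(** * Reordering the variables *)

Section Shuffle.
Context (dO dA dX dY : measure_display) (O : measurableType dO) (A : measurableType dA)
  (X : measurableType dX) (Y : measurableType dY) (R : realType).
Context (mO : {sigma_finite_measure set O -> \bar R})
  (mA : {sigma_finite_measure set A -> \bar R})
  (mX : {sigma_finite_measure set X -> \bar R})
  (mY : {sigma_finite_measure set Y -> \bar R}).

(** Processes take [(omega, (t, (x, x^perp)))]. Pulling [x] to the front leaves
    [(omega, (t, x^perp))], a point of [Omega * pt Y], on which averages in [x] live. *)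
Definition shuffle (z : X * (O * (A * Y))) : O * (A * (X * Y)) :=
  (z.2.1, (z.2.2.1, (z.1, z.2.2.2))).

Lemma measurable_shuffle : measurable_fun setT shuffle.
Proof.
have m21 : measurable_fun setT (fun z : X * (O * (A * Y)) => z.2.1).
  exact: (measurableT_comp measurable_fst measurable_snd).
have m22 : measurable_fun setT (fun z : X * (O * (A * Y)) => z.2.2).
  exact: (measurableT_comp measurable_snd measurable_snd).
apply: measurable_fun_pair => //; apply: measurable_fun_pair.
  exact: (measurableT_comp measurable_fst m22).
apply: measurable_fun_pair => //.
exact: (measurableT_comp measurable_snd m22).
Qed.

Local Notation mZ' := (mX \x prod_measure mO (prod_measure mA mY))%E.
Local Notation mZ := (mO \x prod_measure mA (prod_measure mX mY))%E.
Local Open Scope ereal_scope.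

Lemma tonelli_shuffle (G : O * (A * (X * Y)) -> \bar R) : measurable_fun setT G ->
  (forall z, 0 <= G z) -> \int[mZ']_z G (shuffle z) = \int[mZ]_z G z.
Proof.
move=> mG G0.
have mGs : measurable_fun setT (G \o shuffle) by exact: (measurableT_comp mG measurable_shuffle).
have m1 (x : X) : measurable_fun setT (fun q => (G \o shuffle) (x, q)).
  exact: (measurableT_comp mGs (pair1_measurable x)).
have mG1 w : measurable_fun setT (fun q => G (w, q)) by exact: (measurableT_comp mG (pair1_measurable w)).
have mG2 w t : measurable_fun setT (fun q => G (w, (t, q))).
  exact: (measurableT_comp (mG1 w) (pair1_measurable t)).
rewrite fubini_tonelli1// fubini_tonelli1// /fubini_F.
transitivity (\int[mX]_x \int[mO]_w \int[prod_measure mA mY]_z G (w, (z.1, (x, z.2)))).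
  by apply: eq_integral => x _; rewrite [LHS]fubini_tonelli1//; exact: m1.
(* The variable [x] moves inwards one place at a time: here past [omega], below past [t]. *)
rewrite -(fubini_tonelli (fun p => \int[prod_measure mA mY]_z G (p.1, (z.1, (p.2, z.2))))); last 2 first.
- have mH : measurable_fun setT (fun s : (O * X) * (A * Y) =>
      (G \o shuffle) (s.1.2, (s.1.1, s.2))).
    apply: (measurableT_comp mGs); apply: measurable_fun_pair.
      exact: (measurableT_comp measurable_snd measurable_fst).
    apply: measurable_fun_pair => //.
    exact: (measurableT_comp measurable_fst measurable_fst).
  exact: (measurable_fun_fubini_tonelli_F (m2 := prod_measure mA mY) _ mH (fun _ => G0 _)).
- by move=> p; exact: integral_ge0.
apply: eq_integral => w _.
rewrite fubini_tonelli1 //= /fubini_F.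
transitivity (\int[mX]_x \int[mA]_t \int[mY]_y G (w, (t, (x, y)))).
  apply: eq_integral => x _; rewrite [LHS]fubini_tonelli1//.
  exact: (measurableT_comp (m1 x) (pair1_measurable w)).
rewrite (fubini_tonelli (fun p => \int[mY]_y G (w, (p.2, (p.1, y))))); last 2 first.
- have mH : measurable_fun setT (fun s : (X * A) * Y =>
      (G \o shuffle) (s.1.1, (w, (s.1.2, s.2)))).
    apply: (measurableT_comp mGs); apply: measurable_fun_pair.
      exact: (measurableT_comp measurable_fst measurable_fst).
    apply: measurable_fun_pair => //; apply: measurable_fun_pair => //.
    exact: (measurableT_comp measurable_snd measurable_fst).
  exact: (measurable_fun_fubini_tonelli_F (m2 := mY) _ mH (fun _ => G0 _)).
- by move=> p; exact: integral_ge0.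
apply: eq_integral => t _ /=.
by rewrite [RHS]fubini_tonelli1.
Qed.

Lemma integrable_shuffle (f : O * (A * (X * Y)) -> R) :
  mZ.-integrable setT (EFin \o f) ->
  mZ'.-integrable setT (EFin \o (f \o shuffle)) /\
  (\int[mZ']_z (f (shuffle z)) = \int[mZ]_z f z)%R.
Proof.
move=> /integrableP[mf fi]; split.
  apply/integrableP; split; first exact: (measurableT_comp mf measurable_shuffle).
  rewrite (tonelli_shuffle (G := fun z => `|(EFin \o f) z|))//.
  exact: measurableT_comp.
rewrite /Rintegral; congr fine; rewrite [LHS]integralE [RHS]integralE; congr (_ - _).
  rewrite -[RHS](tonelli_shuffle (G := (EFin \o f)^\+))//; last exact: measurable_funepos.
  by apply: eq_integral => z _; rewrite ?(funeposE, funenegE).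
rewrite -[RHS](tonelli_shuffle (G := (EFin \o f)^\-))//; last exact: measurable_funeneg.
by apply: eq_integral => z _; rewrite ?(funeposE, funenegE).
Qed.

End Shuffle.

(* Nothing in [measNormedType] relates the sigma-algebra to the topology. *)
Definition continuous_measurable (R : realType) (d : measure_display)
    (V : measNormedType d R) :=
  forall f : V -> R, continuous f -> measurable_fun setT f.

Section ContinuousMeasurable.
Context (R : realType).

Lemma floor_grid_cvg (t : R) :
  (fun n => (Num.floor (n.+1%:R * t))%:~R / n.+1%:R) @ \oo --> t.
Proof.
apply/cvgrPdist_le => e e0; near=> n.
have n0 : (0 : R) < n.+1%:R by rewrite ltr0n.
have /andP[lo hi] := floor_itv (n.+1%:R * t).
rewrite ger0_norm; last by rewrite subr_ge0 ler_pdivrMr// [t * _]mulrC.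
apply: (@le_trans _ _ n.+1%:R^-1).
  rewrite -(ler_pM2r n0) mulrBl divfK ?gt_eqF// mulVf ?gt_eqF// lerBlDr [t * _]mulrC.
  by apply: ltW; move: hi; rewrite intrD addrC.
near: n; have := near_infty_natSinv_lt (PosNum e0); apply: filterS => k; exact: ltW.
Unshelve. all: by end_near. Qed.

(** Rounding the first coordinate down to a multiple of [1/(n+1)] leaves countably many values, so
    preimages become countable unions of measurable rectangles; [f] is the pointwise limit by
    continuity. *)
Lemma continuous_measurable_prod (d : measure_display) (V : measNormedType d R) :
  continuous_measurable V -> continuous_measurable (line R * V)%type.
Proof.
move=> cV f cf.
pose g (n : nat) (t : line R) : line R := (Num.floor (n.+1%:R * (t : R)))%:~R / n.+1%:R.
apply: (@measurable_fun_cvg _ _ _ _ (fun n z => f (g n z.1, z.2))) => //.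
- move=> n _ B mB; rewrite setTI.
  rewrite (_ : _ @^-1` B = \bigcup_(k : int)
     ([set t : line R | Num.floor (n.+1%:R * (t : R)) = k] `*`
      [set z | B (f ((k%:~R / n.+1%:R : line R), z))])); last first.
    apply/seteqP; split => [[t z] /= Bz|[t z] [k _ [/= <-]]//].
    by exists (Num.floor (n.+1%:R * (t : R))).
  apply: countable_bigcupT_measurable => // k; apply: measurableX.
    rewrite (_ : [set t | _] = [set` `[(k%:~R / n.+1%:R), ((k + 1)%:~R / n.+1%:R)[%R]).
      exact: measurable_itv.
    apply/seteqP; split => t /=; rewrite in_itv/= ler_pdivrMr ?ltr0n// ltr_pdivlMr ?ltr0n//.
      by move=> <-; rewrite !(mulrC t); exact: floor_itv.
    by rewrite !(mulrC t) => H; exact: floor_def.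
  have mk : measurable_fun setT (fun z : V => f ((k%:~R / n.+1%:R : line R), z)).
    apply: cV => z; apply: continuous_comp; last exact: cf.
    by apply: (@cvg_pair V (line R) V (nbhs z) (nbhs _) (nbhs z) _ _ _ (fun=> _) id);
      [exact: cvg_cst|exact: cvg_id].
  by have := mk measurableT B mB; rewrite setTI.
- move=> [t z] _.
  apply: (@cvg_comp _ _ _ (fun n => (g n t, z)) f _ (nbhs (t, z))); last exact: cf.
  apply: (@cvg_pair nat (line R) V \oo (nbhs t) (nbhs z) _ _ _ (g^~ t) (fun=> z)).
    exact: floor_grid_cvg.
  exact: cvg_cst.
Qed.

End ContinuousMeasurable.

Section RealIntegrable.
Context (d : measure_display) (T : measurableType d) (R : realType)
  (m : {measure set T -> \bar R}).
Implicit Types f g : T -> R.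

Lemma integrable_measurable f : m.-integrable setT (EFin \o f) -> measurable_fun setT f.
Proof. by move=> fi; apply/measurable_EFinP; exact: measurable_int fi. Qed.

Lemma integrable_bddM (c : R) f g : measurable_fun setT g -> (forall x, `|g x| <= c) ->
  m.-integrable setT (EFin \o f) -> m.-integrable setT (EFin \o (fun x => g x * f x)).
Proof.
move=> mg gc fi; apply: (@le_integrable _ _ _ m _ measurableT _ (fun x => c%:E * (EFin \o f) x)%E).
- by apply/measurable_EFinP; apply: measurable_funM => //; exact: integrable_measurable.
- move=> x _ /=; rewrite lee_fin !normrM ler_wpM2r//.
  by rewrite (le_trans (gc x))// ler_norm.
- exact: integrableZl.
Qed.

Lemma integrable_add f g : m.-integrable setT (EFin \o f) ->
  m.-integrable setT (EFin \o g) -> m.-integrable setT (EFin \o (fun x => f x + g x)).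
Proof. by move=> fi gi; exact: (integrableD measurableT fi gi). Qed.

Lemma integrable_scale (c : R) f : m.-integrable setT (EFin \o f) ->
  m.-integrable setT (EFin \o (fun x => c * f x)).
Proof. by move=> fi; exact: (integrableZl measurableT c fi). Qed.

Lemma Rint_add f g : m.-integrable setT (EFin \o f) -> m.-integrable setT (EFin \o g) ->
  \int[m]_x (f x + g x) = \int[m]_x f x + \int[m]_x g x.
Proof. by move=> fi gi; rewrite RintegralD. Qed.

Lemma Rint_scale (c : R) f : m.-integrable setT (EFin \o f) ->
  \int[m]_x (c * f x) = c * \int[m]_x f x.
Proof. by move=> fi; rewrite RintegralZl. Qed.
End RealIntegrable.

Section ProductIntegrable.
Context (d1 d2 : measure_display) (T1 : measurableType d1) (T2 : measurableType d2)
  (R : realType).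
Context (m1 : {sigma_finite_measure set T1 -> \bar R})
  (m2 : {sigma_finite_measure set T2 -> \bar R}).

Lemma integrable_tensor (f : T1 -> R) (g : T2 -> R) :
  m1.-integrable setT (EFin \o f) -> m2.-integrable setT (EFin \o g) ->
  (m1 \x m2)%E.-integrable setT (EFin \o (fun z => f z.1 * g z.2)).
Proof.
move=> fi gi; have mf := integrable_measurable fi; have mg := integrable_measurable gi.
apply/integrable12ltyP.
  apply/measurable_EFinP; apply: measurable_funM.
    exact: (measurableT_comp mf measurable_fst).
  exact: (measurableT_comp mg measurable_snd).
rewrite (_ : (\int[m1]_x _)%E = (\int[m1]_x (`|f x|%:E * \int[m2]_y `|(g y)%:E|))%E); last first.
  apply: eq_integral => x _; rewrite -ge0_integralZl//.
  - by apply: eq_integral => y _; rewrite /= normrM EFinM.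
  - by apply: measurableT_comp => //; exact/measurable_EFinP.
rewrite ge0_integralZr//; last 2 first.
- by apply/measurable_EFinP; exact: measurableT_comp.
- exact: integral_ge0.
by apply: lte_mul_pinfty; [exact: integral_ge0| |by case/integrableP: gi];
  rewrite ge0_fin_numE ?integral_ge0//; case/integrableP: fi.
Qed.
End ProductIntegrable.

(** * Recovering a function from its weak derivative *)

Section PrimitiveRepresentation.
Context (R : realType).
Local Notation L := (line R).
Local Notation mu := (leb R).
Variable rho : L -> R.
Hypothesis rho_test : test (itvoo 1) rho.
Hypothesis rho_int : \int[mu]_x rho x = 1.

Definition kern (x s : L) : R := prim rho s - ((x : R) <= s)%R%:R.

Lemma measurable_prim (f : L -> R) : test (itvoo 1) f -> measurable_fun setT (prim f).
Proof.
move=> tf; apply: continuous_line_measurable.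
apply: smooth_continuous; apply: smooth_prim; first exact: test_smooth tf.
exact: test_integrable tf.
Qed.

Lemma measurable_kern : measurable_fun setT (fun z : L * L => kern z.1 z.2).
Proof.
apply: measurable_funB.
  exact: (measurableT_comp (measurable_prim rho_test) measurable_snd).
rewrite (_ : (fun _ => _) = (fun z : L * L => if (z.1 : R) <= z.2 then 1 else 0)).
  apply: measurable_fun_ifT => //.
  by apply: measurable_fun_ler; [exact: measurable_fst|exact: measurable_snd].
by apply/funext => z; case: (_ <= _).
Qed.

Lemma le_normr_Rint (f : L -> R) (A : set L) : measurable A ->
  mu.-integrable setT (EFin \o f) -> `|\int[mu]_(x in A) f x| <= \int[mu]_x `|f x|.
Proof.
move=> mA fi; have iA : mu.-integrable A (EFin \o f) by exact: (integrableS measurableT).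
have ni : mu.-integrable setT (EFin \o (fun x => `|f x|)) by exact: integrable_norm.
apply: (le_trans (le_normr_Rintegral mA iA)).
rewrite [leLHS]Rintegral_mkcond; apply: le_Rintegral => //.
  have := (integrable_restrict mu mA measurableT (EFin \o (fun x => `|f x|))).1.
  rewrite setTI restrict_EFin; apply.
  exact: (integrableS measurableT).
by move=> x _; rewrite patchE; case: ifP => //; rewrite normr_ge0.
Qed.

Lemma prim_bounded (f : L -> R) : mu.-integrable setT (EFin \o f) ->
  forall x, `|prim f x| <= \int[mu]_x `|f x|.
Proof. by move=> fi x; apply: le_normr_Rint. Qed.

Lemma kern_bounded : exists2 C : R, 0 <= C & forall x s, `|kern x s| <= C.
Proof.
have ri := test_integrable ltr01 rho_test.
exists (\int[mu]_x `|rho x| + 1) => [|x s].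
  by rewrite addr_ge0// Rintegral_ge0.
rewrite (le_trans (ler_normB _ _))// lerD ?prim_bounded//.
by case: ((x : R) <= s); rewrite ?normr1 ?normr0.
Qed.

(** Removing the mean of [phi] along [rho] leaves a function of zero integral, whose primitive is
    again a test function. Through it an arbitrary [phi] can be tested against a weak derivative. *)
Definition corr (phi : L -> R) : L -> R :=
  prim (fun x => phi x + (- \int[mu]_t phi t) * rho x).

Lemma test_corr phi : test (itvoo 1) phi -> test (itvoo 1) (corr phi) /\
  'D_(1 : R) (corr phi) = (fun x => phi x + (- \int[mu]_t phi t) * rho x).
Proof.
move=> tp; apply: test_prim => //; first by apply: testD => //; exact: testZ.
have pi := test_integrable ltr01 tp; have ri := test_integrable ltr01 rho_test.
rewrite Rint_add ?Rint_scale ?rho_int ?mulr1 ?subrr//; exact: integrable_scale.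
Qed.

(** The identity that determines [kern]: up to sign, [corr] is the transpose of the integral
    operator with this kernel. *)
Lemma corrE phi s : test (itvoo 1) phi ->
  corr phi s = - \int[mu]_x (phi x * kern x s).
Proof.
move=> tp; have pi := test_integrable ltr01 tp; have ri := test_integrable ltr01 rho_test.
have iS : measurable ([set` `]-oo, (s : R)]] : set L) by exact: measurable_itv.
have pSi : mu.-integrable setT (EFin \o (phi \_ [set` `]-oo, (s : R)]])).
  have := (integrable_restrict mu iS measurableT (EFin \o phi)).1.
  by rewrite setTI restrict_EFin; apply; exact: (integrableS measurableT).
have -> : \int[mu]_x (phi x * kern x s) =
    \int[mu]_x (prim rho s * phi x + (-1) * (phi \_ [set` `]-oo, (s : R)]]) x).
  apply: eq_Rintegral => x _; rewrite /kern patchE mulrBr mulrC mulN1r; congr (_ - _).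
  case: ifPn => [/set_mem|/negP]; rewrite ?in_setE/= in_itv/=; first by move->; rewrite mulr1.
  by move=> /negP/negbTE->; rewrite mulr0.
rewrite Rint_add ?Rint_scale//; try exact: integrable_scale.
rewrite -Rintegral_mkcond /corr /prim RintegralD//.
- rewrite RintegralZl//; last exact: (integrableS measurableT).
  by rewrite /prim; ring.
- exact: (integrableS measurableT).
- by apply: (integrableS measurableT) => //; exact: integrable_scale.
Qed.

Lemma integral_kernM (phi h : L -> R) : test (itvoo 1) phi ->
  mu.-integrable setT (EFin \o h) ->
  [/\ mu.-integrable setT (EFin \o (fun x => phi x * \int[mu]_s (kern x s * h s))) &
  \int[mu]_x (phi x * \int[mu]_s (kern x s * h s)) =
  - \int[mu]_s (corr phi s * h s)].
Proof.
move=> tp hi; have pi := test_integrable ltr01 tp.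
have [C C0 HC] := kern_bounded.
have fi : (mu \x mu)%E.-integrable setT
    (EFin \o (fun z : L * L => kern z.1 z.2 * (phi z.1 * h z.2))).
  apply: (integrable_bddM (c := C)) => //; first exact: measurable_kern.
  exact: integrable_tensor.
have E x : phi x * \int[mu]_s (kern x s * h s) = \int[mu]_s (kern x s * (phi x * h s)).
  rewrite -Rint_scale.
    by apply: eq_Rintegral => s _; rewrite mulrCA.
  apply: (integrable_bddM (c := C)) => //.
  exact: (measurableT_comp measurable_kern (pair1_measurable x)).
have [i1 e1] := Rfubini1 fi; have [i2 e2] := Rfubini2 fi.
split; first by rewrite (_ : (fun x => _) = (fun x => \int[mu]_s (kern x s * (phi x * h s)))) //; apply/funext.
under eq_Rintegral do rewrite E.
rewrite e1 -e2 -[RHS]mulN1r -Rint_scale; last first.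
  have [b _ Hb] := test_bounded (test_corr tp).1.
  apply: (integrable_bddM (c := b)) => //.
  by apply: continuous_line_measurable; exact: test_continuous (test_corr tp).1.
apply: eq_Rintegral => s _; rewrite corrE// mulN1r mulNr opprK mulrC -Rint_scale.
  by apply: eq_Rintegral => x _; rewrite /=; ring.
have -> : (fun x => phi x * kern x s) = (fun x => kern x s * phi x).
  by apply/funext => x; rewrite mulrC.
apply: (integrable_bddM (c := C)) => //.
exact: (measurableT_comp measurable_kern (pair2_measurable s)).
Qed.

(* The functional [l] plays the role of [phi |-> int phi W] for an unknown
   function [W] with weak derivative [h]. *)
Lemma primitive_representation (l : (L -> R) -> R) (h : L -> R) :
  (forall a phi psi, test (itvoo 1) phi -> test (itvoo 1) psi ->
     l (fun x => phi x + a * psi x) = l phi + a * l psi) ->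
  mu.-integrable setT (EFin \o h) ->
  (forall zeta, test (itvoo 1) zeta -> l ('D_(1 : R) zeta) = - \int[mu]_x (zeta x * h x)) ->
  forall phi, test (itvoo 1) phi ->
    \int[mu]_x (phi x * (l rho + \int[mu]_s (kern x s * h s))) = l phi.
Proof.
move=> lin hi lD phi tp; have pi := test_integrable ltr01 tp.
have [i1 e1] := integral_kernM tp hi.
under eq_Rintegral do rewrite mulrDr (mulrC _ (l rho)).
rewrite Rint_add ?Rint_scale//; last exact: integrable_scale.
have [t1 d1] := test_corr tp.
(* The derivative of [corr phi] is [phi] minus its mean times [rho], so [lin] produces [l phi] and a
   multiple of [l rho] that cancels the first term. *)
rewrite e1 -lD// d1 lin//.
by rewrite mulNr mulrC addrC subrK.
Qed.

End PrimitiveRepresentation.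

(** * Continuous functions orthogonal to all test functions *)

Section FundamentalLemma.
Context (R : realType).
Local Notation L := (line R).
Local Notation mu := (leb R).

Lemma measurable_itvoo (T : R) : measurable (itvoo T : set L).
Proof. exact: measurable_itv. Qed.

(** Test functions live in the open interval, whereas [x] may be an endpoint: the subinterval is
    taken to the right of [x] in the left half and to the left of [x] otherwise, and the bound
    [e <= 1/4] keeps it inside. *)
Lemma subinterval_near (x d : R) : 0 <= x <= 1 -> 0 < d ->
  exists a b : R, [/\ 0 < a, a < b, b < 1 & forall y, a < y < b -> `|x - y| < d].
Proof.
move=> /andP[x0 x1] d0; pose e := Num.min d (2^-1 : R) / 2.
have e0 : 0 < e by rewrite divr_gt0// lt_min d0/= invr_gt0.
have ed : e < d.
  by rewrite ltr_pdivrMr// (le_lt_trans (_ : _ <= d)) ?ge_min ?lexx//; lra.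
have e2 : e <= 4^-1.
  rewrite ler_pdivrMr// (@le_trans _ _ (2^-1)) ?ge_min ?lexx ?orbT//; lra.
have [xh|xh] := leP x (2^-1).
- exists (x + e / 2), (x + e); split; [lra|lra|lra|move=> y /andP[ya yb]].
  rewrite distrC gtr0_norm; lra.
- exists (x - e), (x - e / 2); split; [lra|lra|lra|move=> y /andP[ya yb]].
  rewrite gtr0_norm; lra.
Qed.

(** If [f x > 0], possibly at an endpoint, one-sided continuity gives [f > f x / 2] on an open
    subinterval of [(0, 1)] near [x], where a bump has a positive integral against [f]. *)
Lemma vanishing_of_test (f : L -> R) :
  (forall x : L, itvcc 1 x -> f @ within (itvcc 1) (nbhs x) --> f x) ->
  (forall phi, test (itvoo 1) phi -> \int[mu]_(x in itvoo 1) (phi x * f x) = 0) ->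
  forall x, itvcc 1 x -> f x = 0.
Proof.
wlog fpos : f / exists2 x, itvcc 1 x & 0 < f x.
  move=> W cf If x xI; apply/eqP; apply/negPn/negP => fx0.
  have [fx|fx|fx] := ltgtP (f x) 0; last by rewrite fx eqxx in fx0.
    have := W (fun x => - f x).
    have /[swap]/[apply] : exists2 x, itvcc 1 x & 0 < - f x by exists x; rewrite ?oppr_gt0.
    have /[swap]/[apply] : forall x : L, itvcc 1 x ->
       (fun x => - f x) @ within (itvcc 1) (nbhs x) --> - f x.
      by move=> y yI; apply: cvgN; exact: cf.
    have /[swap]/[apply] : forall phi, test (itvoo 1) phi ->
       \int[mu]_(x in itvoo 1) (phi x * - f x) = 0.
      move=> phi tp; have tp' := testZ (-1) tp; rewrite -[RHS](If _ tp').
      by apply: eq_Rintegral => y _; ring.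
    by move=> /(_ x xI) /eqP; rewrite oppr_eq0 => /eqP fx1; move: fx0; rewrite fx1 eqxx.
  by have := W f (ex_intro2 _ _ x xI fx) cf If x xI => fx1; rewrite fx1 eqxx in fx0.
move=> cf If ? ?; exfalso; have [x xI fx] := fpos.
have fx2 : 0 < f x / 2 by rewrite divr_gt0.
have /cvgrPdist_lt/(_ _ fx2) := cf x xI.
rewrite near_withinE => /nbhs_ballP[d /= d0 Hd].
have xI' : 0 <= (x : R) <= 1 by move: xI; rewrite /itvcc/= in_itv.
have [a [b [a0 ab b1 Hab]]] := subinterval_near xI' d0.
have [B [tB B0 Bout BI]] := test_bump a0 ab b1.
have lo y : itvoo 1 y -> (f x / 2) * B y <= B y * f y.
  move=> yI; have [yab|yab] := boolP (a < y < b); last by rewrite (Bout y yab) mul0r mulr0.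
  rewrite mulrC ler_wpM2l//.
  have : `|f x - f y| < f x / 2.
    apply: Hd; first exact: Hab.
    by move: yI; rewrite /itvoo /itvcc/= !in_itv/= => /andP[/ltW-> /ltW->].
  by rewrite ltr_distl => /andP[_]; lra.
have Bi := test_integrable ltr01 tB.
have fc : {within (itvcc 1 : set L), continuous f} by apply/subspace_continuousP.
have ficc : mu.-integrable (itvcc 1) (EFin \o f).
  apply: (@continuous_compact_integrable R f (itvcc 1)) => //.
  exact: (@segment_compact R).
have fioo : mu.-integrable (itvoo 1) (EFin \o f).
  apply: (integrableS _ _ _ ficc) => //; [exact: measurable_itv|exact: measurable_itv|].
  by apply: subset_itvW; rewrite ?lexx.
have : (f x / 2) * \int[mu]_(y in itvoo 1) B y <= \int[mu]_(y in itvoo 1) (B y * f y).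
  rewrite -RintegralZl; [|exact: measurable_itvoo|]; last first.
    exact: (integrableS measurableT (measurable_itvoo 1) (@subsetT _ _)).
  apply: le_Rintegral => //; first exact: measurable_itv.
  - apply: (integrableS measurableT (measurable_itvoo 1) (@subsetT _ _)).
    exact: integrable_scale.
  - have [c _ Hc] := test_bounded tB.
    apply: (@integrableMr _ _ _ mu _ _ B (EFin \o f)) => //; first exact: measurable_itv.
      by apply: measurable_funTS; apply: continuous_line_measurable; exact: test_continuous tB.
    by exists c; split; [exact: num_real|move=> y cy z _ /=; rewrite (le_trans (Hc z))// ltW].
rewrite If// leNgt mulr_gt0//.
rewrite (_ : \int[mu]_(y in itvoo 1) B y = \int[mu]_y B y)//.
rewrite Rintegral_mkcond; apply: eq_Rintegral => y _; rewrite patchE; case: ifPn => // /negP yI.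
by rewrite (test_out tB)// => yI'; apply: yI; exact: mem_set.
Qed.

End FundamentalLemma.

(** * Pathwise identities *)

Section PathwiseIdentity.
Context (R : realType) (T : R) (Y : crossSection R).
Hypothesis T0 : 0 < T.
Hypothesis mD : measurable (cs_dom Y).
Hypothesis cY : continuous_measurable (cs_space Y).
Local Notation L := (line R).
Local Notation mu := (leb R).
Local Notation mS := (prod_measure (leb R) (mupt Y)).
Local Notation QT := (@Q R T Y).
Local Notation MM := (@M R Y).

Lemma continuous_measurable_pt : continuous_measurable (pt Y).
Proof. exact: continuous_measurable_prod. Qed.

Lemma test_measurable (U : set (pt Y)) psi : test U psi -> measurable_fun setT psi.
Proof. by move=> tp; apply: continuous_measurable_pt; exact: test_continuous tp. Qed.

Lemma test_line_measurable (U : set L) phi : test U phi -> measurable_fun setT phi.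
Proof. by move=> tp; apply: continuous_line_measurable; exact: test_continuous tp. Qed.

Lemma measurable_Q : measurable QT.
Proof. by apply: measurableX => //; exact: measurable_itvoo. Qed.

Lemma measurable_M : measurable MM.
Proof. by apply: measurableX => //; exact: measurable_itvoo. Qed.

Lemma derive_tensor_dir1 phi (psi : pt Y -> R) t z : smooth phi -> smooth psi ->
  'D_(dir1 Y) (tensor phi psi t) z = tensor ('D_(1 : R) phi : L -> R) psi t z.
Proof.
move=> sp ss; rewrite derive_tensor//=.
by rewrite [X in _ + X]/tensor derive0 mulr0 addr0.
Qed.

Lemma derive_tensor_cross phi (psi : pt Y -> R) t (v : Y) z : smooth phi -> smooth psi ->
  'D_((0, v) : pt Y) (tensor phi psi t) z = tensor phi ('D_((0, v) : pt Y) psi) t z.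
Proof.
move=> sp ss; rewrite derive_tensor//=.
by rewrite [X in X + _]/tensor derive0 mul0r add0r.
Qed.

Definition lap_perp (psi : pt Y -> R) : pt Y -> R := fun z =>
  \sum_(v <- cs_basis Y) 'D_((0, v) : pt Y) ('D_((0, v) : pt Y) psi) z.

Lemma test_sum (I : Type) (r : seq I) (U : set (pt Y)) (f : I -> pt Y -> R) :
  (forall i, test U (f i)) -> test U (fun z => \sum_(i <- r) f i z).
Proof.
move=> tf; elim: r => [|i r IH].
  rewrite (_ : (fun _ => _) = fun=> 0); first exact: test0.
  by apply/funext => z; rewrite big_nil.
rewrite (_ : (fun _ => _) = fun z => f i z + \sum_(i <- r) f i z); first exact: testD.
by apply/funext => z; rewrite big_cons.
Qed.

Lemma derive_test_sum (I : Type) (r : seq I) (U : set (pt Y)) (f : I -> pt Y -> R) v z :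
  (forall i, test U (f i)) ->
  'D_v (fun z => \sum_(i <- r) f i z) z = \sum_(i <- r) 'D_v (f i) z.
Proof.
move=> tf; elim: r => [|i r IH].
  rewrite big_nil (_ : (fun _ => _) = cst 0); first by rewrite derive_cst.
  by apply/funext => y; rewrite big_nil.
rewrite (_ : (fun _ => _) = fun z => f i z + \sum_(i <- r) f i z); last first.
  by apply/funext => y; rewrite big_cons.
rewrite derive_smoothD ?big_cons ?IH//; first exact: test_smooth (tf i).
exact: test_smooth (test_sum r tf).
Qed.

Lemma test_lap_perp U psi : test U psi -> test U (lap_perp psi).
Proof. by move=> tp; apply: test_sum => v; do 2 apply: test_derive. Qed.

Lemma derive_lap_perp U psi v : test U psi -> 'D_v (lap_perp psi) = lap_perp ('D_v psi).
Proof.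
move=> tp; apply/funext => z; rewrite (@derive_test_sum _ _ U); last first.
  by move=> b; do 2 apply: test_derive.
apply: eq_bigr => b _; have sp := test_smooth tp.
have E : 'D_v ('D_((0, b) : pt Y) psi) = 'D_((0, b) : pt Y) ('D_v psi).
  by apply/funext => y; exact: (@deriveC_smooth R (pt Y) psi y ((0, b) : pt Y) v sp).
have E2 := congr1 (fun F => 'D_((0, b) : pt Y) F z) E.
have E3 := @deriveC_smooth R (pt Y) _ z ((0, b) : pt Y) v (smooth_derive ((0, b) : pt Y) sp).
exact: (etrans E3 E2).
Qed.

(* The transpose of [-(Delta + c) d/dx]. *)
Definition third_order (c : R) (phi : pt Y -> R) : pt Y -> R := fun z =>
  (\sum_(v <- dirs Y) 'D_(dir1 Y) ('D_v ('D_v phi)) z) + c * 'D_(dir1 Y) phi z.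

(** With the time frozen, [x]-derivatives fall on [phi] and transverse ones on [psi]: the [x] part
    of the Laplacian gives [phi'''], the remainder [phi'] times [lap_perp psi + c psi]. *)
Lemma third_order_tensor c (I : set L) (U : set (pt Y)) phi (psi : pt Y -> R) t :
  test I phi -> test U psi ->
  third_order c (tensor phi psi t) = fun z =>
   tensor ('D_(1 : R) ('D_(1 : R) ('D_(1 : R) phi)) : L -> R) psi t z +
   tensor ('D_(1 : R) phi : L -> R) (fun q => lap_perp psi q + c * psi q) t z.
Proof.
move=> /test_smooth sp /test_smooth ss; apply/funext => z; rewrite /third_order.
have sd (f : L -> R) : smooth f -> smooth ('D_(1 : R) f : L -> R) by exact: smooth_derive.
have sv (f : pt Y -> R) v : smooth f -> smooth ('D_v f) by exact: smooth_derive.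
have E1 (f : L -> R) : smooth f ->
  'D_(dir1 Y) (tensor f psi t) = tensor ('D_(1 : R) f : L -> R) psi t.
  by move=> sf; apply/funext => q; exact: derive_tensor_dir1.
have E2 (g : pt Y -> R) (v : Y) : smooth g ->
  'D_((0, v) : pt Y) (tensor phi g t) = tensor phi ('D_((0, v) : pt Y) g) t.
  by move=> sg; apply/funext => q; exact: derive_tensor_cross.
rewrite big_cons big_map -addrA (E1 _ sp) (E1 _ (sd _ sp)).
rewrite (derive_tensor_dir1 _ _ (sd _ (sd _ sp)) ss).
congr (_ + _); rewrite [RHS]/tensor/= mulrDr /lap_perp mulr_sumr; congr (_ + _).
  apply: eq_bigr => v _; rewrite (E2 _ v ss) (E2 _ v (sv _ _ ss)).
  exact: (derive_tensor_dir1 _ _ sp (sv _ _ (sv _ _ ss))).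
by rewrite (derive_tensor_dir1 _ _ sp ss) /tensor mulrCA.
Qed.

Definition tensor2 (a : L -> R) (b : pt Y -> R) : L * pt Y -> R :=
  fun q => tensor a b q.1 q.2.

Lemma measurable_tensor2 a b : measurable_fun setT a -> measurable_fun setT b ->
  measurable_fun setT (tensor2 a b).
Proof.
move=> ma mb.
have m21 : measurable_fun setT (fun z : L * pt Y => z.2.1).
  exact: (measurableT_comp measurable_fst measurable_snd).
have m22 : measurable_fun setT (fun z : L * pt Y => z.2.2).
  exact: (measurableT_comp measurable_snd measurable_snd).
apply: measurable_funM; first exact: (measurableT_comp ma m21).
apply: (measurableT_comp mb); apply: measurable_fun_pair => //; exact: measurable_fst.
Qed.

Lemma test_tensor2_measurable I U a b : test I a -> test U b ->
  measurable_fun setT (tensor2 a b).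
Proof.
move=> ta tb; apply: measurable_tensor2.
  exact: test_line_measurable ta.
exact: test_measurable tb.
Qed.

Lemma test_tensor2_bounded I U a b : test I a -> test U b ->
  exists2 c : R, 0 <= c & forall q, `|tensor2 a b q| <= c.
Proof.
move=> ta tb; have [ca ca0 Ha] := test_bounded ta; have [cb cb0 Hb] := test_bounded tb.
exists (ca * cb); first exact: mulr_ge0.
by move=> q; rewrite normrM ler_pM.
Qed.

Lemma test_section (b : pt Y -> R) (y : Y) : test QT b ->
  test (itvoo T) (fun t : L => b (t, y)) /\
  'D_(1 : R) (fun t : L => b (t, y)) = fun t => 'D_(dir1 Y) b (t, y).
Proof.
move=> tb.
have A (h : R) (x v : L) : ((h *: v + x, y) : pt Y) = h *: ((v, 0) : pt Y) + ((x, y) : pt Y).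
  by congr pair; rewrite /= scaler0 add0r.
have cA : continuous (fun t : L => ((t, y) : pt Y)).
  by move=> t; apply: (@cvg_pair L L Y (nbhs t) (nbhs t) (nbhs y) _ _ _ id (fun=> y));
    [exact: cvg_id|exact: cvg_cst].
have sb := test_smooth tb.
split; last first.
  by apply/funext => t; have [] := @is_derive_affine R L (pt Y) _ _ A b t 1 sb.
split; first exact: (@smooth_affine R L (pt Y) _ _ A cA).
have [_ [K [cK KU K0]]] := tb.
exists (fst @` K); split.
- apply: continuous_compact => //.
  by apply: continuous_subspaceT => z; exact: cvg_fst.
- by move=> t [z /KU[z1 _] <-].
- by move=> t Kt; apply: K0 => Kty; apply: Kt; exists (t, y).
Qed.

Lemma integral_tail_derive (f : L -> R) (s : L) : test (itvoo T) f ->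
  \int[mu]_t (((s : R) < t)%R%:R * 'D_(1 : R) f t) = - f s.
Proof.
move=> tf; have [a [b [a0 ab bT H]]] := test_support T0 tf.
have [fi pf] := prim_derive (test_smooth tf) H.
have -> : \int[mu]_t (((s : R) < t)%R%:R * 'D_(1 : R) f t) =
   \int[mu]_t ('D_(1 : R) f t + (-1) * ('D_(1 : R) f \_ [set` `]-oo, (s : R)]]) t).
  apply: eq_Rintegral => t _; rewrite patchE ltNge.
  case: ifPn => [/set_mem|/negP]; rewrite ?in_setE/= in_itv/=.
    by move=> -> /=; rewrite mul0r mulN1r subrr.
  by move=> /negP/negbTE->; rewrite mul1r mulr0 addr0.
have iS : measurable ([set` `]-oo, (s : R)]] : set L) by exact: measurable_itv.
have pSi : mu.-integrable setT (EFin \o ('D_(1 : R) f \_ [set` `]-oo, (s : R)]])).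
  have := (integrable_restrict mu iS measurableT (EFin \o 'D_(1 : R) f)).1.
  by rewrite setTI restrict_EFin; apply; exact: (integrableS measurableT).
rewrite Rint_add//; last exact: integrable_scale.
rewrite Rint_scale// -Rintegral_mkcond -/(prim _ _) pf mulN1r.
rewrite -(@prim_right _ ('D_(1 : R) f) (T + 1) (T + 1))//.
  by rewrite pf (test_out tf) ?add0r//= /itvoo/= in_itv/= => /andP[_]; lra.
move=> y yT; rewrite (test_out (test_derive (1 : R) tf))//= /itvoo/= in_itv/= => /andP[_ yT'].
by move: (le_lt_trans yT yT'); lra.
Qed.

Section TimeTerm.
Variables (a : L -> R) (b : pt Y -> R) (H : L * pt Y -> R) (t0 : R).
Hypothesis ta : test (itvoo 1) a.
Hypothesis tb : test QT b.
Hypothesis Hi : mS.-integrable setT (EFin \o H).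
Hypothesis H0 : forall s z, ~ itvoo T s -> H (s, z) = 0.

Local Notation b' := ('D_(dir1 Y) b).

(** A source term of the integrated equation at time [tau], tested with the function attached to
    time [t]. Keeping the two times apart allows the equation to be used at [tau = t] and at
    [tau = t0] with one and the same test function. *)
Definition time_integral (t : L) (tau : R) : R :=
  \int[mu]_(s in itvoo tau) \int[mupt Y]_z (H (s, z) * tensor a b' t z).

Lemma measurable_lt_nat d (X : measurableType d) (f g : X -> R) :
  measurable_fun setT f -> measurable_fun setT g ->
  measurable_fun setT (fun z => (f z < g z)%R%:R : R).
Proof.
move=> mf mg; rewrite (_ : (fun _ => _) = (fun z => if f z < g z then 1 else 0)).
  by apply: measurable_fun_ifT => //; exact: measurable_fun_ltr.
by apply/funext => z; case: (_ < _).
Qed.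

Lemma lt_nat_bounded (s t : R) : `|((s < t)%R%:R : R)| <= 1.
Proof. by case: (s < t); rewrite ?normr1 ?normr0. Qed.

Lemma tb' : test QT b'. Proof. exact: test_derive. Qed.

Lemma integrable_row (t : L) : mS.-integrable setT
  (EFin \o (fun q => H q * tensor a b' t q.2)).
Proof.
have [c c0 Hc] := test_tensor2_bounded ta tb'.
rewrite (_ : (fun q => _) = (fun q => tensor a b' t q.2 * H q)); last first.
  by apply/funext => q; rewrite mulrC.
apply: (integrable_bddM (c := c)) => //; last by move=> q; exact: (Hc (t, q.2)).
apply: (measurableT_comp (measurableT_comp (test_tensor2_measurable ta tb') (pair1_measurable t))).
exact: measurable_snd.
Qed.

Lemma integrable_row_lt (t : L) (tau : R) : mS.-integrable setT
  (EFin \o (fun q => ((q.1 : R) < tau)%R%:R * (H q * tensor a b' t q.2))).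
Proof.
apply: (integrable_bddM (c := 1)).
- by apply: measurable_lt_nat; [exact: measurable_fst|exact: measurable_cst].
- by move=> q; exact: lt_nat_bounded.
- exact: integrable_row.
Qed.

Lemma time_integralE (t : L) (tau : R) : time_integral t tau =
  \int[mS]_q (((q.1 : R) < tau)%R%:R * (H q * tensor a b' t q.2)).
Proof.
rewrite -[RHS](Rfubini1 (integrable_row_lt t tau)).2.
rewrite /time_integral Rintegral_mkcond; apply: eq_Rintegral => s _; rewrite patchE /=.
have [st|st] := boolP ((s : R) < tau); last first.
  rewrite memNset; last by rewrite /itvoo/= in_itv/= (negbTE st) andbF.
  rewrite (@eq_Rintegral _ _ _ (mupt Y) _ (fun=> 0)) ?Rintegral_cst ?mul0r//.
  by move=> z _; rewrite mul0r.
have [s0|s0] := pselect (0 < (s : R)).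
  rewrite mem_set; last by rewrite /itvoo/= in_itv/= s0 st.
  by apply: eq_Rintegral => z _; rewrite mul1r.
rewrite memNset; last by rewrite /itvoo/= in_itv/= => /andP[].
rewrite (@eq_Rintegral _ _ _ (mupt Y) _ (fun=> 0)) ?Rintegral_cst ?mul0r//.
by move=> z _; rewrite H0 ?mul0r ?mulr0// /itvoo/= in_itv/= => /andP[].
Qed.

(* The time integrals up to [t] and up to [t0] differ by the weight [step t]. *)
Definition step (t s : L) : R := ((s : R) < t)%R%:R - ((s : R) < t0)%R%:R.

Lemma measurable_step : measurable_fun setT (fun z : L * L => step z.1 z.2).
Proof.
apply: measurable_funB; apply: measurable_lt_nat;
  [exact: measurable_snd|exact: measurable_fst|exact: measurable_snd|exact: measurable_cst].
Qed.

Lemma step_bounded t s : `|step t s| <= 2.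
Proof.
rewrite /step (le_trans (ler_normB _ _))// (_ : 2 = 1 + 1)//.
by apply: lerD; exact: lt_nat_bounded.
Qed.

(** The indicator of [(0, T)] changes no value, as the time derivative of [b] vanishes outside; it
    exhibits the integrand as a bounded factor times a tensor product of integrable functions, ready
    for Fubini. *)
Definition kern3 (q : L * (L * pt Y)) : R :=
  (step q.1 q.2.1 * tensor a b' q.1 q.2.2) * (\1_(itvoo T) q.1 * H q.2).

Lemma integrable_itv_indic (tau : R) : mu.-integrable setT (EFin \o \1_(itvoo tau)).
Proof. exact: (integrable_indic_itv 0 tau false true). Qed.

Lemma integrable_kern3 : (mu \x mS)%E.-integrable setT (EFin \o kern3).
Proof.
have [c c0 Hc] := test_tensor2_bounded ta tb'.
apply: (@integrable_bddM _ _ _ _ (2 * c) (fun q => \1_(itvoo T) q.1 * H q.2)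
  (fun q => step q.1 q.2.1 * tensor a b' q.1 q.2.2)).
- apply: measurable_funM.
    have m1 : measurable_fun setT (fun q : L * (L * pt Y) => (q.1, q.2.1)).
      apply: measurable_fun_pair; first exact: measurable_fst.
      exact: (measurableT_comp measurable_fst measurable_snd).
    exact: (measurableT_comp measurable_step m1).
  have m2 : measurable_fun setT (fun q : L * (L * pt Y) => (q.1, q.2.2)).
    apply: measurable_fun_pair; first exact: measurable_fst.
    exact: (measurableT_comp measurable_snd measurable_snd).
  exact: (measurableT_comp (test_tensor2_measurable ta tb') m2).
- move=> q; rewrite normrM ler_pM//; first exact: step_bounded.
  exact: (Hc (q.1, q.2.2)).
- apply: integrable_tensor => //; exact: integrable_itv_indic.
Qed.

Lemma tensor_out (t : L) z : ~ itvoo T t -> tensor a b' t z = 0.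
Proof. by move=> tT; rewrite /tensor (test_out tb') ?mulr0// => -[]. Qed.

Lemma time_integralB (t : L) : time_integral t t - time_integral t t0 =
  \int[mS]_q (kern3 (t, q)).
Proof.
rewrite !time_integralE -[X in _ - X]mul1r -mulNr -Rint_scale; last exact: integrable_row_lt.
rewrite -Rint_add; [|exact: integrable_row_lt|apply: integrable_scale; exact: integrable_row_lt].
apply: eq_Rintegral => q _; rewrite /kern3 /= indicE /step.
have [tT|tT] := pselect (itvoo T t); first by rewrite mem_set//=; ring.
by rewrite tensor_out//; ring.
Qed.

Lemma integral_derive_section (y : Y) : \int[mu]_t b' (t, y) = 0.
Proof.
have [ty dy] := test_section y tb.
have [a1 [b1 [a0 ab bT Hs]]] := test_support T0 ty.
have [fi pf] := prim_derive (test_smooth ty) Hs.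
have /= <- : (fun t : L => b (t, y)) (T + 1) = 0.
  by apply: (test_out ty); rewrite /itvoo/= in_itv/= => /andP[_]; lra.
have /= <- := congr1 (fun F => F (T + 1)) pf.
rewrite dy (@prim_right _ _ T)//; last by rewrite lerDl.
by move=> z zT; rewrite (test_out tb')// => -[] /=; rewrite /itvoo/= in_itv/= => /andP[_ /(le_lt_trans zT)]; rewrite ltxx.
Qed.

(** The part of [step] that depends on [t0] is constant in [t] and meets a derivative of zero
    integral; the other part integrates that derivative from [s] on. *)
Lemma integral_step_section (s : L) (y : Y) :
  \int[mu]_t (step t s * b' (t, y)) = - b (s, y).
Proof.
have [ty dy] := test_section y tb.
have iy : mu.-integrable setT (EFin \o (fun t : L => b' (t, y))).
  rewrite -dy; apply: test_integrable T0 _; exact: test_derive.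
rewrite -[RHS]addr0 -[X in _ + X](mulr0 (- (((s : R) < t0)%R%:R))).
have dyt t := congr1 (fun F => F t) dy.
have /= <- := integral_tail_derive s ty.
under [X in _ = X + _]eq_Rintegral do rewrite dyt.
rewrite -(integral_derive_section y) -Rint_scale// -Rint_add//.
- by apply: eq_Rintegral => t _; rewrite /step; ring.
- apply: (integrable_bddM (c := 1)) => //.
    by apply: measurable_lt_nat; [exact: measurable_cst|exact: measurable_id].
  by move=> t; exact: lt_nat_bounded.
- exact: integrable_scale.
Qed.

(** Integration by parts in time, by Fubini: once the integral over [t] is innermost,
    [integral_step_section] replaces the weighted derivative of [b] by [- b]. *)
Lemma time_term :
  mu.-integrable setT (EFin \o (fun t => time_integral t t - time_integral t t0)) /\
  \int[mu]_t (time_integral t t - time_integral t t0) =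
  - \int[mS]_q (H q * tensor2 a b q).
Proof.
have E : (fun t => time_integral t t - time_integral t t0) =
   (fun t => \int[mS]_q (kern3 (t, q))) by apply/funext => t; exact: time_integralB.
have [i1 e1] := Rfubini1 integrable_kern3; have [_ e2] := Rfubini2 integrable_kern3.
rewrite E; split => //; rewrite [LHS]e1 -[LHS]e2.
have Hi2 : mS.-integrable setT (EFin \o (fun q => H q * tensor2 a b q)).
  have [c c0 Hc] := test_tensor2_bounded ta tb.
  rewrite (_ : (fun q => _) = (fun q => tensor2 a b q * H q)); last first.
    by apply/funext => q; rewrite mulrC.
  apply: (integrable_bddM (c := c)) => //.
  exact: test_tensor2_measurable ta tb.
rewrite -mulN1r -Rint_scale//; apply: eq_Rintegral => -[s z] _.
transitivity (\int[mu]_t ((a z.1 * H (s, z)) * (step t s * b' (t, z.2)))).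
  apply: eq_Rintegral => t _; rewrite /kern3/= indicE.
  have [tT|tT] := pselect (itvoo T t); first by rewrite mem_set//= /tensor; ring.
  by rewrite /tensor (test_out tb') ?mulr0 ?mul0r ?mulr0// => -[].
rewrite Rint_scale ?integral_step_section.
  by rewrite /tensor2 /tensor/=; ring.
have [ty dy] := test_section z.2 tb.
apply: (integrable_bddM (c := 2)).
- exact: (measurableT_comp measurable_step (pair2_measurable s)).
- by move=> t; exact: step_bounded.
- rewrite -dy; apply: test_integrable T0 _; exact: test_derive.
Qed.

End TimeTerm.

(** [G] is the state [u(t0)], which does not depend on [t]; only the integral over [t] of the
    derivative of [b] matters, and it is zero. *)
Lemma initial_term (a : L -> R) (b : pt Y -> R) (G : pt Y -> R) :
  test (itvoo 1) a -> test QT b -> (mupt Y).-integrable setT (EFin \o G) ->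
  mu.-integrable setT
    (EFin \o (fun t => \int[mupt Y]_z (G z * tensor a ('D_(dir1 Y) b) t z))) /\
  \int[mu]_t \int[mupt Y]_z (G z * tensor a ('D_(dir1 Y) b) t z) = 0.
Proof.
move=> ta tb Gi; have tb' : test QT ('D_(dir1 Y) b) by exact: test_derive.
have fi : (mu \x mupt Y)%E.-integrable setT (EFin \o (fun q : L * pt Y =>
    tensor2 a ('D_(dir1 Y) b) q * (\1_(itvoo T) q.1 * G q.2))).
  have [c c0 Hc] := test_tensor2_bounded ta tb'.
  apply: (integrable_bddM (c := c)) => //; first exact: test_tensor2_measurable ta tb'.
  by apply: integrable_tensor => //; exact: integrable_itv_indic.
have [i1 e1] := Rfubini1 fi; have [_ e2] := Rfubini2 fi.
have E t z : G z * tensor a ('D_(dir1 Y) b) t z =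
   tensor2 a ('D_(dir1 Y) b) (t, z) * (\1_(itvoo T) t * G z).
  rewrite /tensor2/= indicE; have [tT|tT] := pselect (itvoo T t).
    by rewrite mem_set//=; ring.
  by rewrite /tensor (test_out tb') ?mulr0 ?mul0r ?mulr0// => -[].
have E' : (fun t => \int[mupt Y]_z (G z * tensor a ('D_(dir1 Y) b) t z)) =
    (fun t => \int[mupt Y]_z (tensor2 a ('D_(dir1 Y) b) (t, z) * (\1_(itvoo T) t * G z))).
  by apply/funext => t; apply: eq_Rintegral => z _; exact: E.
rewrite E'; split => //; rewrite [LHS]e1 -[LHS]e2.
rewrite (@eq_Rintegral _ _ _ (mupt Y) _ (fun=> 0)) ?Rintegral_cst ?mul0r// => z _.
have [ty dy] := test_section z.2 tb.
transitivity (\int[mu]_t ((G z * a z.1) * 'D_(dir1 Y) b (t, z.2))).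
  by apply: eq_Rintegral => t _; rewrite -E /tensor; ring.
rewrite Rint_scale ?(integral_derive_section tb) ?mulr0//.
rewrite -dy; apply: test_integrable T0 _; exact: test_derive.
Qed.

End PathwiseIdentity.

Lemma ae_Rintegral (d : measure_display) (X : measurableType d) (R : realType)
    (m : {measure set X -> \bar R}) (f g : X -> R) :
  m.-integrable setT (EFin \o f) -> m.-integrable setT (EFin \o g) ->
  {ae m, forall x, f x = g x} -> \int[m]_x f x = \int[m]_x g x.
Proof.
move=> fi gi fg; rewrite /Rintegral; congr fine; apply: ae_eq_integral => //.
- exact: measurable_int fi.
- exact: measurable_int gi.
- by apply: filterS fg => x /= -> _.
Qed.

(** The equation at the times [t] and [t0]; [e] is the unknown value of [ut 0]. *)
Lemma linear_elimination (R : realType) (x z e f1 f2 a1 a2 b1 b2 : R) :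
  x - e = f1 + (a1 + b1) -> z - e = f2 + (a2 + b2) ->
  x - z = f1 - f2 + (a1 - a2 + (b1 - b2)).
Proof. by lra. Qed.

Section Pathwise.
Context (R : realType) (T : R) (Y : crossSection R).
Hypothesis T0 : 0 < T.
Hypothesis mD : measurable (cs_dom Y).
Hypothesis cY : continuous_measurable (cs_space Y).
Local Notation L := (line R).
Local Notation mu := (leb R).
Local Notation mS := (prod_measure (leb R) (mupt Y)).
Local Notation QT := (@Q R T Y).
Local Notation MM := (@M R Y).

Lemma ae_itvoo_exists (p : L -> Prop) : {ae mu, forall t, p t} ->
  exists2 t, itvoo T t & p t.
Proof.
move=> [N [mN N0 HN]]; apply/not_exists2P => H.
have : (mu (itvoo T) <= mu N)%E.
  apply: le_measure; rewrite ?in_setE//; first exact: measurable_itvoo.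
  by move=> t tT; apply: HN => /= pt; case: (H t).
rewrite N0 /leb/= /itvoo lebesgue_measure_itv/= lte_fin T0 -EFinB lee_fin subr0.
by rewrite leNgt T0.
Qed.

Definition ext2 (f : L -> pt Y -> R) : L * pt Y -> R :=
  (fun q => f q.1 q.2) \_ (itvoo T `*` MM).

Lemma ext2_out f s z : ~ itvoo T s -> ext2 f (s, z) = 0.
Proof. by move=> sT; rewrite /ext2 patchE memNset// => -[]. Qed.

Lemma regular_ext2 f s th : itvoo T s ->
  regular MM (f s) th = \int[mupt Y]_z (ext2 f (s, z) * th z).
Proof.
move=> sT; rewrite /regular Rintegral_mkcond; apply: eq_Rintegral => z _.
rewrite /ext2 !patchE; case: ifPn => [/set_mem zM|/negP zM].
  by rewrite mem_set.
by rewrite memNset ?mul0r// => -[_ /= zM']; apply: zM; exact: mem_set.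
Qed.

Section OneFunction.
Variables (f : L -> pt Y -> R).
Hypothesis fi : mS.-integrable setT (EFin \o ext2 f).

Lemma integrable_ext2M th : test MM th ->
  mS.-integrable setT (EFin \o (fun q => ext2 f q * th q.2)).
Proof.
move=> tt; have [c c0 Hc] := test_bounded tt.
rewrite (_ : (fun q => _) = (fun q => th q.2 * ext2 f q)); last first.
  by apply/funext => q; rewrite mulrC.
apply: (integrable_bddM (c := c)) => //.
exact: (measurableT_comp (test_measurable cY tt) measurable_snd).
Qed.

Lemma integrable_regular_time th (tau : R) : tau <= T -> test MM th ->
  mu.-integrable (itvoo tau) (EFin \o (fun s => regular MM (f s) th)).
Proof.
move=> tauT tt; have [i1 _] := Rfubini1 (integrable_ext2M tt).
apply: (@eq_integrable _ _ _ mu (itvoo tau) (measurable_itvoo tau)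
  (EFin \o (fun s => \int[mupt Y]_z (ext2 f (s, z) * th z)))).
- move=> s /set_mem sT /=; rewrite regular_ext2//.
  by move: sT; rewrite /itvoo/= !in_itv/= => /andP[-> /lt_le_trans->].
- exact: (integrableS measurableT (measurable_itvoo _) (@subsetT _ _) i1).
Qed.

Definition time_regular (tau : R) (th : pt Y -> R) : R :=
  \int[mu]_(s in itvoo tau) regular MM (f s) th.

Lemma time_regularE (tau : R) th : tau <= T -> test MM th ->
  time_regular tau th = \int[mS]_q (\1_(itvoo tau) q.1 * (ext2 f q * th q.2)).
Proof.
move=> tauT tt.
have i3 : mS.-integrable setT
    (EFin \o (fun q => \1_(itvoo tau) q.1 * (ext2 f q * th q.2))).
  apply: (integrable_bddM (c := 1)); last exact: integrable_ext2M.
  - apply: (measurableT_comp _ measurable_fst).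
    by apply: measurable_indic; exact: measurable_itvoo.
  - by move=> q; rewrite indicE; case: (_ \in _); rewrite ?normr1 ?normr0.
rewrite -[RHS](Rfubini1 i3).2 /time_regular Rintegral_mkcond; apply: eq_Rintegral => s _.
rewrite patchE /= indicE; case: ifPn => [/set_mem sT|_].
  rewrite regular_ext2; first by apply: eq_Rintegral => z _; rewrite mul1r.
  by move: sT; rewrite /itvoo/= !in_itv/= => /andP[-> /lt_le_trans->].
rewrite (@eq_Rintegral _ _ _ (mupt Y) _ (fun=> 0)) ?Rintegral_cst ?mul0r// => z _.
by rewrite mul0r.
Qed.

Lemma time_regular_lin (tau c : R) th1 th2 : tau <= T -> test MM th1 -> test MM th2 ->
  time_regular tau (fun z => th1 z + c * th2 z) =
  time_regular tau th1 + c * time_regular tau th2.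
Proof.
move=> tauT t1 t2.
have i3 th : test MM th -> mS.-integrable setT
    (EFin \o (fun q => \1_(itvoo tau) q.1 * (ext2 f q * th q.2))).
  move=> tt; apply: (integrable_bddM (c := 1)); last exact: integrable_ext2M.
  - apply: (measurableT_comp _ measurable_fst).
    by apply: measurable_indic; exact: measurable_itvoo.
  - by move=> q; rewrite indicE; case: (_ \in _); rewrite ?normr1 ?normr0.
rewrite !time_regularE//; last by apply: testD => //; exact: testZ.
rewrite -Rint_scale; last exact: i3.
rewrite -Rint_add; [|exact: i3|by apply: integrable_scale; exact: i3].
by apply: eq_Rintegral => q _; ring.
Qed.

Lemma time_regular_sum (I : Type) (r : seq I) (tau : R) (th : I -> pt Y -> R) :
  tau <= T -> (forall i, test MM (th i)) ->
  mu.-integrable (itvoo tau)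
    (EFin \o (fun s => \sum_(i <- r) regular MM (f s) (th i))) /\
  \int[mu]_(s in itvoo tau) (\sum_(i <- r) regular MM (f s) (th i)) =
  time_regular tau (fun z => \sum_(i <- r) th i z).
Proof.
move=> tauT tt; elim: r => [|i r [IH1 IH2]].
  rewrite (_ : (fun s => _) = (fun=> 0)); last by apply/funext => s; rewrite big_nil.
  split; first exact: (@integrable0 _ _ _ mu (itvoo tau)).
  rewrite time_regularE//; last by apply: test_sum.
  rewrite Rintegral_cst ?mul0r; last exact: measurable_itvoo.
  rewrite (@eq_Rintegral _ _ _ mS _ (fun=> 0)) ?Rintegral_cst ?mul0r// => q _.
  by rewrite big_nil !mulr0.
have E : (fun s => \sum_(j <- i :: r) regular MM (f s) (th j)) =
    (fun s => regular MM (f s) (th i) + \sum_(j <- r) regular MM (f s) (th j)).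
  by apply/funext => s; rewrite big_cons.
have i1 := integrable_regular_time tauT (tt i).
split; first by rewrite E; exact: (integrableD (measurable_itvoo tau) i1 IH1).
rewrite E (RintegralD (measurable_itvoo tau) i1 IH1).
rewrite IH2 -[X in X + _]/(time_regular tau (th i)).
have tl := time_regular_lin 1 tauT (tt i) (test_sum r tt); rewrite mul1r in tl.
rewrite -tl; congr (time_regular tau _); apply/funext => z.
by rewrite big_cons mul1r.
Qed.

(** Three transpositions in the third-order part and one in the first-order part, hence a common
    minus sign. *)
Lemma time_regular_laplace (tau c : R) th : tau <= T -> test MM th ->
  \int[mu]_(s in itvoo tau) (let ux := ddistr (dir1 Y) (regular MM (f s)) in
     laplace (dirs Y) ux th + c * ux th) = - time_regular tau (third_order c th).
Proof.
move=> tauT tt.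
have t3 v : test MM ('D_(dir1 Y) ('D_v ('D_v th))) by do 3 apply: test_derive.
have t1 : test MM ('D_(dir1 Y) th) by exact: test_derive.
have [i1 e1] := time_regular_sum (dirs Y) tauT t3.
have i2 := integrable_regular_time tauT t1.
rewrite /third_order time_regular_lin//; last exact: test_sum.
rewrite -e1 /time_regular -RintegralZl//; last exact: measurable_itvoo.
have i3 : mu.-integrable (itvoo tau)
    (EFin \o (fun s => c * regular MM (f s) ('D_(dir1 Y) th))).
  exact: (integrableZl (measurable_itvoo tau) c i2).
rewrite -RintegralD//; last exact: measurable_itvoo.
rewrite -mulN1r -RintegralZl; last 2 first.
- exact: measurable_itvoo.
- exact: (integrableD (measurable_itvoo tau) i1 i3).
apply: eq_Rintegral => s _; rewrite /laplace /ddistr /= mulN1r opprD mulrN; congr (_ + _).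
by rewrite -sumrN; apply: eq_bigr => v _; rewrite !opprK.
Qed.

Lemma time_regular_tensor (t : L) (tau : R) a b : tau <= T ->
  time_regular tau (tensor a ('D_(dir1 Y) b) t) =
  time_integral a b (ext2 f) t tau.
Proof.
move=> tauT; apply: eq_Rintegral => s /set_mem sT; apply: regular_ext2.
by move: sT; rewrite /itvoo/= !in_itv/= => /andP[-> /lt_le_trans->].
Qed.

End OneFunction.

(** The time derivative is pulled out of [lap_perp] so that both terms have the shape
    [tensor a (D_t b)] to which [time_term] applies. *)
Lemma third_order_tensor_dir1 (c : R) phi (psi : pt Y -> R) t :
  test (itvoo 1) phi -> test QT psi ->
  third_order c (tensor phi ('D_(dir1 Y) psi) t) = fun z =>
   tensor ('D_(1 : R) ('D_(1 : R) ('D_(1 : R) phi)) : L -> R) ('D_(dir1 Y) psi) t z + 1 *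
   tensor ('D_(1 : R) phi : L -> R) ('D_(dir1 Y) (fun q => lap_perp psi q + c * psi q)) t z.
Proof.
move=> tp ts; have ts' : test QT ('D_(dir1 Y) psi) by exact: test_derive.
rewrite (third_order_tensor c t tp ts'); apply/funext => z; rewrite mul1r; congr (_ + _).
rewrite /tensor; congr (_ * _).
have s1 : smooth (lap_perp psi) := test_smooth (test_lap_perp ts).
have s2 : smooth (fun q => c * psi q) := test_smooth (testZ c ts).
rewrite (derive_smoothD _ _ s1 s2) (derive_smoothZ _ _ _ (test_smooth ts)).
by congr (_ + _); have := congr1 (fun F => F (t, z.2)) (derive_lap_perp (dir1 Y) ts).
Qed.

Lemma integrable_tensor2M (H : L * pt Y -> R) a b : test (itvoo 1) a -> test QT b ->
  mS.-integrable setT (EFin \o H) ->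
  mS.-integrable setT (EFin \o (fun q => H q * tensor2 a b q)).
Proof.
move=> ta tb Hi; have [k k0 Hk] := test_tensor2_bounded ta tb.
rewrite (_ : (fun q => _) = (fun q => tensor2 a b q * H q)); last first.
  by apply/funext => q; rewrite mulrC.
apply: (integrable_bddM (c := k)) => //; exact: test_tensor2_measurable ta tb.
Qed.

Lemma time_integral_out (a : L -> R) b H (t : L) (tau : R) : test QT b -> ~ itvoo T t ->
  time_integral a b H t tau = 0.
Proof.
move=> tb tT; rewrite /time_integral (@eq_Rintegral _ _ _ mu _ (fun=> 0)).
  by rewrite Rintegral_cst ?mul0r//; exact: measurable_itvoo.
move=> s _; rewrite (@eq_Rintegral _ _ _ (mupt Y) _ (fun=> 0)) ?Rintegral_cst ?mul0r// => z _.
by rewrite (tensor_out a tb z tT) mulr0.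
Qed.

Section Identity.
Variables (c : R) (uw Fw : L -> pt Y -> R) (ut : L -> (pt Y -> R) -> R).
Hypothesis ui : mS.-integrable setT (EFin \o ext2 uw).
Hypothesis Fi : mS.-integrable setT (EFin \o ext2 Fw).
Hypothesis utE : {ae mu, forall t, itvoo T t -> forall phi, test MM phi ->
  ut t phi = regular MM (uw t) phi}.
Hypothesis ut_eq : forall t phi, itvcc T t -> test MM phi ->
  ut t phi
  + \int[mu]_(s in itvoo t)
      (let ux := ddistr (dir1 Y) (regular MM (uw s)) in
       laplace (dirs Y) ux phi + c * ux phi)
  = ut 0 phi + \int[mu]_(s in itvoo t) regular MM (Fw s) phi.

Variables (phi : L -> R) (psi : pt Y -> R).
Hypothesis tphi : test (itvoo 1) phi.
Hypothesis tpsi : test QT psi.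

Local Notation phi1 := ('D_(1 : R) phi : L -> R).
Local Notation phi3 := ('D_(1 : R) ('D_(1 : R) phi1) : L -> R).
Local Notation psi' := (fun q => lap_perp psi q + c * psi q).

Lemma pathwise_integrated (t : L) (tau : R) : 0 <= tau <= T ->
  ut tau (tensor phi ('D_(dir1 Y) psi) t) - ut 0 (tensor phi ('D_(dir1 Y) psi) t) =
  time_integral phi psi (ext2 Fw) t tau +
  (time_integral phi3 psi (ext2 uw) t tau + time_integral phi1 psi' (ext2 uw) t tau).
Proof.
move=> /andP[tau0 tauT].
have tpsi1 : test QT ('D_(dir1 Y) psi) by exact: test_derive.
have tpsi' : test QT psi' by apply: testD; [exact: test_lap_perp|exact: testZ].
have tpsi'1 : test QT ('D_(dir1 Y) psi') by exact: test_derive.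
have tphi1 : test (itvoo 1) phi1 by exact: test_derive.
have tphi3 : test (itvoo 1) phi3 by do 2 apply: test_derive.
have tt : test MM (tensor phi ('D_(dir1 Y) psi) t) by exact: test_tensor tphi tpsi1.
have tauI : itvcc T tau by rewrite /itvcc/= in_itv/= tau0 tauT.
have := ut_eq tauI tt.
rewrite (time_regular_laplace ui)// third_order_tensor_dir1//.
rewrite (time_regular_lin ui)//; [|exact: test_tensor tphi3 tpsi1|exact: test_tensor tphi1 tpsi'1].
rewrite !time_regular_tensor// -/(time_regular Fw _ _) time_regular_tensor// mul1r.
move=> /eqP; rewrite subr_eq => /eqP ->.
have aux (x y e : R) : x + y + e - x = y + e by ring.
exact: aux.
Qed.

Lemma pathwise_equation :
  \int[mS]_q (ext2 uw q * tensor2 phi ('D_(dir1 Y) psi) q) =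
  - (\int[mS]_q (ext2 Fw q * tensor2 phi psi q) +
     (\int[mS]_q (ext2 uw q * tensor2 phi3 psi q) +
      \int[mS]_q (ext2 uw q * tensor2 phi1 psi' q))).
Proof.
have tpsi1 : test QT ('D_(dir1 Y) psi) by exact: test_derive.
have tpsi' : test QT psi' by apply: testD; [exact: test_lap_perp|exact: testZ].
have tphi1 : test (itvoo 1) phi1 by exact: test_derive.
have tphi3 : test (itvoo 1) phi3 by do 2 apply: test_derive.
have aei := ae_integrable1 ui.
(* A time at which [ut] is given by [u] and [u(t0)] is integrable over [M]; both hold almost
   everywhere. *)
have [t0 t0T [ut0 ui0]] := ae_itvoo_exists (filterI utE aei).
have t0T' : 0 <= (t0 : R) <= T.
  by move: t0T; rewrite /itvoo/= in_itv/= => /andP[/ltW-> /ltW->].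
have u0 : forall s z, ~ itvoo T s -> ext2 uw (s, z) = 0 by move=> s z; exact: ext2_out.
have F0 : forall s z, ~ itvoo T s -> ext2 Fw (s, z) = 0 by move=> s z; exact: ext2_out.
have [iF eF] := time_term T0 cY t0 tphi tpsi Fi F0.
have [i3 e3] := time_term T0 cY t0 tphi3 tpsi ui u0.
have [i1 e1] := time_term T0 cY t0 tphi1 tpsi' ui u0.
have [iI eI] := initial_term T0 cY tphi tpsi ui0.
have [iU eU] := Rfubini1 (integrable_tensor2M tphi tpsi1 ui).
(* The subtracted term has integral zero by [initial_term]; with it the integrand is a difference of
   two instances of the equation. *)
transitivity (\int[mu]_t (\int[mupt Y]_z (ext2 uw (t, z) * tensor2 phi ('D_(dir1 Y) psi) (t, z)) +
   -1 * \int[mupt Y]_z (ext2 uw (t0, z) * tensor phi ('D_(dir1 Y) psi) t z))).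
  rewrite (Rint_add iU (integrable_scale (-1) iI)) (Rint_scale _ iI).
  by rewrite [X in _ + -1 * X]eI mulr0 addr0; exact: esym eU.
have ii : mu.-integrable setT (EFin \o (fun t =>
   (time_integral phi psi (ext2 Fw) t t - time_integral phi psi (ext2 Fw) t t0) +
   ((time_integral phi3 psi (ext2 uw) t t - time_integral phi3 psi (ext2 uw) t t0) +
    (time_integral phi1 psi' (ext2 uw) t t - time_integral phi1 psi' (ext2 uw) t t0)))).
  exact: (integrable_add iF (integrable_add i3 i1)).
have R1 := etrans (Rint_add iF (integrable_add i3 i1))
  (congr2 +%R eF (etrans (Rint_add i3 i1) (congr2 +%R e3 e1))).
have aux (x y z : R) : - (x + (y + z)) = - x + (- y + - z) by ring.
apply: (etrans _ (esym (aux _ _ _))); apply: (etrans _ R1).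
apply: (ae_Rintegral _ ii).
  exact: (integrable_add iU (integrable_scale (-1) iI)).
apply: filterS utE => t /= utt; rewrite mulN1r.
have [tT|tT] := pselect (itvoo T t); last first.
  rewrite !(time_integral_out _ _ _ tpsi tT) !(time_integral_out _ _ _ tpsi' tT).
  have z0 (G : pt Y -> R) :
      \int[mupt Y]_z (G z * tensor phi ('D_(dir1 Y) psi) t z) = 0.
    rewrite (@eq_Rintegral _ _ _ (mupt Y) _ (fun=> 0)) ?Rintegral_cst ?mul0r// => z _.
    by rewrite (tensor_out phi tpsi z tT) mulr0.
  rewrite !subr0 !addr0.
  apply: (etrans (congr2 (fun x y => x - y)
    (z0 (fun z => ext2 uw (t, z))) (z0 (fun z => ext2 uw (t0, z))))).
  exact: subr0.
have tT' : 0 <= (t : R) <= T.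
  by move: tT; rewrite /itvoo/= in_itv/= => /andP[/ltW-> /ltW->].
have tt : test MM (tensor phi ('D_(dir1 Y) psi) t) by exact: test_tensor tphi tpsi1.
have := pathwise_integrated t t0T'; have := pathwise_integrated t tT'.
rewrite (utt tT _ tt) (ut0 t0T _ tt) !regular_ext2//.
move=> E1 E2; exact: (linear_elimination E1 E2).
Qed.

End Identity.

Lemma pathwise_weak_derivative (uw vw : L -> pt Y -> R) phi psi :
  mS.-integrable setT (EFin \o ext2 uw) -> mS.-integrable setT (EFin \o ext2 vw) ->
  {ae mu, forall t, itvoo T t -> forall th, test MM th ->
     ddistr (dir1 Y) (regular MM (uw t)) th = regular MM (vw t) th} ->
  test (itvoo 1) phi -> test QT psi ->
  \int[mS]_q (ext2 uw q * tensor2 ('D_(1 : R) phi : L -> R) psi q) =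
  - \int[mS]_q (ext2 vw q * tensor2 phi psi q).
Proof.
move=> ui vi uv tphi tpsi.
have tphi1 : test (itvoo 1) ('D_(1 : R) phi : L -> R) by exact: test_derive.
have [iu eu] := Rfubini1 (integrable_tensor2M tphi1 tpsi ui).
have [iv ev] := Rfubini1 (integrable_tensor2M tphi tpsi vi).
rewrite -[LHS]eu -[X in - X]ev -mulN1r -Rint_scale//.
apply: ae_Rintegral => //; first exact: integrable_scale.
apply: filterS uv => t /= uvt; rewrite mulN1r.
have [tT|tT] := pselect (itvoo T t); last first.
  rewrite (@eq_Rintegral _ _ _ (mupt Y) _ (fun=> 0)); last first.
    by move=> z _; rewrite ext2_out// mul0r.
  rewrite [X in - X](@eq_Rintegral _ _ _ (mupt Y) _ (fun=> 0)); last first.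
    by move=> z _; rewrite ext2_out// mul0r.
  by rewrite Rintegral_cst// mul0r oppr0.
have tt : test MM (tensor phi psi t) by exact: test_tensor tphi tpsi.
rewrite -(regular_ext2 vw (tensor phi psi t) tT) -(uvt tT _ tt) /ddistr opprK.
rewrite (regular_ext2 _ _ tT); apply: eq_Rintegral => z _.
by rewrite derive_tensor_dir1//; [exact: test_smooth tphi|exact: test_smooth tpsi].
Qed.

End Pathwise.

(** * Square-integrable processes and their pairings *)

(* Nonnegative integrals are suprema over the simple functions below the
   integrand, so monotonicity needs no measurability. *)
Lemma ge0_le_integral_sup (d : measure_display) (X : measurableType d) (R : realType)
    (m : {measure set X -> \bar R}) (D : set X) (f g : X -> \bar R) :
  (forall x, D x -> 0 <= f x)%E -> (forall x, D x -> f x <= g x)%E ->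
  (\int[m]_(x in D) f x <= \int[m]_(x in D) g x)%E.
Proof.
move=> f0 fg; rewrite !ge0_integralE//; last first.
  by move=> x Dx; rewrite (le_trans (f0 x Dx))// fg.
apply: le_ereal_sup => _ [h Hh <-]; exists h => // x.
apply: (le_trans (Hh x)); rewrite !patchE; case: ifPn => // /set_mem; exact: fg.
Qed.

Section Processes.
Context (R : realType) (T : R) (Y : crossSection R).
Context (dO : measure_display) (Omega : measurableType dO) (P : probability Omega R).
Hypothesis T0 : 0 < T.
Hypothesis mD : measurable (cs_dom Y).
Hypothesis finD : (cs_measure Y (cs_dom Y) < +oo)%E.
Hypothesis cY : continuous_measurable (cs_space Y).
Local Notation L := (line R).
Local Notation mu := (leb R).
Local Notation mS := (prod_measure (leb R) (mupt Y)).
Local Notation mZ := (P \x mS)%E.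
Local Notation PW := (prod_measure P (mupt Y)).
Local Notation mZ' := (mu \x PW)%E.
Local Notation QT := (@Q R T Y).
Local Notation MM := (@M R Y).
Local Notation JD := (@jdom R T Y dO Omega).
Implicit Types (f : Omega * (L * pt Y) -> R).

Lemma measurable_jdom : measurable JD.
Proof.
by apply: measurableX => //; apply: measurableX; [exact: measurable_itvoo|exact: measurable_M].
Qed.

Definition ext (u : process Y Omega) : Omega * (L * pt Y) -> R := (jfun u) \_ JD.

Lemma ext_ext2 u w q : ext u (w, q) = ext2 T (u w) q.
Proof.
rewrite /ext /ext2 !patchE; have [qD|qD] := pselect ((itvoo T `*` MM) q).
  by rewrite !mem_set.
by rewrite !memNset// => -[].
Qed.

Lemma ext_out u z : ~ JD z -> ext u z = 0.
Proof. by move=> zD; rewrite /ext patchE memNset. Qed.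

Lemma measurable_ext u : measurable_fun JD (jfun u) -> measurable_fun setT (ext u).
Proof. by move=> mu_; apply/(measurable_restrictT _ measurable_jdom). Qed.

(** Vanishing off [jdom] is built in, so that all later integrals run over the whole product
    space. *)
Definition in_Lq (q : R) f := [/\ measurable_fun setT f, forall z, ~ JD z -> f z = 0 &
  (\int[mZ]_z (`|f z| `^ q)%:E < +oo)%E].

Lemma measurable_abs_powR (d : measure_display) (X : measurableType d) (q : R) (g : X -> R) :
  measurable_fun setT g -> measurable_fun setT (fun x => (`|g x| `^ q)%:E).
Proof.
move=> mg; apply/measurable_EFinP; apply: (measurableT_comp (measurable_powR q)).
exact: measurableT_comp.
Qed.

Lemma measure_itvoo_finite (b : R) : (mu (itvoo b) < +oo)%E.
Proof.
by rewrite /itvoo /leb/= lebesgue_measure_itv/=; case: ifPn; rewrite // -EFinB ltry.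
Qed.

Lemma measure_QT_finite : (mupt Y QT < +oo)%E.
Proof.
have -> : mupt Y QT = (mu (itvoo T) * cs_measure Y (cs_dom Y))%E.
  by apply: product_measure1E => //; exact: measurable_itvoo.
by apply: lte_mul_pinfty => //; rewrite ge0_fin_numE// measure_itvoo_finite.
Qed.

Lemma measure_MM_finite : (mupt Y MM < +oo)%E.
Proof.
have -> : mupt Y MM = (mu (itvoo 1) * cs_measure Y (cs_dom Y))%E.
  by apply: product_measure1E => //; exact: measurable_itvoo.
by apply: lte_mul_pinfty => //; rewrite ge0_fin_numE// measure_itvoo_finite.
Qed.

Lemma measure_jdom_finite : (mZ JD < +oo)%E.
Proof.
have mI := @measurable_itvoo R T; have mM := measurable_M mD.
rewrite product_measure1E//; last exact: measurableX.
have PT : (P setT < +oo)%E by rewrite probability_setT ltry.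
apply: lte_mul_pinfty; [by []|by rewrite ge0_fin_numE|].
have E : (mu \x mupt Y)%E (itvoo T `*` MM) = (mu (itvoo T) * mupt Y MM)%E.
  exact: product_measure1E.
apply: (eq_ind_r (fun z => (z < +oo)%E) _ E).
apply: lte_mul_pinfty => //; last exact: measure_MM_finite.
by rewrite ge0_fin_numE// measure_itvoo_finite.
Qed.

Lemma powR_ge_norm (q x : R) : 1 <= q -> `|x| <= 1 + `|x| `^ q.
Proof.
move=> q1; have [x1|x1] := leP `|x| 1.
  by rewrite (le_trans x1)// lerDl powR_ge0.
rewrite (@le_trans _ _ (`|x| `^ q))// ?lerDr//.
by rewrite -[leLHS]powRr1// ler_powR// ltW.
Qed.

(** [jdom] has finite measure and [|x| <= 1 + |x|^q]. *)
Lemma Lq_integrable (q : R) f : 1 <= q -> in_Lq q f -> mZ.-integrable setT (EFin \o f).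
Proof.
move=> q1 [mf f0 fi].
have i1 : mZ.-integrable setT (EFin \o (\1_JD : _ -> R)).
  apply/integrableP; split.
    by apply/measurable_EFinP; apply: measurable_indic; exact: measurable_jdom.
  rewrite (eq_integral (fun z => (\1_JD z)%:E)).
    by rewrite integral_indic ?setIT//; [exact: measure_jdom_finite|exact: measurable_jdom].
  by move=> z _; rewrite /= ger0_norm.
have i2 : mZ.-integrable setT (EFin \o (fun z => `|f z| `^ q)).
  apply/integrableP; split; first exact: measurable_abs_powR.
  by rewrite (eq_integral (fun z => (`|f z| `^ q)%:E))// => z _; rewrite /= ger0_norm// powR_ge0.
apply: (@le_integrable _ _ _ mZ _ measurableT _ (EFin \o (fun z => \1_JD z + `|f z| `^ q))).
- exact/measurable_EFinP.
- move=> z _; rewrite /= lee_fin [leRHS]ger0_norm; last by rewrite addr_ge0 ?powR_ge0.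
  rewrite indicE; have [zD|zD] := pselect (JD z).
    by rewrite mem_set//; exact: powR_ge_norm.
  by rewrite f0// normr0 addr_ge0 ?powR_ge0.
- exact: integrable_add.
Qed.

Lemma sqr_powR (x : R) : `|x| `^ 2 = x ^+ 2.
Proof. by rewrite (powR_mulrn 2)// real_normK ?num_real. Qed.

(** [h 0 = 0] is what makes the zero extension [ext u] contribute nothing outside [jdom]. *)
Lemma tonelli_jdom (u : process Y Omega) (h : R -> R) : measurable_fun setT h ->
  (forall x, 0 <= h x) -> h 0 = 0 -> measurable_fun JD (jfun u) ->
  (\int[mZ]_z (h (ext u z))%:E =
   \int[P]_w \int[mu]_(t in itvoo T) \int[mupt Y]_(z in MM) (h (u w t z))%:E)%E.
Proof.
move=> mh h0 h00 mu_.
have mhe : measurable_fun setT (fun z => (h (ext u z))%:E).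
  by apply/measurable_EFinP; apply: (measurableT_comp mh); exact: measurable_ext.
rewrite fubini_tonelli1//; last by move=> z; rewrite lee_fin.
apply: eq_integral => w _; rewrite /fubini_F fubini_tonelli1; last 2 first.
- exact: (measurableT_comp mhe (pair1_measurable w)).
- by move=> z; rewrite lee_fin.
rewrite [RHS]integral_mkcond; apply: eq_integral => t _; rewrite /fubini_F patchE.
case: ifPn => [/set_mem tT|/negP tT]; last first.
  apply: integral0_eq => z _; rewrite ext_out ?h00// => -[_ /= [tT' _]].
  by apply: tT; exact: mem_set.
rewrite [RHS]integral_mkcond; apply: eq_integral => z _; rewrite [RHS]patchE /ext patchE.
have [zM|zM] := pselect (MM z); first by rewrite !mem_set.
rewrite !memNset//; first exact: (congr1 EFin h00).
by move=> -[_ []].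
Qed.

(** Of the gradient only [v = u_x] is kept: transverse derivatives always end up on the test
    function. Both [u] and [v] are dominated by the integrand of the hypothesis. *)
Lemma L2L2H1_Lq (u : process Y Omega) : L2L2H1 T P u -> exists v : process Y Omega,
  [/\ in_Lq 2 (ext u), in_Lq 2 (ext v) &
   {ae P, forall w, {ae mu, forall t, itvoo T t -> forall phi, test MM phi ->
      ddistr (dir1 Y) (regular MM (u w t)) phi = regular MM (v w t) phi}}].
Proof.
move=> [mu_ [g [mg wd fin]]]; exists (g (dir1 Y)).
have d1 : dir1 Y \in dirs Y by rewrite mem_head.
have msq : measurable_fun setT (fun x : R => `|x| `^ 2).
  by apply: (measurableT_comp (measurable_powR 2)); exact: normr_measurable.
have sq0 : `|0 : R| `^ 2 = 0 by rewrite normr0 powR0// pnatr_eq0.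
have sq_ge0 (x : R) : 0 <= `|x| `^ 2 := powR_ge0 _ _.
have L2 (v : process Y Omega) : measurable_fun JD (jfun v) ->
    (forall w t z, v w t z ^+ 2 <= u w t z ^+ 2 + \sum_(v <- dirs Y) g v w t z ^+ 2) ->
    in_Lq 2 (ext v).
  move=> mv le_v; split; [exact: measurable_ext|exact: ext_out|].
  apply: (eq_ind_r (fun z => (z < +oo)%E) _ (tonelli_jdom msq sq_ge0 sq0 mv)).
  apply: (le_lt_trans _ fin); apply: ge0_le_integral_sup => w _.
    by do 2 apply: integral_ge0 => ? ?; rewrite lee_fin sq_ge0.
  apply: ge0_le_integral_sup => t tT; first by apply: integral_ge0 => ? ?; rewrite lee_fin sq_ge0.
  apply: ge0_le_integral_sup => z zM; rewrite lee_fin; first exact: sq_ge0.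
  by rewrite sqr_powR; exact: le_v.
split; last first.
- apply: filterS wd => w; apply: filterS => t H tT phi tphi; exact: H.
- apply: (L2 _ (mg _ d1)) => w t z.
  rewrite big_cons addrCA lerDl addr_ge0 ?sqr_ge0// sumr_ge0// => v _.
  exact: sqr_ge0.
- apply: (L2 _ mu_) => w t z; rewrite lerDl sumr_ge0// => v _.
  exact: sqr_ge0.
Qed.

Lemma slice_ext (F : process Y Omega) (x : L) q : itvoo 1 x ->
  ext F (shuffle (x, q)) = ((fun z => slice F x z.1 z.2) \_ (setT `*` QT)) q.
Proof.
case: q => w [t y] xI; rewrite /ext !patchE /shuffle/=.
have [[tT yD]|H] := pselect (QT (t, y)).
  by rewrite !mem_set//=; split => //=; split => //; split.
rewrite !memNset//= => [[_ H']|[_ [tT [_ yD]]]]; apply: H => //; by split.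
Qed.

Lemma shuffle_out (F : process Y Omega) (x : L) q : ~ itvoo 1 x ->
  ext F (shuffle (x, q)) = 0.
Proof. by move=> xI; rewrite ext_out// => -[_ [/= _ []]]. Qed.

(** Tonelli with [x] outermost: the inner integral is then the [p]-th power of the norm of a slice
    in [E]. *)
Lemma LpE_Lq (p : R) (F : process Y Omega) : 1 < p -> LpE T P p F -> in_Lq p (ext F).
Proof.
move=> p1 [mF fin]; have p0 : p != 0 by rewrite gt_eqF// (lt_trans ltr01).
split; [exact: measurable_ext|exact: ext_out|].
have mh := measurable_abs_powR p (measurable_ext mF).
rewrite -(tonelli_shuffle P mu mu (cs_measure Y) mh); last by move=> z; rewrite lee_fin powR_ge0.
rewrite fubini_tonelli1; last 2 first.
- exact: (measurableT_comp mh (@measurable_shuffle _ _ _ _ Omega L L Y)).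
- by move=> z; rewrite lee_fin powR_ge0.
apply: le_lt_trans fin; rewrite [leRHS]integral_mkcond.
apply: ge0_le_integral_sup => x _; first by apply: integral_ge0 => z _; rewrite lee_fin powR_ge0.
rewrite patchE; case: ifPn => [/set_mem xI|/negP xI].
  rewrite /normE poweR_Lnorm//; apply: ge0_le_integral_sup => q _.
    by rewrite lee_fin powR_ge0.
  rewrite slice_ext//.
  have [qQ|qQ] := pselect ((setT `*` QT) q).
    by rewrite !patchE !mem_set//= lexx.
  by rewrite !patchE !memNset//= lexx.
rewrite /fubini_F integral0_eq// => q _; rewrite shuffle_out ?normr0 ?powR0//.
by move=> xI'; apply: xI; exact: mem_set.
Qed.

Definition pairing f (A : set Omega) (b : pt Y -> R) (x : L) : R :=
  \int[PW]_q ((\1_A q.1 * b q.2) * f (shuffle (x, q))).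

Section Pairing.
Variables (f : Omega * (L * pt Y) -> R) (A : set Omega) (b : pt Y -> R) (kb : R).
Hypothesis fi : mZ.-integrable setT (EFin \o f).
Hypothesis mA : measurable A.
Hypothesis mb : measurable_fun setT b.
Hypothesis bb : forall z, `|b z| <= kb.

Lemma measurable_indic_factor : measurable_fun setT
  (fun z : L * (Omega * pt Y) => \1_A z.2.1 * b z.2.2).
Proof.
apply: measurable_funM.
  apply: (measurableT_comp (measurable_indic mA)).
  exact: (measurableT_comp measurable_fst measurable_snd).
apply: (measurableT_comp mb).
exact: (measurableT_comp measurable_snd measurable_snd).
Qed.

Lemma indic_factor_bounded (w : Omega) (z : pt Y) : `|\1_A w * b z| <= kb.
Proof.
rewrite normrM indicE; case: (_ \in _); rewrite ?normr1 ?mul1r// normr0 mul0r.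
by rewrite (le_trans _ (bb z)).
Qed.

Lemma integrable_pairing_kernel : mZ'.-integrable setT
  (EFin \o (fun z : L * (Omega * pt Y) => (\1_A z.2.1 * b z.2.2) * f (shuffle z))).
Proof.
have [i1 _] := integrable_shuffle fi.
apply: (integrable_bddM (c := kb)) => //; first exact: measurable_indic_factor.
by move=> z; exact: indic_factor_bounded.
Qed.

Lemma integrable_pairing : mu.-integrable setT (EFin \o pairing f A b).
Proof. exact: (Rfubini1 integrable_pairing_kernel).1. Qed.

Lemma ae_integrable_pairing : {ae mu, forall x, PW.-integrable setT
  (EFin \o (fun q => (\1_A q.1 * b q.2) * f (shuffle (x, q))))}.
Proof. exact: (ae_integrable1 integrable_pairing_kernel). Qed.

(** Exchanges two readings of the same integral: [x] outermost, for the scalar calculus in [x], and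
    [omega] outermost, where pathwise identities can be inserted. *)
Lemma integral_pairing (a : L -> R) (ka : R) : measurable_fun setT a ->
  (forall x, `|a x| <= ka) ->
  P.-integrable setT
    (EFin \o (fun w => \int[mS]_q (\1_A w * (f (w, q) * tensor2 a b q)))) /\
  \int[mu]_x (a x * pairing f A b x) =
  \int[P]_w \int[mS]_q (\1_A w * (f (w, q) * tensor2 a b q)).
Proof.
move=> ma ba; have mab := measurable_tensor2 ma mb.
have k0 : 0 <= ka by rewrite (le_trans _ (ba 0)).
have kb0 : 0 <= kb by rewrite (le_trans _ (bb 0)).
have i1 : mZ.-integrable setT
    (EFin \o (fun z => \1_A z.1 * (f z * tensor2 a b z.2))).
  rewrite (_ : (fun z => _) = (fun z => (\1_A z.1 * tensor2 a b z.2) * f z)); last first.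
    by apply/funext => z; ring.
  apply: (integrable_bddM (c := ka * kb)) => //.
    apply: measurable_funM.
      by apply: (measurableT_comp (measurable_indic mA)); exact: measurable_fst.
    exact: (measurableT_comp mab measurable_snd).
  move=> z; rewrite normrM indicE.
  have tb : `|tensor2 a b z.2| <= ka * kb by rewrite normrM ler_pM.
  case: (_ \in _); rewrite ?normr1 ?mul1r// normr0 mul0r; exact: mulr_ge0.
have [iP eP] := Rfubini1 i1; split => //.
have [iS eS] := integrable_shuffle i1.
have [iX eX] := Rfubini1 iS.
apply: (etrans _ (esym eP)); apply: (etrans _ eS); apply: (etrans _ eX).
apply: ae_Rintegral => //.
  exact: (integrable_bddM ma ba integrable_pairing).
apply: filterS ae_integrable_pairing => x ix.
rewrite /pairing -(Rint_scale _ ix); apply: eq_Rintegral => -[w [t y]] _.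
by rewrite /shuffle/= /tensor2 /tensor/=; ring.
Qed.

End Pairing.

End Processes.

(** * Weak equations in x for the pairings *)

Section PairingIdentities.
Context (R : realType) (T : R) (Y : crossSection R).
Context (dO : measure_display) (Omega : measurableType dO) (P : probability Omega R).
Hypothesis T0 : 0 < T.
Hypothesis mD : measurable (cs_dom Y).
Hypothesis cY : continuous_measurable (cs_space Y).
Local Notation L := (line R).
Local Notation mu := (leb R).
Local Notation mS := (prod_measure (leb R) (mupt Y)).
Local Notation mZ := (P \x mS)%E.
Local Notation PW := (prod_measure P (mupt Y)).
Local Notation QT := (@Q R T Y).
Local Notation MM := (@M R Y).

Lemma ae_ext2_integrable (u : process Y Omega) :
  mZ.-integrable setT (EFin \o ext T u) ->
  {ae P, forall w, mS.-integrable setT (EFin \o ext2 T (u w))}.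
Proof.
move=> ui; apply: filterS (ae_integrable1 ui) => w.
by apply: (eq_integrable _ _) => // q _; rewrite /= ext_ext2.
Qed.

Lemma integral_pairing_test (u : process Y Omega) (A : set Omega) a b :
  mZ.-integrable setT (EFin \o ext T u) -> measurable A ->
  test (itvoo 1) a -> test QT b ->
  P.-integrable setT (EFin \o (fun w =>
    \int[mS]_q (\1_A w * (ext T u (w, q) * tensor2 a b q)))) /\
  \int[mu]_x (a x * pairing P (ext T u) A b x) =
  \int[P]_w \int[mS]_q (\1_A w * (ext T u (w, q) * tensor2 a b q)).
Proof.
move=> ui mA ta tb.
have [ka _ Ha] := test_bounded ta; have [kb _ Hb] := test_bounded tb.
apply: (integral_pairing ui mA (test_measurable cY tb) Hb (test_line_measurable ta) Ha).
Qed.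

Lemma inner_ext2 (u : process Y Omega) (A : set Omega) a b w :
  mS.-integrable setT (EFin \o ext2 T (u w)) ->
  test (itvoo 1) a -> test QT b ->
  \int[mS]_q (\1_A w * (ext T u (w, q) * tensor2 a b q)) =
  \1_A w * \int[mS]_q (ext2 T (u w) q * tensor2 a b q).
Proof.
move=> ui ta tb; rewrite -Rint_scale; last exact: (integrable_tensor2M cY ta tb ui).
by apply: eq_Rintegral => q _; rewrite ext_ext2.
Qed.

Lemma pairing_weak_derivative (u v : process Y Omega) (A : set Omega) phi psi :
  mZ.-integrable setT (EFin \o ext T u) -> mZ.-integrable setT (EFin \o ext T v) ->
  {ae P, forall w, {ae mu, forall t, itvoo T t -> forall th, test MM th ->
      ddistr (dir1 Y) (regular MM (u w t)) th = regular MM (v w t) th}} ->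
  measurable A -> test (itvoo 1) phi -> test QT psi ->
  \int[mu]_x ('D_(1 : R) phi x * pairing P (ext T u) A psi x) =
  - \int[mu]_x (phi x * pairing P (ext T v) A psi x).
Proof.
move=> ui vi uv mA tp ts; have tp1 : test (itvoo 1) ('D_(1 : R) phi : L -> R) by exact: test_derive.
have [iu eu] := integral_pairing_test ui mA tp1 ts.
have [iv ev] := integral_pairing_test vi mA tp ts.
rewrite [LHS]eu [X in - X]ev -mulN1r -(Rint_scale _ iv).
apply: (ae_Rintegral iu (integrable_scale _ iv)).
apply: filterS3 uv (ae_ext2_integrable ui) (ae_ext2_integrable vi) => w uvw uiw viw.
rewrite (inner_ext2 A uiw tp1 ts) (inner_ext2 A viw tp ts).
rewrite (pathwise_weak_derivative cY uiw viw uvw tp ts).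
by rewrite mulrN mulN1r.
Qed.

Lemma cancel_terms (a b d : R) : a = b + (-1 * (b + (- a - d)) - d).
Proof. by ring. Qed.

(** The weak form in [x] of [(u_x)_xx = F - u_t - (Delta^perp + c) u_x]. Integrating
    [pathwise_equation] over [A] puts [phi'''] and [phi'] against [u]; one derivative in each is
    then traded for [v = u_x]. *)
Lemma pairing_equation (c : R) (F u v : process Y Omega) (A : set Omega) phi psi :
  mZ.-integrable setT (EFin \o ext T u) -> mZ.-integrable setT (EFin \o ext T v) ->
  mZ.-integrable setT (EFin \o ext T F) ->
  {ae P, forall w, {ae mu, forall t, itvoo T t -> forall th, test MM th ->
      ddistr (dir1 Y) (regular MM (u w t)) th = regular MM (v w t) th}} ->
  solves T P c F u ->
  measurable A -> test (itvoo 1) phi -> test QT psi ->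
  \int[mu]_x ('D_(1 : R) ('D_(1 : R) phi : L -> R) x * pairing P (ext T v) A psi x) =
  \int[mu]_x (phi x * pairing P (ext T F) A psi x) +
  (\int[mu]_x (phi x * pairing P (ext T u) A ('D_(dir1 Y) psi) x) -
   \int[mu]_x (phi x * pairing P (ext T v) A (fun z => lap_perp psi z + c * psi z) x)).
Proof.
move=> ui vi Fi uv [ut sol] mA tp ts.
have tp1 : test (itvoo 1) ('D_(1 : R) phi : L -> R) by exact: test_derive.
have tp2 : test (itvoo 1) ('D_(1 : R) ('D_(1 : R) phi : L -> R) : L -> R) by exact: test_derive.
have tp3 : test (itvoo 1) ('D_(1 : R) ('D_(1 : R) ('D_(1 : R) phi : L -> R) : L -> R) : L -> R).
  exact: test_derive.
have ts1 : test QT ('D_(dir1 Y) psi) by exact: test_derive.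
have ts' : test QT (fun z => lap_perp psi z + c * psi z).
  by apply: testD; [exact: test_lap_perp|exact: testZ].
have E3 := pairing_weak_derivative ui vi uv mA tp2 ts.
have E1 := pairing_weak_derivative ui vi uv mA tp ts'.
have [i0 e0] := integral_pairing_test ui mA tp ts1.
have [iF eF] := integral_pairing_test Fi mA tp ts.
have [i3 e3] := integral_pairing_test ui mA tp3 ts.
have [i1 e1] := integral_pairing_test ui mA tp1 ts'.
have E : \int[mu]_x (phi x * pairing P (ext T u) A ('D_(dir1 Y) psi) x) =
  -1 * (\int[mu]_x (phi x * pairing P (ext T F) A psi x) +
   (\int[mu]_x ('D_(1 : R) ('D_(1 : R) ('D_(1 : R) phi : L -> R) : L -> R) x *
      pairing P (ext T u) A psi x) +
    \int[mu]_x ('D_(1 : R) phi x * pairing P (ext T u) A (fun z => lap_perp psi z + c * psi z) x))).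
  rewrite [LHS]e0 [X in -1 * (X + _)]eF [X in _ + (X + _)]e3 [X in _ + (_ + X)]e1.
  have R1 := etrans (Rint_scale (-1) (integrable_add iF (integrable_add i3 i1)))
    (congr1 ( *%R (-1)) (etrans (Rint_add iF (integrable_add i3 i1))
      (congr2 +%R erefl (Rint_add i3 i1)))).
  apply: (etrans _ R1).
  apply: (ae_Rintegral i0 (integrable_scale _ (integrable_add iF (integrable_add i3 i1)))).
  apply: filterS3 sol (ae_ext2_integrable ui) (ae_ext2_integrable Fi) => w [_ s1 s2] uiw Fiw.
  rewrite (inner_ext2 A uiw tp ts1) (inner_ext2 A Fiw tp ts).
  rewrite (inner_ext2 A uiw tp3 ts) (inner_ext2 A uiw tp1 ts').
  rewrite (pathwise_equation T0 cY uiw Fiw s1 s2 tp ts).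
  by rewrite -!mulrDr mulN1r mulrN.
move: E; rewrite E1 E3 => ->.
by apply: cancel_terms.
Qed.

End PairingIdentities.

(** * Averages in x and the norm of B *)

Section WeightedJensen.
Context (d : measure_display) (X : measurableType d) (R : realType)
  (m : {measure set X -> \bar R}).

Lemma poweR_le (q : R) (x y : \bar R) : 0 <= q -> (0 <= x)%E -> (x <= y)%E ->
  (x `^ q <= y `^ q)%E.
Proof.
move=> q0 x0 xy; apply: gt0_ler_poweR => //; rewrite in_itv/= leey andbT//.
exact: le_trans xy.
Qed.

Lemma abs_Rintegral_le (f : X -> R) : measurable_fun setT f ->
  ((`|\int[m]_x f x|)%:E <= \int[m]_x `|f x|%:E)%E.
Proof.
move=> mf; apply: (@le_trans _ _ (`|\int[m]_x (f x)%:E|%E)).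
  have fin (e : \bar R) : ((`|fine e|)%:E <= `|e|)%E.
    by case: e => [s||] /=; rewrite ?normr0 ?leey ?lexx.
  exact: fin.
rewrite (_ : (\int[m]_x `|f x|%:E)%E = (\int[m]_x `|(f x)%:E|)%E); last exact: eq_integral.
by apply: le_abse_integral => //; exact/measurable_EFinP.
Qed.

(** Hoelder for [|k|^(1/r)] and [|k|^(1/q) |g|], with [r] conjugate to [q], bounds the left side by
    [(int_D |k|)^(q-1)] times the integral of [|k| |g|^q]. The mass [delta] and the size [c] enter
    separately, since only the mass will tend to zero. *)
Lemma weighted_jensen (q c delta : R) (D : set X) (k g : X -> R) : 1 < q -> 0 <= c ->
  measurable D -> measurable_fun setT k -> measurable_fun setT g ->
  (forall x, D x -> `|k x| <= c) -> (\int[m]_(x in D) `|k x|%:E <= delta%:E)%E ->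
  (forall x, ~ D x -> g x = 0) ->
  ((`|\int[m]_x (k x * g x)| `^ q)%:E <=
    (delta `^ (q - 1) * c)%:E * \int[m]_x (`|g x| `^ q)%:E)%E.
Proof.
move=> q1 c0 mD mk mg kc kd g0.
have q_gt0 : 0 < q by rewrite (lt_trans ltr01).
have q_neq0 : q != 0 by rewrite gt_eqF.
have q1_gt0 : 0 < q - 1 by rewrite subr_gt0.
have q1_neq0 : q - 1 != 0 by rewrite gt_eqF.
have d0 : 0 <= delta by rewrite -lee_fin (le_trans _ kd)//; apply: integral_ge0 => x _; rewrite lee_fin.
pose r := q / (q - 1).
have r_gt0 : 0 < r by rewrite divr_gt0.
have r_neq0 : r != 0 by rewrite gt_eqF.
have rq : r^-1 + q^-1 = 1.
  by rewrite /r invf_div; field; rewrite q_neq0.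
pose k1 := (fun x => `|k x|) \_ D.
have mk1 : measurable_fun setT k1.
  apply/(measurable_restrictT _ mD); apply: measurable_funTS; exact: measurableT_comp.
have k1_ge0 x : 0 <= k1 x by rewrite /k1 patchE; case: ifPn.
have k1c x : k1 x <= c.
  rewrite /k1 patchE; case: ifPn => // /set_mem xD; exact: kc.
pose a x := k1 x `^ r^-1.
pose b x := k1 x `^ q^-1 * `|g x|.
have ma : measurable_fun setT a by exact: (measurableT_comp (measurable_powR r^-1)).
have mb : measurable_fun setT b.
  apply: measurable_funM; first exact: (measurableT_comp (measurable_powR q^-1)).
  exact: measurableT_comp.
have ab x : `|a x * b x| = `|k x * g x|.
  rewrite /a /b mulrA -powRD; last by rewrite rq oner_eq0.
  rewrite rq powRr1// normrM (ger0_norm (k1_ge0 x)) normr_id normrM /k1 patchE.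
  have [xD|xD] := pselect (D x); first by rewrite mem_set.
  by rewrite memNset// g0// normr0 !mulr0.
have le1 : ((`|\int[m]_x (k x * g x)|)%:E <= 'N[m]_r%:E[EFin \o a] * 'N[m]_q%:E[EFin \o b])%E.
  apply: le_trans (hoelder m ma mb r_gt0 q_gt0 rq); rewrite Lnorm1.
  rewrite (eq_integral (fun x => `|k x * g x|%:E)); last first.
    by move=> x _; rewrite /= -ab.
  by apply: abs_Rintegral_le; exact: measurable_funM.
have N0 (s : R) f : (0 <= 'N[m]_s%:E[f])%E by exact: Lnorm_ge0.
rewrite -poweR_EFin.
apply: (le_trans (poweR_le (ltW q_gt0) _ le1)); first by rewrite lee_fin.
rewrite poweRM//.
have Ea : ('N[m]_r%:E[EFin \o a] `^ q <= (delta `^ (q - 1))%:E)%E.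
  have qE : q = r * (q - 1) by rewrite /r divfK.
  rewrite [X in (_ `^ X <= _)%E]qE.
  rewrite poweRrM poweR_Lnorm// (_ : (\int[m]_x _)%E = (\int[m]_(x in D) `|k x|%:E)%E); last first.
    rewrite [RHS]integral_mkcond; apply: eq_integral => x _.
    rewrite [LHS](poweR_EFin `|a x| r) /a (ger0_norm (powR_ge0 _ _)) -powRrM mulVf// powRr1//.
    by rewrite /k1 !patchE; case: ifPn.
  rewrite -poweR_EFin; apply: poweR_le => //; first exact: ltW.
  by apply: integral_ge0 => x _; rewrite lee_fin.
have Eb : ('N[m]_q%:E[EFin \o b] `^ q <= c%:E * \int[m]_x (`|g x| `^ q)%:E)%E.
  rewrite poweR_Lnorm// -ge0_integralZl//; last exact: measurable_abs_powR.
  apply: ge0_le_integral_sup => x _; first exact: poweR_ge0.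
  rewrite [leLHS](poweR_EFin `|b x| q) -EFinM lee_fin /b normrM normr_id powRM//.
  rewrite ger0_norm ?powR_ge0// -powRrM mulVf// powRr1//.
  by rewrite ler_wpM2r// powR_ge0.
rewrite [(_ * c)%:E]EFinM -[leRHS]muleA; apply: lee_pmul => //; exact: poweR_ge0.
Qed.

Lemma ae_eq_of_integrals (f g : X -> R) :
  m.-integrable setT (EFin \o f) -> m.-integrable setT (EFin \o g) ->
  (forall A, measurable A -> \int[m]_(x in A) f x = \int[m]_(x in A) g x) ->
  {ae m, forall x, f x = g x}.
Proof.
move=> fi gi H.
have HE A : A `<=` [set: X] -> measurable A ->
    (\int[m]_(x in A) (EFin \o f) x = \int[m]_(x in A) (EFin \o g) x)%E.
  move=> _ mA; have := H A mA; rewrite /Rintegral => E.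
  rewrite -(@fineK _ (\int[m]_(x in A) (EFin \o f) x)%E) ?E ?fineK//.
    apply: (@integrable_fin_num _ _ _ m A) => //; exact: (integrableS measurableT).
  apply: (@integrable_fin_num _ _ _ m A) => //; exact: (integrableS measurableT).
have mg := measurable_int _ gi.
apply: filterS (integral_ae_eq measurableT fi mg HE) => x /(_ I) []; exact.
Qed.

End WeightedJensen.

Section Averages.
Context (R : realType) (T : R) (Y : crossSection R).
Context (dO : measure_display) (Omega : measurableType dO) (P : probability Omega R).
Hypothesis mD : measurable (cs_dom Y).
Hypothesis cY : continuous_measurable (cs_space Y).
Local Notation L := (line R).
Local Notation mu := (leb R).
Local Notation mS := (prod_measure (leb R) (mupt Y)).
Local Notation mZ := (P \x mS)%E.
Local Notation PW := (prod_measure P (mupt Y)).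
Local Notation mZ' := (mu \x PW)%E.
Local Notation QT := (@Q R T Y).
Local Notation MM := (@M R Y).
Local Notation JD := (@jdom R T Y dO Omega).
Implicit Types (f : Omega * (L * pt Y) -> R) (k : L -> R).

Definition avg f k (q : Omega * pt Y) : R := \int[mu]_x (k x * f (shuffle (x, q))).

Lemma measurable_avg_kernel f k : measurable_fun setT f -> measurable_fun setT k ->
  measurable_fun setT (fun z : L * (Omega * pt Y) => k z.1 * f (shuffle z)).
Proof.
move=> mf mk; apply: measurable_funM; first exact: (measurableT_comp mk measurable_fst).
exact: (measurableT_comp mf (@measurable_shuffle _ _ _ _ Omega L L Y)).
Qed.

Lemma measurable_avg f k : measurable_fun setT f -> measurable_fun setT k ->
  measurable_fun setT (avg f k).
Proof.
by move=> mf mk; exact: (measurable_Rintegral2 mu (measurable_avg_kernel mf mk)).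
Qed.

Lemma avg_out f k q : (forall z, ~ JD z -> f z = 0) -> ~ QT q.2 -> avg f k q = 0.
Proof.
case: q => w [t y] f0 qQ; rewrite /avg /Rintegral integral0_eq// => x _.
rewrite f0 ?mulr0// => -[_ /= [tT [_ yD]]]; apply: qQ; by split.
Qed.

(** [weighted_jensen] in [x] at each fixed [(omega, (t, x^perp))], then Tonelli. *)
Lemma avg_Lq (q c delta : R) f k : 1 < q -> 0 <= c -> in_Lq T P q f -> measurable_fun setT k ->
  (forall s, itvoo 1 s -> `|k s| <= c) ->
  (\int[mu]_(s in itvoo 1) `|k s|%:E <= delta%:E)%E ->
  (\int[PW]_z (`|avg f k z| `^ q)%:E <=
   (delta `^ (q - 1) * c)%:E * \int[mZ]_z (`|f z| `^ q)%:E)%E.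
Proof.
move=> q1 c0 [mf f0 _] mk kc kd.
have mh := measurable_abs_powR q mf.
have mhs := measurableT_comp mh (@measurable_shuffle _ _ _ _ Omega L L Y).
have h0 z : (0 <= (`|f z| `^ q)%:E)%E by rewrite lee_fin powR_ge0.
rewrite -(tonelli_shuffle P mu mu (cs_measure Y) mh)//.
rewrite [X in (_ <= _ * X)%E]fubini_tonelli2; last 2 first.
- exact: (measurableT_comp mh (@measurable_shuffle _ _ _ _ Omega L L Y)).
- by move=> z; rewrite lee_fin powR_ge0.
rewrite -ge0_integralZl//; last 3 first.
- apply: measurable_fun_fubini_tonelli_G.
    exact: (measurableT_comp mh (@measurable_shuffle _ _ _ _ Omega L L Y)).
  by move=> z; rewrite lee_fin powR_ge0.
- by move=> z _; apply: integral_ge0 => x _; exact: h0.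
- by rewrite lee_fin mulr_ge0// powR_ge0.
apply: ge0_le_integral_sup => z _; first by rewrite lee_fin powR_ge0.
apply: (weighted_jensen q1 c0 (@measurable_itvoo R 1) mk) => //.
- exact: (measurableT_comp (measurableT_comp mf
    (@measurable_shuffle _ _ _ _ Omega L L Y)) (pair2_measurable z)).
- move=> x xI; rewrite f0// => -[_ /= [_ [xI' _]]]; exact: xI.
Qed.

Section Integrals.
Variables (f : Omega * (L * pt Y) -> R) (k : L -> R) (kk : R) (b : pt Y -> R) (kb : R).
Hypothesis fi : mZ.-integrable setT (EFin \o f).
Hypothesis f0 : forall z, ~ JD z -> f z = 0.
Hypothesis mk : measurable_fun setT k.
Hypothesis bk : forall x, `|k x| <= kk.
Hypothesis mb : measurable_fun setT b.
Hypothesis bb : forall z, `|b z| <= kb.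

Lemma integrable_avg_kernel : mZ'.-integrable setT
  (EFin \o (fun z : L * (Omega * pt Y) => k z.1 * f (shuffle z))).
Proof.
have [i1 _] := integrable_shuffle fi.
apply: (integrable_bddM (c := kk)) => //; first exact: (measurableT_comp mk measurable_fst).
Qed.

Lemma integrable_avg : PW.-integrable setT (EFin \o avg f k).
Proof. exact: (Rfubini2 integrable_avg_kernel).1. Qed.

Lemma integral_avg (A : set Omega) : measurable A ->
  PW.-integrable setT (EFin \o (fun q => (\1_A q.1 * b q.2) * avg f k q)) /\
  \int[PW]_q ((\1_A q.1 * b q.2) * avg f k q) = \int[mu]_x (k x * pairing P f A b x).
Proof.
move=> mA.
have mAb : measurable_fun setT (fun q : Omega * pt Y => \1_A q.1 * b q.2).
  apply: measurable_funM; first exact: (measurableT_comp (measurable_indic mA) measurable_fst).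
  exact: (measurableT_comp mb measurable_snd).
have bAb (q : Omega * pt Y) : `|\1_A q.1 * b q.2| <= kb by exact: (indic_factor_bounded A bb).
have i1 : PW.-integrable setT (EFin \o (fun q => (\1_A q.1 * b q.2) * avg f k q)).
  exact: (integrable_bddM mAb bAb integrable_avg).
split => //.
have i2 : mZ'.-integrable setT (EFin \o (fun z : L * (Omega * pt Y) =>
    (\1_A z.2.1 * b z.2.2) * (k z.1 * f (shuffle z)))).
  apply: (integrable_bddM (c := kb) _ _ integrable_avg_kernel) => [|z].
    exact: (measurableT_comp mAb measurable_snd).
  exact: bAb.
have [j1 e1] := Rfubini1 i2; have [j2 e2] := Rfubini2 i2.
have E2 : \int[PW]_q ((\1_A q.1 * b q.2) * avg f k q) =
    \int[PW]_q (\int[mu]_x ((\1_A q.1 * b q.2) * (k x * f (shuffle (x, q))))).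
  apply: (ae_Rintegral i1 j2).
  by apply: filterS (ae_integrable2 integrable_avg_kernel) => q iq; exact: (esym (Rint_scale _ iq)).
rewrite E2 e2 -e1.
apply: ae_Rintegral => //.
  exact: (integrable_bddM mk bk (integrable_pairing fi mA mb bb)).
apply: filterS (ae_integrable_pairing fi mA mb bb) => x ix.
rewrite /pairing -Rint_scale//; apply: eq_Rintegral => q _; rewrite /=; ring.
Qed.

Lemma regular_avgE (A : set Omega) w : \1_A w * regular QT (fun z => avg f k (w, z)) b =
  \int[mupt Y]_z ((\1_A w * b z) * avg f k (w, z)).
Proof.
rewrite indicE; case: (_ \in _); last first.
  by rewrite mul0r /Rintegral integral0_eq// => z _; rewrite !mul0r.
rewrite mul1r /regular Rintegral_mkcond; apply: eq_Rintegral => z _.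
rewrite patchE; case: ifPn => [_|/negP zQ]; first by rewrite mul1r mulrC.
by rewrite avg_out ?mulr0// => zQ'; apply: zQ; exact: mem_set.
Qed.

Lemma integrable_regular_avg : P.-integrable setT
  (EFin \o (fun w => regular QT (fun z => avg f k (w, z)) b)).
Proof.
have [i _] := integral_avg measurableT.
apply: eq_integrable (Rfubini1 i).1 => // w _ /=.
by rewrite -(regular_avgE [set: Omega] w) indicT mul1r.
Qed.

Lemma integral_regular_avg (A : set Omega) : measurable A ->
  \int[P]_(w in A) regular QT (fun z => avg f k (w, z)) b =
  \int[mu]_x (k x * pairing P f A b x).
Proof.
move=> mA; have [i e] := integral_avg mA; rewrite -e -(Rfubini1 i).2 Rintegral_mkcond.
apply: eq_Rintegral => w _; rewrite -regular_avgE patchE indicE.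
by case: (_ \in _); rewrite ?mul1r// mul0r.
Qed.

End Integrals.

End Averages.

(** * Elementary inequalities and bounds in the dual of H^2_0 *)

Section FiniteSums.
Context (R : realType).

Lemma sqr_sum_le (I : Type) (s : seq I) (a : I -> R) :
  (\sum_(v <- s) a v) ^+ 2 <= (2 ^+ size s) * \sum_(v <- s) a v ^+ 2.
Proof.
elim: s => [|v s IH]; first by rewrite !big_nil expr0n/= mulr0.
rewrite !big_cons /= (exprS 2).
set S := \sum_(j <- s) a j in IH *; set N := \sum_(j <- s) _ in IH *.
have p1 : 1 <= (2 : R) ^+ size s by rewrite exprn_ege1// ler1n.
have a0 := sqr_ge0 (a v).
have H : (a v + S) ^+ 2 <= 2 * a v ^+ 2 + 2 * S ^+ 2.
  by have := sqr_ge0 (a v - S); rewrite sqrrB sqrrD; lra.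
apply: (le_trans H); nra.
Qed.

Lemma le_sum_mem (I : eqType) (s : seq I) (F : I -> R) v : (forall v, 0 <= F v) ->
  v \in s -> F v <= \sum_(x <- s) F x.
Proof. by move=> F0 vs; rewrite (big_rem v)//= lerDl sumr_ge0. Qed.

Lemma young_product (l x y : R) : 0 < l -> 2 * `|x * y| <= l * x ^+ 2 + l^-1 * y ^+ 2.
Proof.
move=> l0; have l1 : l * l^-1 = 1 by rewrite divff// gt_eqF.
rewrite normrM -[x ^+ 2]real_normK ?num_real// -[y ^+ 2]real_normK ?num_real//.
set a := `|x|; set b := `|y|; set m := l^-1 in l1 *.
have m0 : 0 < m by rewrite invr_gt0.
have := mulr_ge0 (ltW l0) (sqr_ge0 (a - m * b)).
rewrite sqrrB exprMn.
have -> : l * (a ^+ 2 - a * (m * b) *+ 2 + m ^+ 2 * b ^+ 2) =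
  l * a ^+ 2 - 2 * (l * m) * (a * b) + (l * m) * (m * b ^+ 2) by ring.
rewrite l1; lra.
Qed.

(** Recovers Cauchy-Schwarz from Young's inequality with a free weight, at [l = b / a]. The weighted
    form is additive, so the three terms of [dual_op] can be summed with a common [l] before
    optimizing. *)
Lemma young_optimal (a s b : R) : 0 <= a -> 0 <= s -> 0 < b ->
  (forall l, 0 < l -> 2 * a <= l * s + l^-1 * b) -> a ^+ 2 <= b * s.
Proof.
move=> a0 s0 b0 H; have [->|a_neq0] := eqVneq a 0; first by rewrite expr0n/= mulr_ge0// ltW.
have a_gt0 : 0 < a by rewrite lt_def a_neq0.
have := H (b / a) (divr_gt0 b0 a_gt0); rewrite invf_div.
have -> : a / b * b = a by rewrite divfK// gt_eqF.
move=> H1; have : a <= b / a * s by lra.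
by rewrite -(ler_pM2r a_gt0) -expr2 mulrAC divfK.
Qed.

End FiniteSums.

Section DualBounds.
Context (R : realType) (T : R) (Y : crossSection R).
Hypothesis mD : measurable (cs_dom Y).
Hypothesis finD : (cs_measure Y (cs_dom Y) < +oo)%E.
Hypothesis cY : continuous_measurable (cs_space Y).
Local Notation m := (mupt Y).
Local Notation QT := (@Q R T Y).

Lemma integrable_indic_Q : m.-integrable setT (EFin \o (\1_QT : pt Y -> R)).
Proof.
have mQ := measurable_Q T mD.
apply/integrableP; split; first by apply/measurable_EFinP; exact: measurable_indic.
rewrite (eq_integral (fun z => (\1_QT z)%:E)).
  by rewrite integral_indic ?setIT//; exact: measure_QT_finite.
by move=> z _; rewrite /= ger0_norm.
Qed.

Lemma integrable_bounded_Q (c : R) (g : pt Y -> R) : measurable_fun setT g ->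
  (forall z, `|g z| <= c) -> (forall z, ~ QT z -> g z = 0) -> m.-integrable setT (EFin \o g).
Proof.
move=> mg bg g0; apply: eq_integrable (integrable_bddM mg bg integrable_indic_Q) => // z _ /=.
rewrite indicE; have [zQ|zQ] := pselect (QT z); first by rewrite mem_set// mulr1.
by rewrite memNset// g0// mulr0.
Qed.

Lemma test_sqr_integrable (psi : pt Y -> R) : test QT psi ->
  m.-integrable setT (EFin \o (fun z => psi z ^+ 2)).
Proof.
move=> tp; have [b b0 Hb] := test_bounded tp; have mp := test_measurable cY tp.
apply: (@integrable_bounded_Q (b ^+ 2)) => [|z|z zQ].
- by apply: measurable_funM.
- by rewrite normrX lerXn2r ?nnegrE.
- by rewrite (test_out tp)// expr0n.
Qed.

Lemma regular_mkcond (f chi : pt Y -> R) : (forall z, ~ QT z -> f z = 0) ->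
  regular QT f chi = \int[m]_z (f z * chi z).
Proof.
move=> f0; rewrite /regular Rintegral_mkcond; apply: eq_Rintegral => z _.
rewrite patchE; case: ifPn => // /negP zQ; rewrite f0 ?mul0r// => zQ'.
by apply: zQ; exact: mem_set.
Qed.

Lemma sqr_mkcond (chi : pt Y -> R) : test QT chi ->
  \int[m]_(z in QT) (chi z) ^+ 2 = \int[m]_z (chi z) ^+ 2.
Proof.
move=> tc; rewrite [LHS]Rintegral_mkcond; apply: eq_Rintegral => z _.
rewrite patchE; case: ifPn => // /negP zQ; rewrite (test_out tc) ?expr0n// => zQ'.
by apply: zQ; exact: mem_set.
Qed.

Lemma sqr_integrable_integrable (f : pt Y -> R) : measurable_fun setT f ->
  (forall z, ~ QT z -> f z = 0) -> m.-integrable setT (EFin \o (fun z => f z ^+ 2)) ->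
  m.-integrable setT (EFin \o f).
Proof.
move=> mf f0 fi.
apply: (@le_integrable _ _ _ m _ measurableT _ (EFin \o (fun z => \1_QT z + f z ^+ 2))).
- exact/measurable_EFinP.
- move=> z _; rewrite /= lee_fin [leRHS]ger0_norm; last by rewrite addr_ge0 ?sqr_ge0.
  rewrite indicE; have [zQ|zQ] := pselect (QT z); last first.
    by rewrite memNset// f0// normr0 addr_ge0 ?sqr_ge0.
  rewrite mem_set//=; rewrite -[f z ^+ 2]real_normK ?num_real//.
  have := sqr_ge0 (`|f z| - 1); rewrite sqrrB1; have := normr_ge0 (f z); lra.
- exact: integrable_add integrable_indic_Q fi.
Qed.

Lemma integrable_mul_test (f chi : pt Y -> R) : m.-integrable setT (EFin \o f) ->
  test QT chi -> m.-integrable setT (EFin \o (fun z => f z * chi z)).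
Proof.
move=> fi tc; have [b b0 Hb] := test_bounded tc.
have := integrable_bddM (test_measurable cY tc) Hb fi.
by apply: eq_integrable => // z _; rewrite /= mulrC.
Qed.

Lemma linear_regular (f : pt Y -> R) : (forall z, ~ QT z -> f z = 0) ->
  m.-integrable setT (EFin \o f) -> linear_on QT (regular QT f).
Proof.
move=> f0 fi a phi psi tp ts; rewrite !regular_mkcond//.
have ip := integrable_mul_test fi tp; have is_ := integrable_mul_test fi ts.
rewrite -(Rint_scale _ ip) -(Rint_add (integrable_scale _ ip) is_).
by apply: eq_Rintegral => z _; ring.
Qed.

Lemma young_regular (l : R) (f chi : pt Y -> R) : 0 < l -> measurable_fun setT f ->
  (forall z, ~ QT z -> f z = 0) -> m.-integrable setT (EFin \o (fun z => f z ^+ 2)) ->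
  test QT chi ->
  2 * `|regular QT f chi| <= l * \int[m]_z (f z ^+ 2) + l^-1 * \int[m]_(z in QT) (chi z) ^+ 2.
Proof.
move=> l0 mf f0 fi tc; rewrite regular_mkcond// sqr_mkcond//.
have ci := test_sqr_integrable tc.
have i1 := sqr_integrable_integrable mf f0 fi.
have i2 := integrable_mul_test i1 tc.
have ni : m.-integrable setT (EFin \o (fun z => `|f z * chi z|)) by exact: integrable_norm.
have J1 := integrable_scale l fi; have J2 := integrable_scale l^-1 ci.
apply: (@le_trans _ _ (2 * \int[m]_z `|f z * chi z|)).
  by rewrite ler_pM2l//; exact: le_normr_Rintegral.
rewrite -(Rint_scale 2 ni) -(Rint_scale l fi) -(Rint_scale l^-1 ci) -(Rint_add J1 J2).
apply: le_Rintegral => //.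
- exact: integrable_scale.
- exact: integrable_add.
- by move=> z _; exact: young_product.
Qed.

(** The first 2 covers [psi] and its time derivative. The rest comes from squaring
    [lap_perp psi + c psi]: a factor 2 for the two summands, and [2 ^+ size] from [sqr_sum_le] for
    the sum over the basis. *)
Definition Hm2_const (c : R) : R := 2 + 2 * 2 ^+ size (cs_basis Y) + 2 * c ^+ 2.

Lemma Hm2_const_gt0 c : 0 < Hm2_const c.
Proof.
by rewrite /Hm2_const -addrA ltr_wpDr// addr_ge0// mulr_ge0// ?sqr_ge0// exprn_ge0.
Qed.

Lemma combine_bounds (n0 n1 n2 d1 dl e c : R) : 0 <= n0 -> 0 <= n1 -> 0 <= n2 ->
  n0 + n1 + n2 <= 1 -> d1 <= n1 -> dl <= 2 * (e * n2) + 2 * (c ^+ 2 * n0) -> 0 <= e ->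
  n0 + d1 + dl <= 2 + 2 * e + 2 * c ^+ 2.
Proof.
move=> h0 h1 h2 hs hd hl he; have c2 := sqr_ge0 c.
have A : e * n2 <= e by rewrite ler_piMr//; lra.
have B : c ^+ 2 * n0 <= c ^+ 2 by rewrite ler_piMr//; lra.
lra.
Qed.

(** Boundedness, from the unit ball of [H^2] to [L^2], of the operators that [dual_op]
    transposes. *)
Lemma test_operator_bound (c : R) (psi : pt Y -> R) : test QT psi -> normH2 T psi <= 1 ->
  \int[m]_(z in QT) (psi z) ^+ 2 + \int[m]_(z in QT) ('D_(dir1 Y) psi z) ^+ 2 +
  \int[m]_(z in QT) (lap_perp psi z + c * psi z) ^+ 2 <= Hm2_const c.
Proof.
move=> tp H0.
pose N0 := \int[m]_(z in QT) (psi z) ^+ 2.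
pose N1 := \sum_(v <- dirs Y) \int[m]_(z in QT) ('D_v psi z) ^+ 2.
pose N2 := \sum_(v <- dirs Y) \sum_(v2 <- dirs Y) \int[m]_(z in QT) ('D_v ('D_v2 psi) z) ^+ 2.
have H1 : Num.sqrt (N0 + N1 + N2) <= 1 := H0.
have N00 : 0 <= N0 by apply: Rintegral_ge0 => z _; exact: sqr_ge0.
have N10 : 0 <= N1 by apply: sumr_ge0 => v _; apply: Rintegral_ge0 => z _; exact: sqr_ge0.
have I20 v v2 : 0 <= \int[m]_(z in QT) ('D_v ('D_v2 psi) z) ^+ 2.
  by apply: Rintegral_ge0 => z _; exact: sqr_ge0.
have N20 : 0 <= N2 by do 2 apply: sumr_ge0 => ? _.
have H : N0 + N1 + N2 <= 1.
  by rewrite -[leRHS](expr1n _ 2) -[leLHS]sqr_sqrtr ?addr_ge0// lerXn2r ?nnegrE ?sqrtr_ge0.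
have tlap := test_lap_perp tp.
apply: (combine_bounds N00 N10 N20 H).
- by rewrite /N1 /dirs big_cons lerDl; apply: sumr_ge0 => v _; apply: Rintegral_ge0 => z _; exact: sqr_ge0.
- have td v : test QT ('D_((0, v) : pt Y) ('D_((0, v) : pt Y) psi)).
    by do 2 apply: test_derive.
  have tlc : test QT (fun z => lap_perp psi z + c * psi z) by apply: testD => //; exact: testZ.
  have i0 := test_sqr_integrable tp.
  have iv v := test_sqr_integrable (td v).
  pose S (z : pt Y) := \sum_(v <- cs_basis Y) 'D_((0, v) : pt Y) ('D_((0, v) : pt Y) psi) z ^+ 2.
  have SE (s : seq Y) : m.-integrable setT (EFin \o (fun z =>
        \sum_(v <- s) 'D_((0, v) : pt Y) ('D_((0, v) : pt Y) psi) z ^+ 2)) /\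
      \int[m]_z (\sum_(v <- s) 'D_((0, v) : pt Y) ('D_((0, v) : pt Y) psi) z ^+ 2) =
      \sum_(v <- s) \int[m]_z ('D_((0, v) : pt Y) ('D_((0, v) : pt Y) psi) z ^+ 2).
    elim: s => [|v s [IH1 IH2]].
      rewrite big_nil; split.
        by apply: eq_integrable (integrable0 m setT) => // z _; rewrite /= big_nil.
      by rewrite /Rintegral integral0_eq// => z _; rewrite big_nil.
    rewrite big_cons -IH2 -(Rint_add (iv v) IH1); split.
      by apply: eq_integrable (integrable_add (iv v) IH1) => // z _; rewrite /= big_cons.
    by apply: eq_Rintegral => z _; rewrite big_cons.
  have [iS eS] := SE (cs_basis Y).
  (* The pure transverse second derivatives are diagonal terms of the double sum [N2], whose terms
     are all nonnegative. *)
  have le2 : \int[m]_z S z <= N2.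
    rewrite eS /N2 /dirs big_cons.
    apply: (@le_trans _ _ (\sum_(j <- [seq ((0, v) : pt Y) | v <- cs_basis Y])
      \sum_(v2 <- dir1 Y :: [seq ((0, v) : pt Y) | v <- cs_basis Y])
        \int[m]_(z in QT) ('D_j ('D_v2 psi) z) ^+ 2)); last first.
      by rewrite lerDr; apply: sumr_ge0 => v _.
    rewrite big_map big_seq [leRHS]big_seq; apply: ler_sum => v vb.
    rewrite -(sqr_mkcond (td v)).
    apply: (le_sum_mem (F := fun v2 => \int[m]_(z in QT) ('D_((0, v) : pt Y) ('D_v2 psi) z) ^+ 2)) => //.
    by rewrite in_cons; apply/orP; right; exact: map_f.
  rewrite sqr_mkcond// /N0 sqr_mkcond//.
  apply: (@le_trans _ _ (2 * (2 ^+ size (cs_basis Y) * \int[m]_z S z) + 2 * (c ^+ 2 * \int[m]_z psi z ^+ 2))).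
    have j1 := integrable_scale 2 (integrable_scale (2 ^+ size (cs_basis Y)) iS).
    have j2 := integrable_scale 2 (integrable_scale (c ^+ 2) i0).
    rewrite -(Rint_scale _ iS) -(Rint_scale _ i0).
    rewrite -(Rint_scale 2 (integrable_scale _ iS)) -(Rint_scale 2 (integrable_scale _ i0)).
    rewrite -(Rint_add j1 j2).
    apply: le_Rintegral => //; [exact: test_sqr_integrable|exact: integrable_add|].
    move=> z _; have := sqr_sum_le (cs_basis Y)
      (fun v => 'D_((0, v) : pt Y) ('D_((0, v) : pt Y) psi) z).
    rewrite -/(lap_perp psi z) -/(S z).
    move: (lap_perp psi z) (psi z) (S z) (2 ^+ _) => a b s e.
    have := sqr_ge0 (a - c * b); rewrite sqrrB sqrrD exprMn; lra.
  by rewrite lerD2r ler_pM2l// ler_wpM2l// exprn_ge0.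
- exact: exprn_ge0.
Qed.

End DualBounds.

Lemma Lnorm_le (d : measure_display) (X : measurableType d) (R : realType)
    (m : {measure set X -> \bar R}) (q r : R) (f : X -> \bar R) : 0 < q -> 0 <= r ->
  (\int[m]_x `|f x| `^ q <= (r `^ q)%:E)%E -> ('N[m]_q%:E[f] <= r%:E)%E.
Proof.
move=> q0 r0; have qn : q != 0 by rewrite gt_eqF.
rewrite -poweR_Lnorm// => H.
have N0 : (0 <= 'N[m]_q%:E[f])%E by exact: Lnorm_ge0.
rewrite -(poweRe1 N0) -(mulfV qn) poweRrM.
rewrite -(powRr1 r0) -(mulfV qn) powRrM -poweR_EFin.
by apply: poweR_le => //; [rewrite invr_ge0 ltW|exact: poweR_ge0].
Qed.

Section Dual.
Context (R : realType) (T : R) (Y : crossSection R).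
Context (dO : measure_display) (Omega : measurableType dO) (P : probability Omega R).
Hypothesis mD : measurable (cs_dom Y).
Hypothesis finD : (cs_measure Y (cs_dom Y) < +oo)%E.
Hypothesis cY : continuous_measurable (cs_space Y).
Local Notation m := (mupt Y).
Local Notation PW := (prod_measure P (mupt Y)).
Local Notation QT := (@Q R T Y).

(** The distribution [f1 - d_t f2 - (Delta^perp + c) f3] on [Q]; there [dir1] is the time
    direction. *)
Definition dual_op (c : R) (f1 f2 f3 : pt Y -> R) (psi : pt Y -> R) : R :=
  regular QT f1 psi + (regular QT f2 ('D_(dir1 Y) psi) -
    regular QT f3 (fun z => lap_perp psi z + c * psi z)).

Lemma derive_test_linear (a : R) (v : pt Y) phi psi : test QT phi -> test QT psi ->
  'D_v (fun z => a * phi z + psi z) = (fun z => a * 'D_v phi z + 'D_v psi z).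
Proof.
move=> tp ts; have ta := testZ a tp; apply/funext => z.
rewrite (derive_smoothD _ _ (test_smooth ta) (test_smooth ts)).
by rewrite (derive_smoothZ _ _ _ (test_smooth tp)).
Qed.

Lemma lap_perp_linear (a : R) phi psi z : test QT phi -> test QT psi ->
  lap_perp (fun x => a * phi x + psi x) z = a * lap_perp phi z + lap_perp psi z.
Proof.
move=> tp ts; rewrite /lap_perp mulr_sumr -big_split; apply: eq_bigr => v _.
rewrite (derive_test_linear _ _ tp ts).
exact: (congr1 (fun g => g z) (derive_test_linear a ((0, v) : pt Y)
  (test_derive ((0, v) : pt Y) tp) (test_derive ((0, v) : pt Y) ts))).
Qed.

Lemma regroup_linear (a c x y p q : R) :
  a * x + y + c * (a * p + q) = a * (x + c * p) + (y + c * q).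
Proof. by ring. Qed.

Lemma regroup_dual (a x1 y1 x2 y2 x3 y3 : R) :
  a * x1 + y1 + (a * x2 + y2 - (a * x3 + y3)) = a * (x1 + (x2 - x3)) + (y1 + (y2 - y3)).
Proof. by ring. Qed.

Lemma normH2_0 : @normH2 R T Y (fun=> 0) = 0.
Proof.
have I0 (f : pt Y -> R) : (forall z, f z = 0) -> \int[m]_(z in QT) (f z ^+ 2) = 0.
  by move=> f0; rewrite /Rintegral integral0_eq// => z _; rewrite f0 expr0n.
have D0 (v : pt Y) : 'D_v (fun=> 0 : R) = (fun=> 0) by apply/funext => z; exact: derive_cst.
have D00 (u v : pt Y) : 'D_u ('D_v (fun=> 0 : R)) = (fun=> 0).
  exact: (etrans (congr1 (derive^~ u) (D0 v)) (D0 u)).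
have E1 : \sum_(v <- dirs Y) \int[m]_(z in QT) ('D_v (fun=> 0 : R) z) ^+ 2 = 0.
  by apply: big1 => v _; apply: I0 => z; exact: (congr1 (fun g => g z) (D0 v)).
have E2 : \sum_(v <- dirs Y) \sum_(v2 <- dirs Y)
    \int[m]_(z in QT) ('D_v ('D_v2 (fun=> 0 : R)) z) ^+ 2 = 0.
  apply: big1 => u _; apply: big1 => v _; apply: I0 => z; exact: (congr1 (fun g => g z) (D00 u v)).
have E0 := I0 (fun=> 0) (fun _ => erefl).
apply: (etrans (congr1 Num.sqrt (congr2 +%R (congr2 +%R E0 E1) E2))).
by rewrite !addr0 sqrtr0.
Qed.

Lemma normHm2_ge0 (L : (pt Y -> R) -> R) : (0 <= normHm2 T L)%E.
Proof.
apply: le_ereal_sup_tmp; exists (`|L (fun=> 0)|)%:E; last by rewrite lee_fin.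
by exists (fun=> 0) => //; split; [exact: test0|rewrite normH2_0].
Qed.

Section Deterministic.
Variables (c : R) (f1 f2 f3 : pt Y -> R).
Hypothesis mf1 : measurable_fun setT f1.
Hypothesis mf2 : measurable_fun setT f2.
Hypothesis mf3 : measurable_fun setT f3.
Hypothesis out1 : forall z, ~ QT z -> f1 z = 0.
Hypothesis out2 : forall z, ~ QT z -> f2 z = 0.
Hypothesis out3 : forall z, ~ QT z -> f3 z = 0.

Lemma sum3_abs_le (a b d A1 B1 D1 : R) : 2 * `|a| <= A1 -> 2 * `|b| <= B1 -> 2 * `|d| <= D1 ->
  2 * `|a + (b - d)| <= A1 + B1 + D1.
Proof.
move=> ha hb hd; have := ler_normD a (b - d); have := ler_normB b d; lra.
Qed.

Lemma regroup3 (l x1 x2 x3 y1 y2 y3 : R) :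
  l * x1 + l^-1 * y1 + (l * x2 + l^-1 * y2) + (l * x3 + l^-1 * y3) =
  l * (x1 + x2 + x3) + l^-1 * (y1 + y2 + y3).
Proof. by rewrite !mulrDr; ring. Qed.

Lemma dual_op_sqr psi : m.-integrable setT (EFin \o (fun z => f1 z ^+ 2)) ->
  m.-integrable setT (EFin \o (fun z => f2 z ^+ 2)) ->
  m.-integrable setT (EFin \o (fun z => f3 z ^+ 2)) ->
  test QT psi -> normH2 T psi <= 1 ->
  `|dual_op c f1 f2 f3 psi| ^+ 2 <= Hm2_const Y c *
    (\int[m]_z (f1 z ^+ 2) + \int[m]_z (f2 z ^+ 2) + \int[m]_z (f3 z ^+ 2)).
Proof.
move=> i1 i2 i3 tp np.
have sq (f : pt Y -> R) : 0 <= \int[m]_z (f z ^+ 2) by apply: Rintegral_ge0 => z _; exact: sqr_ge0.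
apply: young_optimal; [exact: normr_ge0|by rewrite !addr_ge0//; exact: sq|exact: Hm2_const_gt0|].
move=> l l0.
have t1 : test QT ('D_(dir1 Y) psi) by exact: test_derive.
have t3 : test QT (fun z => lap_perp psi z + c * psi z).
  by apply: testD; [exact: test_lap_perp|exact: testZ].
have H1 := young_regular mD finD cY l0 mf1 out1 i1 tp.
have H2 := young_regular mD finD cY l0 mf2 out2 i2 t1.
have H3 := young_regular mD finD cY l0 mf3 out3 i3 t3.
apply: (le_trans (sum3_abs_le H1 H2 H3)).
rewrite regroup3 lerD2l ler_wpM2l//; first by rewrite invr_ge0 ltW.
exact: (test_operator_bound mD finD cY).
Qed.

Lemma integrable_sqr_of_sum : (\int[m]_z (f1 z ^+ 2 + f2 z ^+ 2 + f3 z ^+ 2)%:E < +oo)%E ->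
  [/\ m.-integrable setT (EFin \o (fun z => f1 z ^+ 2)),
      m.-integrable setT (EFin \o (fun z => f2 z ^+ 2)),
      m.-integrable setT (EFin \o (fun z => f3 z ^+ 2)) &
      (\int[m]_z (f1 z ^+ 2 + f2 z ^+ 2 + f3 z ^+ 2)%:E)%E =
      (\int[m]_z (f1 z ^+ 2) + \int[m]_z (f2 z ^+ 2) + \int[m]_z (f3 z ^+ 2))%:E].
Proof.
move=> fin.
have msq (f : pt Y -> R) : measurable_fun setT f -> measurable_fun setT (fun z => f z ^+ 2).
  by move=> mf; exact: measurable_funM.
have Sge0 z : 0 <= f1 z ^+ 2 + f2 z ^+ 2 + f3 z ^+ 2 by rewrite !addr_ge0 ?sqr_ge0.
have iS : m.-integrable setT (EFin \o (fun z => f1 z ^+ 2 + f2 z ^+ 2 + f3 z ^+ 2)).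
  apply/integrableP; split.
    by apply/measurable_EFinP; do 2 (apply: measurable_funD; last exact: msq); exact: msq.
  rewrite (eq_integral (fun z => (f1 z ^+ 2 + f2 z ^+ 2 + f3 z ^+ 2)%:E))// => z _.
  by rewrite /= ger0_norm.
have sub (f : pt Y -> R) : measurable_fun setT f ->
    (forall z, f z ^+ 2 <= f1 z ^+ 2 + f2 z ^+ 2 + f3 z ^+ 2) ->
    m.-integrable setT (EFin \o (fun z => f z ^+ 2)).
  move=> mf le_f; apply: (le_integrable measurableT _ _ iS).
    by apply/measurable_EFinP; exact: msq.
  by move=> z _; rewrite /= lee_fin !ger0_norm ?sqr_ge0.
have i1 : m.-integrable setT (EFin \o (fun z => f1 z ^+ 2)).
  by apply: sub => // z; rewrite -addrA lerDl addr_ge0 ?sqr_ge0.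
have i2 : m.-integrable setT (EFin \o (fun z => f2 z ^+ 2)).
  by apply: sub => // z; rewrite addrAC lerDr addr_ge0 ?sqr_ge0.
have i3 : m.-integrable setT (EFin \o (fun z => f3 z ^+ 2)).
  by apply: sub => // z; rewrite lerDr addr_ge0 ?sqr_ge0.
split => //.
rewrite -(Rint_add i1 i2) -(Rint_add (integrable_add i1 i2) i3) /Rintegral fineK//.
exact: (integrable_fin_num measurableT iS).
Qed.

Lemma normHm2_dual_op_le : (\int[m]_z (f1 z ^+ 2 + f2 z ^+ 2 + f3 z ^+ 2)%:E < +oo)%E ->
  (normHm2 T (dual_op c f1 f2 f3) <= (Num.sqrt (Hm2_const Y c *
    (\int[m]_z (f1 z ^+ 2) + \int[m]_z (f2 z ^+ 2) + \int[m]_z (f3 z ^+ 2))))%:E)%E.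
Proof.
move=> fin; have [i1 i2 i3 _] := integrable_sqr_of_sum fin.
set S := (_ + _ + _)%R.
have S0 : 0 <= S by rewrite !addr_ge0//; apply: Rintegral_ge0 => z _; exact: sqr_ge0.
have KS : 0 <= Hm2_const Y c * S by rewrite mulr_ge0// ltW// Hm2_const_gt0.
apply: ge_ereal_sup => _ [psi [tp np] <-]; rewrite lee_fin.
rewrite -[leLHS]normr_id -sqrtr_sqr ler_sqrt//.
exact: dual_op_sqr.
Qed.

Lemma normHm2_dual_op : (normHm2 T (dual_op c f1 f2 f3) `^ 2 <=
  (Hm2_const Y c)%:E * \int[m]_z (f1 z ^+ 2 + f2 z ^+ 2 + f3 z ^+ 2)%:E)%E.
Proof.
have K0 := Hm2_const_gt0 Y c.
(* If the functions are not square integrable the right side is [+oo], the constant being positive.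
   Admitting this case gives a bound for every [omega], which can be integrated directly. *)
have [->|fin] := eqVneq (\int[m]_z (f1 z ^+ 2 + f2 z ^+ 2 + f3 z ^+ 2)%:E)%E +oo%E.
  by rewrite gt0_muley ?lte_fin// leey.
rewrite -ltey in fin; have [_ _ _ ->] := integrable_sqr_of_sum fin.
apply: (le_trans (poweR_le _ (normHm2_ge0 _) (normHm2_dual_op_le fin))) => //.
rewrite poweR_EFin lee_fin (powR_mulrn 2) ?sqrtr_ge0// sqr_sqrtr//.
rewrite mulr_ge0//; first exact: ltW.
by rewrite !addr_ge0//; apply: Rintegral_ge0 => z _; exact: sqr_ge0.
Qed.

Lemma inHm2_dual_op : (\int[m]_z (f1 z ^+ 2 + f2 z ^+ 2 + f3 z ^+ 2)%:E < +oo)%E ->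
  inHm2 T (dual_op c f1 f2 f3).
Proof.
move=> fin; have [i1 i2 i3 _] := integrable_sqr_of_sum fin; split; last first.
  exact: le_lt_trans (normHm2_dual_op_le fin) (ltry _).
have l1 := linear_regular cY out1 (sqr_integrable_integrable mD finD mf1 out1 i1).
have l2 := linear_regular cY out2 (sqr_integrable_integrable mD finD mf2 out2 i2).
have l3 := linear_regular cY out3 (sqr_integrable_integrable mD finD mf3 out3 i3).
move=> a phi psi tp ts; rewrite /dual_op (l1 a _ _ tp ts).
have t3 (chi : pt Y -> R) : test QT chi -> test QT (fun z => lap_perp chi z + c * chi z).
  by move=> tc; apply: testD; [exact: test_lap_perp|exact: testZ].
have -> : 'D_(dir1 Y) (fun z => a * phi z + psi z) =
    (fun z => a * 'D_(dir1 Y) phi z + 'D_(dir1 Y) psi z).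
  exact: (derive_test_linear _ _ tp ts).
rewrite (l2 a _ _ (test_derive _ tp) (test_derive _ ts)).
have -> : (fun z => lap_perp (fun x => a * phi x + psi x) z + c * (a * phi z + psi z)) =
    (fun z => a * (lap_perp phi z + c * phi z) + (lap_perp psi z + c * psi z)).
  by apply/funext => z; rewrite (lap_perp_linear _ _ tp ts); exact: regroup_linear.
rewrite (l3 a _ _ (t3 _ tp) (t3 _ ts)); exact: regroup_dual.
Qed.

End Deterministic.

Section Random.
Variables (c : R) (f1 f2 f3 : Omega * pt Y -> R).
Hypothesis mf1 : measurable_fun setT f1.
Hypothesis mf2 : measurable_fun setT f2.
Hypothesis mf3 : measurable_fun setT f3.
Hypothesis out1 : forall q, ~ QT q.2 -> f1 q = 0.
Hypothesis out2 : forall q, ~ QT q.2 -> f2 q = 0.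
Hypothesis out3 : forall q, ~ QT q.2 -> f3 q = 0.

Definition dual : rdistr Y Omega := fun w =>
  dual_op c (fun z => f1 (w, z)) (fun z => f2 (w, z)) (fun z => f3 (w, z)).

Definition sqr_sum (q : Omega * pt Y) : \bar R := (f1 q ^+ 2 + f2 q ^+ 2 + f3 q ^+ 2)%:E.

Lemma sqr_sum_ge0 q : (0 <= sqr_sum q)%E.
Proof. by rewrite lee_fin !addr_ge0 ?sqr_ge0. Qed.

Lemma measurable_sqr_sum : measurable_fun setT sqr_sum.
Proof.
have msq (f : Omega * pt Y -> R) : measurable_fun setT f -> measurable_fun setT (fun z => f z ^+ 2).
  by move=> mf; exact: measurable_funM.
by apply/measurable_EFinP; do 2 (apply: measurable_funD; last exact: msq); exact: msq.
Qed.

Lemma measurable_regular_section (f : Omega * pt Y -> R) psi : measurable_fun setT f ->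
  (forall q, ~ QT q.2 -> f q = 0) -> test QT psi ->
  measurable_fun setT (fun w => regular QT (fun z => f (w, z)) psi).
Proof.
move=> mf f0 tp.
have mg : measurable_fun setT (fun q : Omega * pt Y => f q * psi q.2).
  by apply: measurable_funM => //; exact: (measurableT_comp (test_measurable cY tp) measurable_snd).
rewrite (_ : (fun w => _) = (fun w => \int[m]_z (f (w, z) * psi z))).
  exact: (measurable_Rintegral1 m mg).
by apply/funext => w; apply: regular_mkcond => z; exact: (f0 (w, z)).
Qed.

Lemma measurable_dual psi : test QT psi -> measurable_fun setT (fun w => dual w psi).
Proof.
move=> tp; apply: measurable_funD; first exact: measurable_regular_section.
apply: measurable_funB; first by apply: measurable_regular_section => //; exact: test_derive.
apply: measurable_regular_section => //.
by apply: testD; [exact: test_lap_perp|exact: testZ].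
Qed.

Lemma section1 (f : Omega * pt Y -> R) w : measurable_fun setT f ->
  measurable_fun setT (fun z => f (w, z)).
Proof. by move=> mf; exact: (measurableT_comp mf (pair1_measurable w)). Qed.

Lemma integral_Hm2_dual : (\int[P]_w (`|normHm2 T (dual w)| `^ 2) <=
  (Hm2_const Y c)%:E * \int[PW]_q sqr_sum q)%E.
Proof.
have mS := measurable_sqr_sum.
rewrite [in leRHS]fubini_tonelli1//; last exact: sqr_sum_ge0.
rewrite -ge0_integralZl//; last 3 first.
- exact: (measurable_fun_fubini_tonelli_F _ mS sqr_sum_ge0).
- by move=> w _; apply: integral_ge0 => z _; exact: sqr_sum_ge0.
- by rewrite lee_fin ltW// Hm2_const_gt0.
apply: ge0_le_integral_sup => w _; first exact: poweR_ge0.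
rewrite gee0_abs; last exact: normHm2_ge0.
by apply: normHm2_dual_op; first [exact: section1|by move=> z zQ; auto].
Qed.

Lemma normL2Hm2_dual (r : R) : 0 <= r ->
  ((Hm2_const Y c)%:E * \int[PW]_q sqr_sum q <= (r `^ 2)%:E)%E ->
  (normL2Hm2 T P dual <= r%:E)%E.
Proof.
move=> r0 H; apply: Lnorm_le => //; exact: le_trans integral_Hm2_dual H.
Qed.

Lemma inL2Hm2_dual : (\int[PW]_q sqr_sum q < +oo)%E -> inL2Hm2 T P dual.
Proof.
move=> fin; split; first exact: measurable_dual.
  have iS : PW.-integrable setT sqr_sum.
    apply/integrableP; split; first exact: measurable_sqr_sum.
    rewrite (eq_integral sqr_sum)// => q _; exact/gee0_abs/sqr_sum_ge0.
  apply: filterS (ae_integrable1 iS) => w /integrableP[_ iw].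
  apply: inHm2_dual_op; first [exact: section1|by move=> z zQ; auto|idtac].
  move: iw; rewrite (eq_integral (fun z => sqr_sum (w, z)))// => z _.
  exact/gee0_abs/sqr_sum_ge0.
have K0 : (0 <= \int[PW]_q sqr_sum q)%E by apply: integral_ge0 => q _; exact: sqr_sum_ge0.
have fn : (\int[PW]_q sqr_sum q)%E \is a fin_num by rewrite ge0_fin_numE.
set K := Hm2_const Y c * fine (\int[PW]_q sqr_sum q).
have KK : 0 <= K by rewrite mulr_ge0// ?fine_ge0// ltW// Hm2_const_gt0.
apply: le_lt_trans (ltry (Num.sqrt K)); apply: normL2Hm2_dual; first exact: sqrtr_ge0.
by rewrite -(fineK fn) -EFinM lee_fin (powR_mulrn 2) ?sqrtr_ge0// sqr_sqrtr.
Qed.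

End Random.
End Dual.

(** * Averages as elements of B and their continuity in x *)

Section Representation.
Context (R : realType) (T : R) (Y : crossSection R).
Context (dO : measure_display) (Omega : measurableType dO) (P : probability Omega R).
Hypothesis mD : measurable (cs_dom Y).
Hypothesis finD : (cs_measure Y (cs_dom Y) < +oo)%E.
Hypothesis cY : continuous_measurable (cs_space Y).
Local Notation L := (line R).
Local Notation mu := (leb R).
Local Notation m := (mupt Y).
Local Notation mS := (prod_measure (leb R) (mupt Y)).
Local Notation mZ := (P \x mS)%E.
Local Notation PW := (prod_measure P (mupt Y)).
Local Notation QT := (@Q R T Y).
Variables (p c : R) (fu fv fF : Omega * (L * pt Y) -> R).
Hypothesis p1 : 1 < p.
Hypothesis Lu : in_Lq T P 2 fu.
Hypothesis Lv : in_Lq T P 2 fv.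
Hypothesis LF : in_Lq T P p fF.

(* Integrating [u_xxx = F - u_t - Delta^perp u_x - c u_x] against a kernel [k'],
   and [u_x] against [k], only involves [fu = u], [fv = u_x] and [fF = F]: the
   derivatives in [t] and [x^perp] are moved onto the test function. *)
Definition repr (k k' : L -> R) : rdistr Y Omega := fun w psi =>
  dual T c (avg fv k) (avg fu k') (avg fv k') w psi +
  regular QT (fun z => avg fF k' (w, z)) psi.

(** Size and mass are kept apart: for the difference of two nearby kernels only the mass [delta] is
    small. *)
Definition kernel_bounds (cst delta : R) (k : L -> R) := [/\ measurable_fun setT k,
  forall s, itvoo 1 s -> `|k s| <= cst & (\int[mu]_(s in itvoo 1) `|k s|%:E <= delta%:E)%E].

Lemma avg_sqr_le (f : Omega * (L * pt Y) -> R) cst delta k : in_Lq T P 2 f ->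
  0 <= cst -> 0 <= delta -> kernel_bounds cst delta k ->
  (\int[PW]_q (avg f k q ^+ 2)%:E <=
   (delta * cst * fine (\int[mZ]_z (`|f z| `^ 2)%:E))%:E)%E.
Proof.
move=> Lf c0 d0 [mk kc kd]; have [_ _ fin] := Lf.
have := avg_Lq (ltr1n R 2) c0 Lf mk kc kd.
have -> : (2 - 1 : R) = 1 by rewrite -[2]/(1 + 1) addrK.
rewrite powRr1// => H; rewrite [leRHS]EFinM fineK; last first.
  by rewrite ge0_fin_numE//; apply: integral_ge0 => z _; rewrite lee_fin powR_ge0.
apply: le_trans H; rewrite (eq_integral (fun q => (`|avg f k q| `^ 2)%:E))// => q _.
by rewrite sqr_powR.
Qed.

Lemma integral_sqr_sum_le cst delta k k' : 0 <= cst -> 0 <= delta ->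
  kernel_bounds cst delta k -> kernel_bounds cst delta k' ->
  (\int[PW]_q sqr_sum (avg fv k) (avg fu k') (avg fv k') q <=
   (delta * cst * (fine (\int[mZ]_z (`|fv z| `^ 2)%:E) + fine (\int[mZ]_z (`|fu z| `^ 2)%:E) +
     fine (\int[mZ]_z (`|fv z| `^ 2)%:E)))%:E)%E.
Proof.
move=> c0 d0 bk bk'; have [mk _ _] := bk; have [mk' _ _] := bk'.
have [mfu _ _] := Lu; have [mfv _ _] := Lv.
have msq (f : Omega * pt Y -> R) : measurable_fun setT f ->
    measurable_fun setT (fun z => (f z ^+ 2)%:E).
  by move=> mf; apply/measurable_EFinP; exact: measurable_funM.
have m1 := msq _ (measurable_avg mfv mk); have m2 := msq _ (measurable_avg mfu mk').
have m3 := msq _ (measurable_avg mfv mk').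
rewrite (eq_integral (fun q => (avg fv k q ^+ 2)%:E + (avg fu k' q ^+ 2)%:E +
  (avg fv k' q ^+ 2)%:E)%E)//.
have pos (f : Omega * pt Y -> R) q : (0 <= (f q ^+ 2)%:E)%E by rewrite lee_fin sqr_ge0.
rewrite ge0_integralD//; [|by move=> q _; rewrite adde_ge0|exact: emeasurable_funD].
rewrite ge0_integralD// !mulrDr !EFinD.
by apply: leeD; [apply: leeD|]; exact: avg_sqr_le.
Qed.

Lemma normE_avg cst delta k r : 0 <= cst -> kernel_bounds cst delta k -> 0 <= r ->
  delta `^ (p - 1) * cst * fine (\int[mZ]_z (`|fF z| `^ p)%:E) <= r `^ p ->
  (normE T P p (fun w z => avg fF k (w, z)) <= r%:E)%E.
Proof.
move=> c0 [mk kc kd] r0 H; have [mf f0 fin] := LF.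
have p0 : 0 < p by rewrite (lt_trans ltr01).
apply: Lnorm_le => //; apply: (@le_trans _ _ (\int[PW]_q (`|avg fF k q| `^ p)%:E)%E).
  apply: ge0_le_integral_sup => -[w z] _; first exact: poweR_ge0.
  rewrite patchE; case: ifPn => _; rewrite lee_fin //= ?normr0 ?powR0 ?powR_ge0//.
  by rewrite gt_eqF.
apply: (le_trans (avg_Lq p1 c0 LF mk kc kd)).
rewrite -lee_fin EFinM fineK// in H.
by rewrite ge0_fin_numE//; apply: integral_ge0 => z _; rewrite lee_fin powR_ge0.
Qed.

Lemma inE_avg cst delta k : 0 <= cst -> kernel_bounds cst delta k ->
  inE T P p (fun w z => avg fF k (w, z)).
Proof.
move=> c0 bk; have [mk kc kd] := bk; have [mf f0 fin] := LF.
split.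
  rewrite (_ : (fun z => _) = avg fF k); last by apply/funext => -[].
  by apply: measurable_funTS; exact: measurable_avg.
have p0 : p != 0 by rewrite gt_eqF// (lt_trans ltr01).
set B := delta `^ (p - 1) * cst * fine (\int[mZ]_z (`|fF z| `^ p)%:E).
have B0 : 0 <= B.
  rewrite !mulr_ge0 ?powR_ge0// fine_ge0//; apply: integral_ge0 => z _.
  by rewrite lee_fin powR_ge0.
apply: le_lt_trans (ltry (B `^ p^-1)).
by apply: (normE_avg c0 bk); rewrite ?powR_ge0// -powRrM mulVf// powRr1.
Qed.

Lemma avg_out_ext f k (q : Omega * pt Y) (s : R) : in_Lq T P s f -> ~ QT q.2 -> avg f k q = 0.
Proof. by move=> [_ f0 _]; exact: avg_out. Qed.

(** [A] and [B] depend on [fu], [fv], [fF] but not on the kernels, so one estimate yields both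
    finiteness ([r] large) and continuity ([delta] small). Each of the two summands of the
    decomposition costs [r]. Asking for [G = repr k k'] only almost surely for each [psi] makes the
    lemma applicable to differences. *)
Lemma normB_repr : exists A B : R, [/\ 0 <= A, 0 <= B &
  forall cst delta k k' r (G : rdistr Y Omega), 0 <= cst -> 0 <= delta -> 0 <= r ->
  kernel_bounds cst delta k -> kernel_bounds cst delta k' ->
  delta * cst * A <= r ^+ 2 -> delta `^ (p - 1) * cst * B <= r `^ p ->
  (forall psi, test QT psi -> {ae P, forall w, G w psi = repr k k' w psi}) ->
  (normB T P p G <= (r + r)%:E)%E].
Proof.
have I0 (f : Omega * (L * pt Y) -> R) (s : R) : 0 <= fine (\int[mZ]_z (`|f z| `^ s)%:E).
  by apply: fine_ge0; apply: integral_ge0 => z _; rewrite lee_fin powR_ge0.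
have K0 := Hm2_const_gt0 Y c.
exists (Hm2_const Y c * (fine (\int[mZ]_z (`|fv z| `^ 2)%:E) +
  fine (\int[mZ]_z (`|fu z| `^ 2)%:E) + fine (\int[mZ]_z (`|fv z| `^ 2)%:E))).
exists (fine (\int[mZ]_z (`|fF z| `^ p)%:E)).
split; [by apply: mulr_ge0; [exact: ltW|rewrite !addr_ge0]|by []|].
move=> cst delta k k' r G c0 d0 r0 bk bk' HA HB HG.
have [mk _ _] := bk; have [mk' _ _] := bk'.
have [mfu _ _] := Lu; have [mfv _ _] := Lv; have [mfF _ _] := LF.
have SS := integral_sqr_sum_le c0 d0 bk bk'.
have m1 := measurable_avg mfv mk; have m2 := measurable_avg mfu mk'.
have m3 := measurable_avg mfv mk'.
have o1 q : ~ QT q.2 -> avg fv k q = 0 := avg_out_ext k Lv.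
have o2 q : ~ QT q.2 -> avg fu k' q = 0 := avg_out_ext k' Lu.
have o3 q : ~ QT q.2 -> avg fv k' q = 0 := avg_out_ext k' Lv.
apply: ge_ereal_inf; exists (normL2Hm2 T P (dual T c (avg fv k) (avg fu k') (avg fv k')) +
  normE T P p (fun w z => avg fF k' (w, z)))%E.
  exists (dual T c (avg fv k) (avg fu k') (avg fv k')), (fun w z => avg fF k' (w, z)).
  split => //; last exact: (inE_avg c0 bk').
  by apply: inL2Hm2_dual => //; exact: le_lt_trans SS (ltry _).
rewrite EFinD; apply: leeD; last exact: (normE_avg c0 bk').
apply: normL2Hm2_dual => //.
apply: (le_trans (lee_wpmul2l _ SS)); first by rewrite lee_fin ltW.
by rewrite -EFinM lee_fin (powR_mulrn 2)// mulrCA.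
Qed.

Lemma integral_repr (k k' : L -> R) (kk : R) (A : set Omega) psi : measurable_fun setT k ->
  measurable_fun setT k' -> (forall s, `|k s| <= kk) -> (forall s, `|k' s| <= kk) ->
  measurable A -> test QT psi ->
  P.-integrable setT (EFin \o (fun w => repr k k' w psi)) /\
  \int[P]_(w in A) repr k k' w psi =
   \int[mu]_x (k x * pairing P fv A psi x) +
   (\int[mu]_x (k' x * pairing P fu A ('D_(dir1 Y) psi) x) -
    \int[mu]_x (k' x * pairing P fv A (fun z => lap_perp psi z + c * psi z) x)) +
   \int[mu]_x (k' x * pairing P fF A psi x).
Proof.
move=> mk mk' bk bk' mA tp.
have t1 : test QT ('D_(dir1 Y) psi) by exact: test_derive.
have t3 : test QT (fun z => lap_perp psi z + c * psi z).
  by apply: testD; [exact: test_lap_perp|exact: testZ].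
have [b0 _ B0] := test_bounded tp; have [b1 _ B1] := test_bounded t1.
have [b3 _ B3] := test_bounded t3.
have n0 := test_measurable cY tp; have n1 := test_measurable cY t1.
have n3 := test_measurable cY t3.
have iu := Lq_integrable mD finD (ler1n R 2) Lu.
have iv := Lq_integrable mD finD (ler1n R 2) Lv.
have iF := Lq_integrable mD finD (ltW p1) LF.
have [_ ou _] := Lu; have [_ ov _] := Lv; have [_ oF _] := LF.
have j1 := integrable_regular_avg iv ov mk bk n0 B0.
have j2 := integrable_regular_avg iu ou mk' bk' n1 B1.
have j3 := integrable_regular_avg iv ov mk' bk' n3 B3.
have j4 := integrable_regular_avg iF oF mk' bk' n0 B0.
have i1 := integral_regular_avg iv ov mk bk n0 B0 mA.
have i2 := integral_regular_avg iu ou mk' bk' n1 B1 mA.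
have i3 := integral_regular_avg iv ov mk' bk' n3 B3 mA.
have i4 := integral_regular_avg iF oF mk' bk' n0 B0 mA.
rewrite -i1 -i2 -i3 -i4.
have sub (f : Omega -> R) : P.-integrable setT (EFin \o f) -> P.-integrable A (EFin \o f).
  exact: integrableS.
have j23 : P.-integrable setT (EFin \o (fun w =>
    regular QT (fun z => avg fu k' (w, z)) ('D_(dir1 Y) psi) -
    regular QT (fun z => avg fv k' (w, z)) (fun z => lap_perp psi z + c * psi z))).
  exact: (integrableB measurableT j2 j3).
have j123 : P.-integrable setT (EFin \o (fun w => dual T c (avg fv k) (avg fu k') (avg fv k') w psi)).
  exact: integrable_add j1 j23.
split; first exact: integrable_add j123 j4.
rewrite -(RintegralB mA (sub _ j2) (sub _ j3)) -(RintegralD mA (sub _ j1) (sub _ j23)).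
by rewrite -(RintegralD mA (sub _ j123) (sub _ j4)).
Qed.

End Representation.

Section Thresholds.
Context (R : realType).

Lemma le_mul_of_le_div (d x y : R) : 0 <= d -> 0 <= x -> 0 <= y -> d <= x / (y + 1) -> d * y <= x.
Proof.
move=> d0 x0 y0; rewrite ler_pdivlMr; last by rewrite ltr_wpDl.
by rewrite mulrDr mulr1; lra.
Qed.

Lemma small_threshold (p a b r : R) : 1 < p -> 0 <= a -> 0 <= b -> 0 < r ->
  exists2 d : R, 0 < d & forall delta, 0 <= delta -> delta <= d ->
    delta * a <= r ^+ 2 /\ delta `^ (p - 1) * b <= r `^ p.
Proof.
move=> p1 a0 b0 r0; have q0 : 0 < p - 1 by rewrite subr_gt0.
have rp : 0 < r `^ p by rewrite powR_gt0.
have r2 : 0 < r ^+ 2 by rewrite exprn_gt0.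
have z0 : 0 < r `^ p / (b + 1) by rewrite divr_gt0// ltr_wpDl.
(* Each inequality is solved for [delta], the second through the power [p - 1 > 0]; adding 1 keeps
   the denominators positive. *)
exists (Num.min (r ^+ 2 / (a + 1)) ((r `^ p / (b + 1)) `^ (p - 1)^-1)).
  by rewrite lt_min powR_gt0// divr_gt0// ltr_wpDl.
move=> delta d0; rewrite le_min => /andP[h1 h2]; split.
  by apply: le_mul_of_le_div => //; exact: ltW.
apply: le_mul_of_le_div => //; [exact: powR_ge0|exact: ltW|].
have E (x : R) : 0 <= x -> x = (x `^ (p - 1)^-1) `^ (p - 1).
  by move=> x0; rewrite -powRrM mulVf ?powRr1// gt_eqF.
rewrite [leRHS](E _ (ltW z0)).
by apply: (@ge0_ler_powR _ (p - 1) (ltW q0)); rewrite ?nnegrE ?powR_ge0.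
Qed.

Lemma large_radius (p a b : R) : 1 < p -> exists2 r : R, 0 <= r & a <= r ^+ 2 /\ b <= r `^ p.
Proof.
(* Since [r >= 1], both [r ^+ 2] and the [p]-th power of [r] are at least [r]. *)
move=> p1; pose r := 1 + `|a| + `|b|; have na := normr_ge0 a; have nb := normr_ge0 b.
have la := ler_norm a; have lb := ler_norm b.
have r1 : 1 <= r by rewrite /r; lra.
exists r; first lra; split.
  by apply: (@le_trans _ _ r); [rewrite /r; lra|rewrite expr2 ler_peMl//; lra].
apply: (@le_trans _ _ r); first by rewrite /r; lra.
rewrite -[leLHS]powRr1; last lra.
by apply: ler_powR => //; exact: ltW.
Qed.

Lemma cvge_to_0 (X : topologicalType) (FF : set_system X) (f : X -> \bar R) : Filter FF ->
  (forall x, (0 <= f x)%E) -> (forall e : R, 0 < e -> \forall x \near FF, (f x <= e%:E)%E) ->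
  f @ FF --> (0 : \bar R)%E.
Proof.
move=> FFF f0 H U /= [e /= e0 He].
apply: filterS (H (e / 2) (divr_gt0 e0 (ltr0Sn R 1))) => x fx /=.
have fn : f x \is a fin_num by rewrite ge0_fin_numE//; exact: le_lt_trans fx (ltry _).
rewrite -(fineK fn); apply: He; rewrite /ball_/= sub0r normrN.
rewrite ger0_norm ?fine_ge0//.
apply: (@le_lt_trans _ _ (e / 2)); first by rewrite -lee_fin fineK.
by rewrite ltr_pdivrMr// ltr_pMr// ltr1n.
Qed.

End Thresholds.

Section ContinuousRepresentation.
Context (R : realType) (T : R) (Y : crossSection R).
Context (dO : measure_display) (Omega : measurableType dO) (P : probability Omega R).
Hypothesis mD : measurable (cs_dom Y).
Hypothesis finD : (cs_measure Y (cs_dom Y) < +oo)%E.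
Hypothesis cY : continuous_measurable (cs_space Y).
Local Notation L := (line R).
Local Notation mu := (leb R).
Local Notation m := (mupt Y).
Local Notation QT := (@Q R T Y).
Variables (p c : R) (fu fv fF : Omega * (L * pt Y) -> R).
Hypothesis p1 : 1 < p.
Hypothesis Lu : in_Lq T P 2 fu.
Hypothesis Lv : in_Lq T P 2 fv.
Hypothesis LF : in_Lq T P p fF.
Local Notation X := (repr T c fu fv fF).

Lemma Rint_mulB (k1 k2 g : L -> R) (K : R) : measurable_fun setT k1 -> measurable_fun setT k2 ->
  (forall s, `|k1 s| <= K) -> (forall s, `|k2 s| <= K) -> mu.-integrable setT (EFin \o g) ->
  \int[mu]_x ((k1 x - k2 x) * g x) = \int[mu]_x (k1 x * g x) - \int[mu]_x (k2 x * g x).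
Proof.
move=> m1 m2 b1 b2 gi; have i1 := integrable_bddM m1 b1 gi; have i2 := integrable_bddM m2 b2 gi.
by rewrite -(RintegralB measurableT i1 i2); apply: eq_Rintegral => x _; rewrite mulrBl.
Qed.

Lemma repr_regroup (a1 a2 b1 b2 c1 c2 d1 d2 : R) :
  (a1 + (b1 - c1) + d1) - (a2 + (b2 - c2) + d2) =
  (a1 - a2) + ((b1 - b2) - (c1 - c2)) + (d1 - d2).
Proof. by ring. Qed.

(** Averages are additive in the kernel only where the integrands in [x] are integrable, hence the
    almost sure statement. By [integral_repr] both sides have the same integral over every event,
    which identifies them. *)
Lemma repr_diff (k1 k1' k2 k2' : L -> R) (K : R) psi :
  measurable_fun setT k1 -> measurable_fun setT k1' ->
  measurable_fun setT k2 -> measurable_fun setT k2' ->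
  (forall s, `|k1 s| <= K) -> (forall s, `|k1' s| <= K) ->
  (forall s, `|k2 s| <= K) -> (forall s, `|k2' s| <= K) -> test QT psi ->
  {ae P, forall w, rsub (X k1 k1') (X k2 k2') w psi =
    X (fun s => k1 s - k2 s) (fun s => k1' s - k2' s) w psi}.
Proof.
move=> m1 m1' m2 m2' b1 b1' b2 b2' tp.
have m12 : measurable_fun setT (fun s => k1 s - k2 s) by exact: measurable_funB.
have m12' : measurable_fun setT (fun s => k1' s - k2' s) by exact: measurable_funB.
have b12 s : `|k1 s - k2 s| <= K + K by rewrite (le_trans (ler_normB _ _))// lerD.
have b12' s : `|k1' s - k2' s| <= K + K by rewrite (le_trans (ler_normB _ _))// lerD.
have [i1 _] := integral_repr mD finD cY c p1 Lu Lv LF m1 m1' b1 b1' measurableT tp.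
have [i2 _] := integral_repr mD finD cY c p1 Lu Lv LF m2 m2' b2 b2' measurableT tp.
have [i3 _] := integral_repr mD finD cY c p1 Lu Lv LF m12 m12' b12 b12' measurableT tp.
apply: ae_eq_of_integrals => //; first exact: (integrableB measurableT i1 i2).
move=> A mA.
have [_ e1] := integral_repr mD finD cY c p1 Lu Lv LF m1 m1' b1 b1' mA tp.
have [_ e2] := integral_repr mD finD cY c p1 Lu Lv LF m2 m2' b2 b2' mA tp.
have [_ e3] := integral_repr mD finD cY c p1 Lu Lv LF m12 m12' b12 b12' mA tp.
have sub (f : Omega -> R) : P.-integrable setT (EFin \o f) -> P.-integrable A (EFin \o f).
  exact: integrableS.
have t1 : test QT ('D_(dir1 Y) psi) by exact: test_derive.
have t3 : test QT (fun z => lap_perp psi z + c * psi z).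
  by apply: testD; [exact: test_lap_perp|exact: testZ].
have [b0 _ B0] := test_bounded tp; have [bd1 _ B1] := test_bounded t1.
have [b3 _ B3] := test_bounded t3.
have iu := Lq_integrable mD finD (ler1n R 2) Lu.
have iv := Lq_integrable mD finD (ler1n R 2) Lv.
have iF := Lq_integrable mD finD (ltW p1) LF.
have g1 := integrable_pairing iv mA (test_measurable cY tp) B0.
have g2 := integrable_pairing iu mA (test_measurable cY t1) B1.
have g3 := integrable_pairing iv mA (test_measurable cY t3) B3.
have g4 := integrable_pairing iF mA (test_measurable cY tp) B0.
rewrite e3 (Rint_mulB m1 m2 b1 b2 g1) (Rint_mulB m1' m2' b1' b2' g2).
rewrite (Rint_mulB m1' m2' b1' b2' g3) (Rint_mulB m1' m2' b1' b2' g4).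
apply: (etrans (RintegralB mA (sub _ i1) (sub _ i2))).
by rewrite e1 e2 repr_regroup.
Qed.

Definition kernel_family (C : R) (k : L -> L -> R) :=
  [/\ forall x, measurable_fun setT (k x),
      forall x s, itvcc 1 x -> `|k x s| <= C &
      forall x x', itvcc 1 x -> itvcc 1 x' ->
        (\int[mu]_(s in itvoo 1) `|k x' s - k x s|%:E <= (C * `|x' - x|)%:E)%E].

Lemma measurable_repr (k k' : L -> R) (K : R) psi : measurable_fun setT k -> measurable_fun setT k' ->
  (forall s, `|k s| <= K) -> (forall s, `|k' s| <= K) -> test QT psi ->
  measurable_fun setT (fun w => X k k' w psi).
Proof.
move=> mk mk' bk bk' tp; apply: integrable_measurable.
exact: (integral_repr mD finD cY c p1 Lu Lv LF mk mk' bk bk' measurableT tp).1.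
Qed.

(** The interval [(0, 1)] has measure 1, so the uniform bound also bounds the mass. *)
Lemma family_bounds C k x : 0 <= C -> kernel_family C k -> itvcc 1 x -> kernel_bounds C C (k x).
Proof.
move=> C0 [mk bk _] xI; split => //; first by move=> s _; exact: bk.
have mI := @measurable_itvoo R 1.
apply: (@le_trans _ _ (\int[mu]_(s in itvoo 1) (cst C%:E s))%E).
  by apply: ge0_le_integral_sup => s _; rewrite lee_fin//; exact: bk.
have E : mu (itvoo 1) = 1%E.
  by rewrite /itvoo /leb/= lebesgue_measure_itv/= lte_fin ltr01 sube0.
apply: (eq_ind_r (fun z => (z <= _)%E) _ (integral_cst mu mI C%:E)).
by apply: (eq_ind_r (fun z => (C%:E * z <= C%:E)%E) _ E); rewrite mule1.
Qed.

Lemma family_diff_bounds C k x x' : kernel_family C k -> itvcc 1 x -> itvcc 1 x' ->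
  kernel_bounds (C + C) (C * `|x' - x|) (fun s => k x' s - k x s).
Proof.
move=> [mk bk dk] xI xI'; split; [exact: measurable_funB| |exact: dk].
by move=> s _; rewrite (le_trans (ler_normB _ _))// lerD// bk.
Qed.

Lemma CxB_repr (C : R) (k k' : L -> L -> R) : 0 <= C -> kernel_family C k ->
  kernel_family C k' -> CxB T P p (fun x => X (k x) (k' x)).
Proof.
move=> C0 fk fk' x xI; have [mk bk _] := fk; have [mk' bk' _] := fk'.
have [A [B [A0 B0 HB]]] := normB_repr mD finD cY c p1 Lu Lv LF.
split; first split.
- move=> psi tp.
  by apply: (measurable_repr (mk x) (mk' x) (K := C)) => // s; [exact: bk|exact: bk'].
(* Finiteness of the norm: [normB_repr] with mass [C] and a sufficiently large radius. *)
- have [r r0 [h1 h2]] := large_radius (C * C * A) (C `^ (p - 1) * C * B) p1.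
  apply: le_lt_trans (ltry (r + r)).
  apply: (HB C C (k x) (k' x)) => //; try exact: family_bounds.
  by move=> psi _; apply: aeW.
apply: cvge_to_0 => [x'|e e0].
  apply: le_ereal_inf_tmp => _ [g [h [_ _ _ ->]]]; apply: adde_ge0; exact: Lnorm_ge0.
have e2 : 0 < e / 2 by rewrite divr_gt0.
have C20 : 0 <= (C + C) by rewrite addr_ge0.
(* Continuity: the difference of two kernels has size at most [C + C] and mass at most [C |x' - x|],
   so [normB_repr] applies with fixed size and small mass; each summand of [B] receives [e / 2]. *)
have [d d0 Hd] := small_threshold p1 (mulr_ge0 C20 A0) (mulr_ge0 C20 B0) e2.
have dC : 0 < d / (C + 1) by rewrite divr_gt0// ltr_wpDl.
rewrite near_withinE.
have H0 : nbhs (x : L) (fun x' : L => `|(x : R) - x'| < d / (C + 1)).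
  apply/nbhs_ballP; exists (d / (C + 1)) => //=.
apply: filterS H0 => x' xx' xI'.
have xC : C * `|x' - x| <= d.
  rewrite distrC mulrC; apply: le_mul_of_le_div => //; [exact: ltW|exact: ltW].
have xC0 : 0 <= C * `|x' - x| by rewrite mulr_ge0.
have [h1 h2] := Hd _ xC0 xC.
rewrite [e](_ : _ = e / 2 + e / 2); last exact: splitr.
apply: (HB (C + C) (C * `|x' - x|) (fun s => k x' s - k x s) (fun s => k' x' s - k' x s)) => //.
- exact: ltW.
- exact: family_diff_bounds.
- exact: family_diff_bounds.
- by rewrite -mulrA.
- by rewrite -mulrA.
- move=> psi tp; apply: (@repr_diff _ _ _ _ C) => // s; by [exact: bk|exact: bk'].
Qed.

End ContinuousRepresentation.

(** * The kernels *)

Section KernelFamilies.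
Context (R : realType).
Local Notation L := (line R).
Local Notation mu := (leb R).
Variable rho : L -> R.
Hypothesis rho_test : test (itvoo 1) rho.
Local Notation rho' := ('D_(1 : R) rho : L -> R).

(** With [S = u_xxx], insert [u_xx(r) = - int rho' u_x + int k(r, s) S(s) ds] into [u_x(x) = int rho
    u_x + int k(x, r) u_xx(r) dr]. The constant mean of [u_xx] is multiplied by the mass
    [kern_mass x], giving the weight [kern1] on [u_x]; the remainder is the iterated kernel [kern2]
    on [S]. *)
Definition kern_mass (x : L) : R := \int[mu]_r (\1_(itvoo 1) r * kern rho x r).

Definition kern2 (x s : L) : R := \int[mu]_r ((kern rho x r * kern rho r s) * \1_(itvoo 1) r).

Lemma family_weaken C C' (k : L -> L -> R) : C <= C' -> kernel_family C k -> kernel_family C' k.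
Proof.
move=> CC [mk bk dk]; split => // [x s xI|x x' xI xI']; first exact: le_trans (bk _ _ xI) CC.
by apply: (le_trans (dk x x' xI xI')); rewrite lee_fin ler_wpM2r.
Qed.

Lemma family_const (k : L -> R) : test (itvoo 1) k -> exists2 C, 0 <= C &
  kernel_family C (fun _ : L => k).
Proof.
move=> tk; have [C C0 HC] := test_bounded tk; exists C => //; split => // [x|x x' _ _].
  exact: test_line_measurable tk.
rewrite integral0_eq ?lee_fin ?mulr_ge0// => s _; by rewrite subrr normr0.
Qed.

Lemma measurable_kern1 x : measurable_fun setT (kern rho x).
Proof. exact: (measurableT_comp (measurable_kern rho_test) (pair1_measurable x)). Qed.

Lemma kern_diff (x x' s : L) : (x : R) <= x' ->
  `|kern rho x' s - kern rho x s| = ((x : R) <= s)%R%:R - ((x' : R) <= s)%R%:R.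
Proof.
move=> xx'; rewrite /kern (_ : _ - _ - _ = ((x : R) <= s)%R%:R - ((x' : R) <= s)%R%:R); last by ring.
rewrite ger0_norm// subr_ge0; have [x's|] := boolP ((x' : R) <= s) => //.
by rewrite (le_trans xx' x's).
Qed.

(** The term [prim rho s] does not depend on [x]. The difference of two kernels is thus, up to sign,
    the indicator of the interval between [x] and [x'], of mass [|x' - x|]. *)
Lemma family_kern : exists2 C, 0 <= C & kernel_family C (kern rho).
Proof.
have [C C0 HC] := kern_bounded rho_test; exists (C + 1); first by rewrite addr_ge0.
split => [x|x s _|]; [exact: measurable_kern1|by rewrite (le_trans (HC _ _))// lerDl|].
suff H (x x' : L) : (x : R) <= x' ->
    (\int[mu]_(s in itvoo 1) `|kern rho x' s - kern rho x s|%:E <= (`|x' - x|)%:E)%E.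
  move=> x x' _ _; apply: (@le_trans _ _ (`|x' - x|)%:E); last first.
    by rewrite lee_fin ler_peMl// lerDr.
  have [xx|/ltW xx] := leP (x : R) x'; first exact: H.
  have := H _ _ xx; rewrite distrC (eq_integral (fun s => `|kern rho x' s - kern rho x s|%:E))//.
  by move=> s _; rewrite distrC.
move=> xx'; have mI : measurable ([set` `[x : R, x'[] : set L) by exact: measurable_itv.
apply: (@le_trans _ _ (\int[mu]_s (\1_([set` `[x : R, x'[]) s)%:E)%E).
  rewrite [leLHS]integral_mkcond; apply: ge0_le_integral_sup => s _.
    by rewrite patchE; case: ifPn.
  rewrite patchE; case: ifPn => _; last by rewrite lee_fin.
  rewrite lee_fin kern_diff// indicE; have [x's|sx'] := leP (x' : R) s.
    by rewrite (le_trans xx' x's) subrr.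
  have [xs|] := leP (x : R) s; last by rewrite subrr.
  by rewrite subr0 mem_set//= in_itv/= xs sx'.
rewrite integral_indic// setIT /leb/= lebesgue_measure_itv/= lte_fin.
by case: ifPn => [_|_]; rewrite lee_fin// ler_norm.
Qed.

Lemma integrable_indic_unit : mu.-integrable setT (EFin \o (\1_(itvoo 1) : L -> R)).
Proof. exact: integrable_itv_indic. Qed.

Lemma weighted_mass_bound (B C D : R) (g h : L -> R) : measurable_fun setT g ->
  measurable_fun setT h -> (forall r, `|g r| <= B) -> (forall r, `|h r| <= C) ->
  (\int[mu]_(s in itvoo 1) `|g s|%:E <= D%:E)%E ->
  mu.-integrable setT (EFin \o (fun r => (g r * h r) * \1_(itvoo 1) r)) /\
  `|\int[mu]_r ((g r * h r) * \1_(itvoo 1) r)| <= C * D.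
Proof.
move=> mg mh bg bh gD.
have C0 : 0 <= C by rewrite (le_trans _ (bh 0)).
have i : mu.-integrable setT (EFin \o (fun r => (g r * h r) * \1_(itvoo 1) r)).
  apply: (integrable_bddM (c := B * C) _ _ integrable_indic_unit); first exact: measurable_funM.
  by move=> r; rewrite normrM ler_pM.
split => //; apply: (le_trans (le_normr_Rintegral measurableT i)).
have mn : measurable_fun setT (fun r => `|g r|) by exact: measurableT_comp.
have ig : mu.-integrable setT (EFin \o (fun r => `|g r| * \1_(itvoo 1) r)).
  by apply: (integrable_bddM mn _ integrable_indic_unit) => r; rewrite normr_id; exact: bg.
apply: (@le_trans _ _ (\int[mu]_r (C * (`|g r| * \1_(itvoo 1) r)))).
  apply: le_Rintegral => //.
  - exact: (integrable_norm i).
  - exact: (integrable_scale C ig).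
  - move=> r _; rewrite !normrM [X in _ * X]ger0_norm; last by rewrite indicE.
    by rewrite mulrA ler_wpM2r// mulrC ler_wpM2r.
rewrite (Rint_scale C ig) ler_wpM2l// -lee_fin; apply: le_trans gD.
rewrite /Rintegral fineK; last exact: (integrable_fin_num measurableT ig).
rewrite [leRHS]integral_mkcond; apply: ge0_le_integral_sup => r _.
  by rewrite lee_fin mulr_ge0.
by rewrite patchE indicE; case: ifPn => _; rewrite ?mulr1// mulr0.
Qed.

Lemma kern1_norm_bound : exists2 C, 0 <= C & forall x, itvcc 1 x -> forall (D : R) (h : L -> R),
  measurable_fun setT h -> (forall r, `|h r| <= D) ->
  mu.-integrable setT (EFin \o (fun r => (kern rho x r * h r) * \1_(itvoo 1) r)) /\
  `|\int[mu]_r ((kern rho x r * h r) * \1_(itvoo 1) r)| <= D * C.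
Proof.
have [C C0 fk] := family_kern; exists C => // x xI D h mh bh; have [mk bk _] := fk.
have [_ _ kx] := family_bounds C0 fk xI.
by apply: (weighted_mass_bound (mk x) mh (fun r => bk x r xI) bh kx).
Qed.

Lemma kern1_diff_bound : exists2 C, 0 <= C & forall x x', itvcc 1 x -> itvcc 1 x' ->
  forall (D : R) (h : L -> R),
  measurable_fun setT h -> (forall r, `|h r| <= D) ->
  `|\int[mu]_r ((kern rho x' r * h r) * \1_(itvoo 1) r) -
    \int[mu]_r ((kern rho x r * h r) * \1_(itvoo 1) r)| <= D * (C * `|x' - x|).
Proof.
have [C C0 fk] := family_kern; have [C' _ H] := kern1_norm_bound.
exists C => // x x' xI xI' D h mh bh; have [mk bk _] := fk.
have [i1 _] := H _ xI _ _ mh bh; have [i2 _] := H _ xI' _ _ mh bh.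
have [mdk bdk dk] := family_diff_bounds fk xI xI'.
have bd r : `|kern rho x' r - kern rho x r| <= C + C.
  by rewrite (le_trans (ler_normB _ _))// lerD// bk.
have [_ H2] := weighted_mass_bound mdk mh bd bh dk.
rewrite -(RintegralB measurableT i2 i1); apply: le_trans H2.
rewrite le_eqVlt; apply/orP; left; apply/eqP; congr (`|_|).
by apply: eq_Rintegral => r _; ring.
Qed.

Lemma kern_mass_bounds : exists2 C, 0 <= C &
  (forall x, itvcc 1 x -> `|kern_mass x| <= C) /\
  (forall x x', itvcc 1 x -> itvcc 1 x' -> `|kern_mass x' - kern_mass x| <= C * `|x' - x|).
Proof.
have [C C0 H] := kern1_norm_bound; have [D D0 H'] := kern1_diff_bound.
have E x : kern_mass x = \int[mu]_r ((kern rho x r * (fun=> 1) r) * \1_(itvoo 1) r).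
  by apply: eq_Rintegral => r _; rewrite mulr1 mulrC.
have b1 (r : L) : `|(1 : R)| <= 1 by rewrite normr1.
exists (C + D); first exact: addr_ge0.
split=> [x xI|x x' xI xI']; rewrite !E.
  by apply: (le_trans (H x xI 1 (fun=> 1) (measurable_cst _) b1).2); rewrite mul1r lerDl.
apply: (le_trans (H' x x' xI xI' 1 (fun=> 1) (measurable_cst _) b1)).
by rewrite mul1r ler_wpM2r// lerDr.
Qed.

Lemma measurable_kern_row s : measurable_fun setT (fun r => kern rho r s).
Proof. exact: (measurableT_comp (measurable_kern rho_test) (pair2_measurable s)). Qed.

Lemma measurable_kern2 x : measurable_fun setT (kern2 x).
Proof.
apply: (measurable_Rintegral2 mu (f := fun z => (kern rho x z.1 * kern rho z.1 z.2) * \1_(itvoo 1) z.1)).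
apply: measurable_funM; [apply: measurable_funM|].
- exact: (measurableT_comp (measurable_kern1 x) measurable_fst).
- exact: measurable_kern.
- apply: (measurableT_comp (measurable_indic (@measurable_itvoo R 1))); exact: measurable_fst.
Qed.

Lemma kern2_bounded : exists2 C, 0 <= C & forall x s, itvcc 1 x -> `|kern2 x s| <= C.
Proof.
have [C C0 H] := kern1_norm_bound; have [D D0 HD] := kern_bounded rho_test.
exists (D * C) => [|x s xI]; first exact: mulr_ge0.
exact: (H x xI D _ (measurable_kern_row s) (fun r => HD r s)).2.
Qed.

(** [x] enters through the first factor only, which is Lipschitz in [L^1], and the second is
    bounded; the iterated kernel is therefore Lipschitz in [x] uniformly in [s]. *)
Lemma family_kern2 : exists2 C, 0 <= C & kernel_family C kern2.
Proof.
have [C C0 H] := kern2_bounded; have [D D0 HD] := kern_bounded rho_test.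
have [E E0 HE] := kern1_diff_bound.
exists (C + D * E); first by rewrite addr_ge0 ?mulr_ge0.
split => [x|x s xI|x x' xI xI']; first exact: measurable_kern2.
  by rewrite (le_trans (H _ _ xI))// lerDl mulr_ge0.
have mI := @measurable_itvoo R 1.
apply: (@le_trans _ _ (\int[mu]_(s in itvoo 1) (cst (D * (E * `|x' - x|))%:E s))%E).
  apply: ge0_le_integral_sup => s _; rewrite lee_fin//.
  exact: (HE x x' xI xI' D _ (measurable_kern_row s) (fun r => HD r s)).
have ui : mu (itvoo 1) = 1%E.
  by rewrite /itvoo /leb/= lebesgue_measure_itv/= lte_fin ltr01 sube0.
apply: (eq_ind_r (fun z => (z <= _)%E) _ (integral_cst mu mI _)).
apply: (eq_ind_r (fun z => (_ * z <= _)%E) _ ui).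
by rewrite mule1 lee_fin mulrA ler_wpM2r// lerDr.
Qed.

Definition kern1 (x s : L) : R := rho s + (- kern_mass x) * rho' s.

Lemma family_kern1 : exists2 C, 0 <= C & kernel_family C kern1.
Proof.
have t' : test (itvoo 1) rho' by exact: test_derive.
have [C C0 [HC1 HC2]] := kern_mass_bounds.
have [a a0 Ha] := test_bounded rho_test; have [b b0 Hb] := test_bounded t'.
have m1 := test_line_measurable rho_test; have m2 := test_line_measurable t'.
exists (a + C * b); first by rewrite addr_ge0 ?mulr_ge0.
split => [x|x s xI|x x' xI xI'].
- by apply: measurable_funD => //; apply: measurable_funM.
- apply: (le_trans (ler_normD _ _)); apply: lerD; first exact: Ha.
  by rewrite normrM normrN ler_pM// HC1.
have mI := @measurable_itvoo R 1.
apply: (@le_trans _ _ (\int[mu]_(s in itvoo 1) (cst (C * `|x' - x| * b)%:E s))%E).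
  apply: ge0_le_integral_sup => s _; rewrite lee_fin//=.
  rewrite /kern1 (_ : _ - _ = (kern_mass x - kern_mass x') * rho' s); last by ring.
  by rewrite normrM distrC ler_pM// HC2.
have ui : mu (itvoo 1) = 1%E.
  by rewrite /itvoo /leb/= lebesgue_measure_itv/= lte_fin ltr01 sube0.
apply: (eq_ind_r (fun z => (z <= _)%E) _ (integral_cst mu mI _)).
apply: (eq_ind_r (fun z => (_ * z <= _)%E) _ ui).
by rewrite mule1 lee_fin mulrAC ler_wpM2r// lerDr.
Qed.

Lemma kern_iterated (x : L) (H : L -> R) : itvcc 1 x -> mu.-integrable setT (EFin \o H) ->
  \int[mu]_r (kern rho x r * (\1_(itvoo 1) r * \int[mu]_s (kern rho r s * H s))) =
  \int[mu]_s (kern2 x s * H s).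
Proof.
move=> xI Hi; have [D D0 HD] := kern_bounded rho_test.
have [B B0 HB] := kern2_bounded.
have mI : measurable_fun setT (fun z : L * L => \1_(itvoo 1) z.1 : R).
  by apply: (measurableT_comp (measurable_indic (@measurable_itvoo R 1))); exact: measurable_fst.
have i2 : (mu \x mu)%E.-integrable setT (EFin \o (fun z : L * L =>
    (kern rho x z.1 * kern rho z.1 z.2) * (\1_(itvoo 1) z.1 * H z.2))).
  apply: (integrable_bddM (c := D * D) _ _ (integrable_tensor integrable_indic_unit Hi)).
    apply: measurable_funM; last exact: measurable_kern.
    exact: (measurableT_comp (measurable_kern1 x) measurable_fst).
  by move=> z; rewrite normrM ler_pM.
have [j1 e1] := Rfubini1 i2; have [j2 e2] := Rfubini2 i2.
transitivity (\int[mu]_r \int[mu]_s ((kern rho x r * kern rho r s) * (\1_(itvoo 1) r * H s))).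
  apply: eq_Rintegral => r _.
  have k1 : mu.-integrable setT (EFin \o (fun s => kern rho r s * H s)).
    exact: (integrable_bddM (measurable_kern1 r) (HD r) Hi).
  rewrite -(Rint_scale _ k1) -(Rint_scale _ (integrable_scale _ k1)).
  by apply: eq_Rintegral => s _; ring.
rewrite e1 -e2; apply: eq_Rintegral => s _.
have mr := measurable_kern_row s.
have k2 : mu.-integrable setT (EFin \o (fun r => (kern rho x r * kern rho r s) * \1_(itvoo 1) r)).
  apply: (integrable_bddM (c := D * D) _ _ integrable_indic_unit).
    by apply: measurable_funM => //; exact: measurable_kern1.
  by move=> r; rewrite normrM ler_pM.
rewrite /kern2 mulrC -(Rint_scale _ k2); apply: eq_Rintegral => r _; ring.
Qed.

End KernelFamilies.

(** * The averages are the weak derivatives of u *)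

Section WeakDerivatives.
Context (R : realType) (T : R) (Y : crossSection R).
Context (dO : measure_display) (Omega : measurableType dO) (P : probability Omega R).
Hypothesis T0 : 0 < T.
Hypothesis mD : measurable (cs_dom Y).
Hypothesis finD : (cs_measure Y (cs_dom Y) < +oo)%E.
Hypothesis cY : continuous_measurable (cs_space Y).
Local Notation L := (line R).
Local Notation mu := (leb R).
Local Notation m := (mupt Y).
Local Notation mS := (prod_measure (leb R) (mupt Y)).
Local Notation mZ := (P \x mS)%E.
Local Notation PW := (prod_measure P (mupt Y)).
Local Notation QT := (@Q R T Y).
Local Notation MM := (@M R Y).

(** [in_x] leads to an iterated integral over [omega] and [Q], [pairing] to one over the product. By
    Fubini they agree where the section is integrable, that is for almost every [x]. The auxiliary
    [J] is a measurable version of the former, so that the two can be compared under the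
    integral. *)
Lemma integral_in_x (u : process Y Omega) (A : set Omega) (a : L -> R) psi :
  mZ.-integrable setT (EFin \o ext T u) -> measurable A -> test (itvoo 1) a -> test QT psi ->
  \int[mu]_(x in itvoo 1) (a x * \int[P]_(w in A) in_x T u x w psi) =
  \int[mu]_x (a x * pairing P (ext T u) A psi x).
Proof.
move=> ui mA ta tp; have [b _ Hb] := test_bounded tp; have mp := test_measurable cY tp.
have mext := integrable_measurable ui.
pose J x := \int[P]_w \int[m]_z ((\1_A w * psi z) * ext T u (shuffle (x, (w, z)))).
have mJ : measurable_fun setT J.
  have m21 : measurable_fun setT (fun q : (L * Omega) * pt Y => (q.1.1, (q.1.2, q.2))).
    apply/measurable_fun_pairP; split.
      exact: (measurableT_comp measurable_fst measurable_fst).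
    apply/measurable_fun_pairP; split; last exact: measurable_snd.
    exact: (measurableT_comp measurable_snd measurable_fst).
  have mG : measurable_fun setT (fun q : (L * Omega) * pt Y =>
      (\1_A q.1.2 * psi q.2) * ext T u (shuffle (q.1.1, (q.1.2, q.2)))).
    apply: measurable_funM; first apply: measurable_funM.
    - apply: (measurableT_comp (measurable_indic mA)).
      exact: (measurableT_comp measurable_snd measurable_fst).
    - exact: (measurableT_comp mp measurable_snd).
    - exact: (measurableT_comp (measurableT_comp mext
        (@measurable_shuffle _ _ _ _ Omega L L Y)) m21).
  exact: (measurable_Rintegral1 P (measurable_Rintegral1 m mG)).
have JE x : itvoo 1 x -> \int[P]_(w in A) in_x T u x w psi = J x.
  move=> xI; rewrite Rintegral_mkcond; apply: eq_Rintegral => w _.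
  have E : in_x T u x w psi = \int[m]_z (psi z * ext T u (shuffle (x, (w, z)))).
    rewrite /in_x /regular Rintegral_mkcond; apply: eq_Rintegral => z _.
    rewrite slice_ext// !patchE; have [zQ|zQ] := pselect (QT z).
      by rewrite !mem_set//= mulrC.
    by rewrite !memNset ?mulr0//= => -[_].
  rewrite patchE; case: ifPn => wA.
    by rewrite E; apply: eq_Rintegral => z _; rewrite indicE wA mul1r.
  by rewrite /Rintegral integral0_eq// => z _; rewrite indicE (negbTE wA) !mul0r.
have ma := test_line_measurable ta.
have [ka _ Ha] := test_bounded ta.
have ip := integrable_bddM ma Ha (integrable_pairing ui mA mp Hb).
rewrite [LHS]Rintegral_mkcond.
transitivity (\int[mu]_x (a x * J x)).
  apply: eq_Rintegral => x _; rewrite patchE; case: ifPn => [/set_mem xI|/negP xI].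
    by rewrite JE.
  by rewrite (test_out ta) ?mul0r// => xI'; apply: xI; exact: mem_set.
rewrite /Rintegral; congr fine; apply: ae_eq_integral => //.
- by apply/measurable_EFinP; exact: measurable_funM.
- exact: (measurable_int _ ip).
apply: filterS (ae_integrable_pairing ui mA mp Hb) => x ix _ /=.
by rewrite /J /pairing (Rfubini1 ix).2.
Qed.

Section Equation.
Variables (p c : R) (u v F : process Y Omega) (rho : L -> R).
Hypothesis p1 : 1 < p.
Hypothesis Lu : in_Lq T P 2 (ext T u).
Hypothesis Lv : in_Lq T P 2 (ext T v).
Hypothesis LF : in_Lq T P p (ext T F).
Hypothesis uv : {ae P, forall w, {ae mu, forall t, itvoo T t -> forall th, test MM th ->
      ddistr (dir1 Y) (regular MM (u w t)) th = regular MM (v w t) th}}.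
Hypothesis sol : solves T P c F u.
Hypothesis rho_test : test (itvoo 1) rho.
Hypothesis rho_int : \int[mu]_x rho x = 1.
Local Notation rho' := ('D_(1 : R) rho : L -> R).
Local Notation X := (repr T c (ext T u) (ext T v) (ext T F)).

(* [u_xx] is recovered from [u_xxx] and the mean [- int rho' u_x] of [u_xx];
   [u_x] from this representation of [u_xx] and the mean [int rho u_x]. *)
Definition dxx (x : L) : rdistr Y Omega := X (fun s => -1 * rho' s) (kern rho x).
Definition dx (x : L) : rdistr Y Omega := X (kern1 rho x) (kern2 rho x).

Section Fixed.
Variables (A : set Omega) (psi : pt Y -> R).
Hypothesis mA : measurable A.
Hypothesis tp : test QT psi.

Definition dx_pairing := pairing P (ext T v) A psi.
(** The pairing of [u_xxx], read off the equation, with the derivatives in [t] and [x^perp] on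
    [psi]. *)
Definition source_pairing x := pairing P (ext T F) A psi x +
  (pairing P (ext T u) A ('D_(dir1 Y) psi) x +
   -1 * pairing P (ext T v) A (fun z => lap_perp psi z + c * psi z) x).

Lemma test_order2 : test QT (fun z => lap_perp psi z + c * psi z).
Proof. by apply: testD; [exact: test_lap_perp|exact: testZ]. Qed.

Lemma integrable_pairing_test (f : process Y Omega) b q : 1 <= q -> in_Lq T P q (ext T f) ->
  test QT b -> mu.-integrable setT (EFin \o pairing P (ext T f) A b).
Proof.
move=> q1 Lf tb; have [B _ HB] := test_bounded tb.
exact: (integrable_pairing (Lq_integrable mD finD q1 Lf) mA (test_measurable cY tb) HB).
Qed.

Lemma integrable_pairing_F : mu.-integrable setT (EFin \o pairing P (ext T F) A psi).
Proof. exact: (integrable_pairing_test (ltW p1) LF tp). Qed.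
Lemma integrable_pairing_u : mu.-integrable setT (EFin \o pairing P (ext T u) A ('D_(dir1 Y) psi)).
Proof. exact: (integrable_pairing_test (ler1n R 2) Lu (test_derive _ tp)). Qed.
Lemma integrable_pairing_v : mu.-integrable setT (EFin \o
  pairing P (ext T v) A (fun z => lap_perp psi z + c * psi z)).
Proof. exact: (integrable_pairing_test (ler1n R 2) Lv test_order2). Qed.

Lemma integrable_dx_pairing : mu.-integrable setT (EFin \o dx_pairing).
Proof. exact: (integrable_pairing_test (ler1n R 2) Lv tp). Qed.

Lemma integrable_source_pairing : mu.-integrable setT (EFin \o source_pairing).
Proof.
exact: (integrable_add integrable_pairing_F (integrable_add integrable_pairing_u (integrable_scale (-1) integrable_pairing_v))).
Qed.

Lemma integral_weight_source (k : L -> R) (K : R) : measurable_fun setT k -> (forall s, `|k s| <= K) ->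
  \int[mu]_x (k x * source_pairing x) = \int[mu]_x (k x * pairing P (ext T F) A psi x) +
  (\int[mu]_x (k x * pairing P (ext T u) A ('D_(dir1 Y) psi) x) -
   \int[mu]_x (k x * pairing P (ext T v) A (fun z => lap_perp psi z + c * psi z) x)).
Proof.
move=> mk bk; have jF := integrable_bddM mk bk integrable_pairing_F; have ju := integrable_bddM mk bk integrable_pairing_u.
have jv := integrable_bddM mk bk integrable_pairing_v.
have sc : - (\int[mu]_x (k x * pairing P (ext T v) A (fun z => lap_perp psi z + c * psi z) x)) =
  \int[mu]_x (-1 * (k x * pairing P (ext T v) A (fun z => lap_perp psi z + c * psi z) x)).
  by rewrite (Rint_scale (-1) jv) mulN1r.
have jv' := integrable_scale (-1) jv.
apply: esym; apply: (etrans (congr2 +%R erefl (congr2 +%R erefl sc))).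
apply: (etrans (congr2 +%R erefl (esym (Rint_add ju jv')))).
apply: (etrans (esym (Rint_add jF (integrable_add ju jv')))).
apply: eq_Rintegral => x _; rewrite /source_pairing.
move: (pairing _ _ _ _ x) (pairing _ _ _ _ x) (pairing _ _ _ _ x) => a b d.
by rewrite !mulrDr; congr (_ + (_ + _)); exact: mulrCA.
Qed.

Lemma second_derivative_dx_pairing phi : test (itvoo 1) phi ->
  \int[mu]_x ('D_(1 : R) ('D_(1 : R) phi : L -> R) x * dx_pairing x) = \int[mu]_x (phi x * source_pairing x).
Proof.
move=> tphi; have [b _ Hb] := test_bounded tphi.
rewrite (integral_weight_source (test_line_measurable tphi) Hb).
exact: (pairing_equation T0 cY (Lq_integrable mD finD (ler1n R 2) Lu)
  (Lq_integrable mD finD (ler1n R 2) Lv) (Lq_integrable mD finD (ltW p1) LF) uv sol mA tphi tp).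
Qed.

Lemma swap_terms (a b d e : R) : a + (b - d) + e = a + (e + (b - d)).
Proof. by ring. Qed.

Lemma integral_repr_pairing (k k' : L -> R) (K : R) : measurable_fun setT k -> measurable_fun setT k' ->
  (forall s, `|k s| <= K) -> (forall s, `|k' s| <= K) ->
  \int[P]_(w in A) X k k' w psi = \int[mu]_x (k x * dx_pairing x) + \int[mu]_x (k' x * source_pairing x).
Proof.
move=> mk mk' bk bk'; rewrite (integral_weight_source mk' bk').
have [_ ->] := integral_repr mD finD cY c p1 Lu Lv LF mk mk' bk bk' mA tp.
exact: swap_terms.
Qed.

(** Plays the part of [l] in [primitive_representation]: [u_xx] is so far known only weakly, so its
    pairing exists only tested against [phi]. *)
Definition test_uxx (phi : L -> R) : R := -1 * \int[mu]_x ('D_(1 : R) phi x * dx_pairing x).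
Definition test_ux (phi : L -> R) : R := \int[mu]_x (phi x * dx_pairing x).
Definition uxx_pairing (x : L) : R := test_uxx rho + \int[mu]_s (kern rho x s * source_pairing s).

Lemma integrable_test_dx_pairing phi : test (itvoo 1) phi ->
  mu.-integrable setT (EFin \o (fun x => phi x * dx_pairing x)).
Proof.
move=> tphi; have [b _ Hb] := test_bounded tphi.
exact: (integrable_bddM (test_line_measurable tphi) Hb integrable_dx_pairing).
Qed.

Lemma test_ux_linear (a : R) phi chi : test (itvoo 1) phi -> test (itvoo 1) chi ->
  test_ux (fun x => phi x + a * chi x) = test_ux phi + a * test_ux chi.
Proof.
move=> t1 t2; have i1 := integrable_test_dx_pairing t1; have i2 := integrable_test_dx_pairing t2.
rewrite /test_ux -(Rint_scale a i2) -(Rint_add i1 (integrable_scale a i2)).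
by apply: eq_Rintegral => x _; rewrite mulrDl mulrA.
Qed.

Lemma test_uxx_linear (a : R) phi chi : test (itvoo 1) phi -> test (itvoo 1) chi ->
  test_uxx (fun x => phi x + a * chi x) = test_uxx phi + a * test_uxx chi.
Proof.
move=> t1 t2.
have E : 'D_(1 : R) (fun x : L => phi x + a * chi x) =
    (fun x => 'D_(1 : R) phi x + a * 'D_(1 : R) chi x).
  apply/funext => x; have ta := testZ a t2.
  by rewrite (derive_smoothD _ _ (test_smooth t1) (test_smooth ta))
    (derive_smoothZ _ _ _ (test_smooth t2)).
have H1 := test_ux_linear a (test_derive (1 : R) t1) (test_derive (1 : R) t2).
have E2 : \int[mu]_x ('D_(1 : R) (fun x : L => phi x + a * chi x) x * dx_pairing x) =
    test_ux (fun x : L => 'D_(1 : R) phi x + a * 'D_(1 : R) chi x).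
  by apply: eq_Rintegral => x _; congr (_ * _); exact: (congr1 (fun g => g x) E).
apply: (etrans (congr1 ( *%R (-1)) (etrans E2 H1))).
by rewrite mulrDr mulrCA.
Qed.

Lemma uxx_pairing_weak phi : test (itvoo 1) phi -> \int[mu]_x (phi x * uxx_pairing x) = test_uxx phi.
Proof.
move=> tphi; apply: (primitive_representation rho_test rho_int test_uxx_linear integrable_source_pairing) => //.
by move=> zeta tz; rewrite /test_uxx second_derivative_dx_pairing// mulN1r.
Qed.

(** Boundedness makes [uxx_pairing] integrable over [(0, 1)], so it can serve as the derivative [h]
    in the second use of [primitive_representation], for [u_x]. *)
Lemma uxx_pairing_bounded : exists2 C, 0 <= C & forall x, `|uxx_pairing x| <= C.
Proof.
have [D D0 HD] := kern_bounded rho_test.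
have nH : mu.-integrable setT (EFin \o (fun s => `|source_pairing s|)) := integrable_norm integrable_source_pairing.
exists (`|test_uxx rho| + D * \int[mu]_s `|source_pairing s|).
  by rewrite addr_ge0// mulr_ge0//; apply: Rintegral_ge0 => s _.
move=> x; apply: (le_trans (ler_normD _ _)); apply: lerD => //.
have i1 := integrable_bddM (measurable_kern1 rho_test x) (HD x) integrable_source_pairing.
apply: (le_trans (le_normr_Rintegral measurableT i1)).
rewrite -(Rint_scale D nH); apply: le_Rintegral => //.
- exact: (integrable_norm i1).
- exact: integrable_scale.
- by move=> s _; rewrite normrM ler_wpM2r.
Qed.

Lemma measurable_uxx_pairing : measurable_fun setT uxx_pairing.
Proof.
apply: measurable_funD => //.
apply: (measurable_Rintegral1 mu (f := fun z => kern rho z.1 z.2 * source_pairing z.2)).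
apply: measurable_funM; first exact: measurable_kern.
exact: (measurableT_comp (integrable_measurable integrable_source_pairing) measurable_snd).
Qed.

Lemma integrable_uxx_pairing : mu.-integrable setT (EFin \o (fun x => \1_(itvoo 1) x * uxx_pairing x)).
Proof.
have [C C0 HC] := uxx_pairing_bounded.
have := integrable_bddM measurable_uxx_pairing HC (integrable_indic_unit R).
by apply: eq_integrable => // x _; rewrite /= mulrC.
Qed.

Definition ux_pairing (x : L) : R := test_ux rho + \int[mu]_s (kern rho x s * (\1_(itvoo 1) s * uxx_pairing s)).

Lemma ux_pairing_weak phi : test (itvoo 1) phi -> \int[mu]_x (phi x * ux_pairing x) = test_ux phi.
Proof.
move=> tphi; apply: (primitive_representation rho_test rho_int test_ux_linear integrable_uxx_pairing) => //.
move=> zeta tz.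
have -> : \int[mu]_x (zeta x * (\1_(itvoo 1) x * uxx_pairing x)) = \int[mu]_x (zeta x * uxx_pairing x).
  apply: eq_Rintegral => x _; rewrite indicE; have [xI|xI] := pselect (itvoo 1 x).
    by rewrite mem_set// mul1r.
  by rewrite (test_out tz)// !mul0r.
by rewrite uxx_pairing_weak// /test_uxx mulN1r opprK.
Qed.

Lemma integral_dxx x : itvcc 1 x -> \int[P]_(w in A) dxx x w psi = uxx_pairing x.
Proof.
move=> xI; have t' : test (itvoo 1) rho' by exact: test_derive.
have [D D0 HD] := kern_bounded rho_test.
have [b b0 Hb] := test_bounded t'; have mr := test_line_measurable t'.
have b1 s : `|-1 * rho' s| <= b + D.
  by rewrite mulN1r normrN (le_trans (Hb s))// lerDl.
have b2 s : `|kern rho x s| <= b + D by rewrite (le_trans (HD x s))// lerDr.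
rewrite (integral_repr_pairing _ (measurable_kern1 rho_test x) b1 b2); last exact: measurable_funM.
rewrite /uxx_pairing /test_uxx -(Rint_scale _ (integrable_test_dx_pairing t')); congr (_ + _).
by apply: eq_Rintegral => s _; rewrite mulrA.
Qed.

Lemma integral_dx x : itvcc 1 x -> \int[P]_(w in A) dx x w psi = ux_pairing x.
Proof.
move=> xI; have t' : test (itvoo 1) rho' by exact: test_derive.
have [C C0 [mk1 bk1 _]] := family_kern1 rho_test.
have [D D0 [mk2 bk2 _]] := family_kern2 rho_test.
have b1 s : `|kern1 rho x s| <= C + D by rewrite (le_trans (bk1 x s xI))// lerDl.
have b2 s : `|kern2 rho x s| <= C + D by rewrite (le_trans (bk2 x s xI))// lerDr.
rewrite (integral_repr_pairing (mk1 x) (mk2 x) b1 b2).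
have iV' := integrable_test_dx_pairing t'; have iV := integrable_test_dx_pairing rho_test.
(* The two terms of [kern1] reproduce the two means: [rho] that of [u_x], and
   [- kern_mass rho x * rho'] that of [u_xx] times the mass of the kernel. *)
have -> : \int[mu]_s (kern1 rho x s * dx_pairing s) = test_ux rho + kern_mass rho x * test_uxx rho.
  have -> : kern_mass rho x * test_uxx rho = (- kern_mass rho x) * \int[mu]_s (rho' s * dx_pairing s).
    by rewrite /test_uxx mulN1r mulrN mulNr.
  rewrite /test_ux -(Rint_scale _ iV') -(Rint_add iV (integrable_scale _ iV')).
  by apply: eq_Rintegral => s _; rewrite /kern1 mulrDl mulrA.
(* Undoing the iteration leaves a mean and an inner integral which together form [uxx_pairing r]
   under the outer kernel. *)
rewrite -(kern_iterated rho_test xI integrable_source_pairing) /ux_pairing -addrA; congr (_ + _).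
have [B B0 HB] := kern_bounded rho_test.
have mk := measurable_kern1 rho_test x.
have iK : mu.-integrable setT (EFin \o (fun r => \1_(itvoo 1) r * kern rho x r)).
  have := integrable_bddM mk (HB x) (integrable_indic_unit R).
  by apply: eq_integrable => // r _; rewrite /= mulrC.
have [E E0 HE] := uxx_pairing_bounded.
have mI : measurable_fun setT (fun r => \int[mu]_s (kern rho r s * source_pairing s)).
  apply: (measurable_Rintegral1 mu (f := fun z => kern rho z.1 z.2 * source_pairing z.2)).
  apply: measurable_funM; first exact: measurable_kern.
  exact: (measurableT_comp (integrable_measurable integrable_source_pairing) measurable_snd).
have bI r : `|\int[mu]_s (kern rho r s * source_pairing s)| <= E + `|test_uxx rho|.
  have -> : \int[mu]_s (kern rho r s * source_pairing s) = uxx_pairing r - test_uxx rho by rewrite /uxx_pairing addrAC subrr add0r.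
  by rewrite (le_trans (ler_normB _ _))// lerD2r.
have i2 : mu.-integrable setT (EFin \o (fun r =>
    kern rho x r * (\1_(itvoo 1) r * \int[mu]_s (kern rho r s * source_pairing s)))).
  have := integrable_bddM mI bI iK.
  by apply: eq_integrable => // r _ /=; congr (_ %:E); ring.
rewrite /kern_mass mulrC -(Rint_scale _ iK) -(Rint_add (integrable_scale _ iK) i2).
apply: eq_Rintegral => r _; rewrite /uxx_pairing; ring.
Qed.

End Fixed.

Lemma unit_itv_sub (x : L) : itvoo 1 x -> itvcc 1 x.
Proof. by rewrite /itvoo /itvcc /= !in_itv/= => /andP[/ltW -> /ltW ->]. Qed.

Lemma integral_test_unit (a g h : L -> R) : test (itvoo 1) a ->
  (forall x, itvoo 1 x -> g x = h x) ->
  \int[mu]_(x in itvoo 1) (a x * g x) = \int[mu]_x (a x * h x).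
Proof.
move=> ta gh; rewrite [LHS]Rintegral_mkcond; apply: eq_Rintegral => x _.
rewrite patchE; case: ifPn => [/set_mem xI|/negP xI]; first by rewrite gh.
by rewrite (test_out ta) ?mul0r// => xI'; apply: xI; exact: mem_set.
Qed.

Lemma derive1n_1 (phi : L -> R) : derive1n 1 (phi : R -> R) = ('D_(1 : R) phi : L -> R).
Proof. by apply/funext => x; rewrite derive1nS derive1E. Qed.

Lemma derive1n_2 (phi : L -> R) :
  derive1n 2 (phi : R -> R) = ('D_(1 : R) ('D_(1 : R) phi : L -> R) : L -> R).
Proof. by apply/funext => x; rewrite derive1nS derive1n_1 derive1E. Qed.

Lemma weak_dxx : weak_dx T P 2 (in_x T u) dxx.
Proof.
move=> A phi psi mA tphi tp.
have t1 : test (itvoo 1) ('D_(1 : R) phi : L -> R) by exact: test_derive.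
have t2 : test (itvoo 1) ('D_(1 : R) ('D_(1 : R) phi : L -> R) : L -> R) by exact: test_derive.
rewrite derive1n_2 (integral_in_x (Lq_integrable mD finD (ler1n R 2) Lu) mA t2 tp).
rewrite (pairing_weak_derivative cY (Lq_integrable mD finD (ler1n R 2) Lu)
  (Lq_integrable mD finD (ler1n R 2) Lv) uv mA t1 tp).
rewrite (integral_test_unit (h := uxx_pairing A psi) tphi); last first.
  by move=> x xI; exact: (integral_dxx mA tp (unit_itv_sub xI)).
by rewrite (uxx_pairing_weak mA tp tphi) /test_uxx expr2 mulrNN !mul1r mulN1r.
Qed.

Lemma weak_dx1 : weak_dx T P 1 (in_x T u) dx.
Proof.
move=> A phi psi mA tphi tp.
have t1 : test (itvoo 1) ('D_(1 : R) phi : L -> R) by exact: test_derive.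
rewrite derive1n_1 (integral_in_x (Lq_integrable mD finD (ler1n R 2) Lu) mA t1 tp).
rewrite (pairing_weak_derivative cY (Lq_integrable mD finD (ler1n R 2) Lu)
  (Lq_integrable mD finD (ler1n R 2) Lv) uv mA tphi tp).
rewrite (integral_test_unit (h := ux_pairing A psi) tphi); last first.
  by move=> x xI; exact: (integral_dx mA tp (unit_itv_sub xI)).
by rewrite (ux_pairing_weak mA tp tphi) /test_ux expr1 mulN1r.
Qed.

Lemma CxB_dxx : CxB T P p dxx.
Proof.
have t' : test (itvoo 1) (fun s => -1 * rho' s) by apply: testZ; exact: test_derive.
have [C C0 fC] := family_const t'; have [D D0 fD] := family_kern rho_test.
apply: (CxB_repr mD finD cY c p1 Lu Lv LF (C := C + D) (k := fun _ s => -1 * rho' s)).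
- exact: addr_ge0.
- by apply: family_weaken fC; rewrite lerDl.
- by apply: family_weaken fD; rewrite lerDr.
Qed.

Lemma CxB_dx : CxB T P p dx.
Proof.
have [C C0 fC] := family_kern1 rho_test; have [D D0 fD] := family_kern2 rho_test.
apply: (CxB_repr mD finD cY c p1 Lu Lv LF (C := C + D)).
- exact: addr_ge0.
- by apply: family_weaken fC; rewrite lerDl.
- by apply: family_weaken fD; rewrite lerDr.
Qed.

End Equation.
End WeakDerivatives.

(** * Uniqueness of traces *)

Section IntegralInequalities.
Context (d : measure_display) (X : measurableType d) (R : realType)
  (m : {measure set X -> \bar R}).

(** Setting [f] to zero on the exceptional null set makes the inequality hold everywhere and
    modifies only the measurable side. In the application [g] involves [normHm2], an uncountable
    supremum. *)
Lemma ae_ge0_le_integral_sup (f g : X -> \bar R) : measurable_fun setT f ->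
  (forall x, 0 <= f x)%E -> (forall x, 0 <= g x)%E -> {ae m, forall x, (f x <= g x)%E} ->
  (\int[m]_x f x <= \int[m]_x g x)%E.
Proof.
move=> mf f0 g0 [N [mN N0 sN]].
have mf1 : measurable_fun setT (f \_ (~` N)).
  by apply/(measurable_restrictT _ (measurableC mN)); exact: measurable_funTS.
have f10 x : (0 <= (f \_ (~` N)) x)%E by rewrite patchE; case: ifPn.
have E : ae_eq m setT f (f \_ (~` N)).
  exists N; split => // x /= H; apply: contrapT => xN; apply: H => _.
  by rewrite patchE mem_set.
rewrite (ge0_ae_eq_integral measurableT mf mf1 (fun x _ => f0 x) (fun x _ => f10 x) E).
apply: ge0_le_integral_sup => x _ //; rewrite patchE; case: ifPn => // /set_mem xN.
by apply: contrapT => H; apply: xN; exact: sN.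
Qed.

(** Hoelder against the indicator of [D]; the exponent [(q - 1) / q] is the inverse of the conjugate
    exponent. *)
Lemma hoelder_finite (q dl : R) (D : set X) (f : X -> R) : 1 < q -> measurable D ->
  (m D <= dl%:E)%E -> measurable_fun setT f -> (forall x, ~ D x -> f x = 0) ->
  (\int[m]_x `|f x|%:E <= (dl `^ ((q - 1) / q))%:E * 'N[m]_q%:E[EFin \o f])%E.
Proof.
move=> q1 mD mdl mf f0.
have q_gt0 : 0 < q by rewrite (lt_trans ltr01).
have q1_gt0 : 0 < q - 1 by rewrite subr_gt0.
have qn : q != 0 by rewrite gt_eqF.
have q1n : q - 1 != 0 by rewrite gt_eqF.
pose r := q / (q - 1).
have r_gt0 : 0 < r by rewrite divr_gt0.
have rq : r^-1 + q^-1 = 1 by rewrite /r invf_div; field; rewrite qn.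
have d0 : 0 <= dl by rewrite -lee_fin (le_trans _ mdl).
have m1 : measurable_fun setT (\1_D : X -> R) by exact: measurable_indic.
have := hoelder m m1 mf r_gt0 q_gt0 rq; rewrite Lnorm1.
rewrite (eq_integral (fun x => `|f x|%:E)); last first.
  move=> x _ /=; rewrite indicE; have [xD|xD] := pselect (D x).
    by rewrite mem_set// mul1r.
  by rewrite f0// mulr0.
move=> H; apply: (le_trans H); apply: lee_wpmul2r; first exact: Lnorm_ge0.
apply: Lnorm_le => //; first exact: powR_ge0.
rewrite -powRrM (_ : (q - 1) / q * r = 1); last first.
  by rewrite /r; field; rewrite qn q1n.
have iD : (\int[m]_x (\1_D x)%:E = m D)%E by rewrite integral_indic// setIT.
rewrite powRr1//; apply: le_trans mdl; rewrite -iD.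
apply: ge0_le_integral_sup => x _; first exact: poweR_ge0.
rewrite /= indicE; case: (_ \in _); rewrite /= ?normr1 ?normr0 ?powR1// powR0//.
by rewrite gt_eqF.
Qed.

End IntegralInequalities.

Section TraceUniqueness.
Context (R : realType) (T : R) (Y : crossSection R).
Context (dO : measure_display) (Omega : measurableType dO) (P : probability Omega R).
Hypothesis mD : measurable (cs_dom Y).
Hypothesis finD : (cs_measure Y (cs_dom Y) < +oo)%E.
Hypothesis cY : continuous_measurable (cs_space Y).
Local Notation L := (line R).
Local Notation mu := (leb R).
Local Notation m := (mupt Y).
Local Notation PW := (prod_measure P (mupt Y)).
Local Notation QT := (@Q R T Y).
Variable p : R.
Hypothesis p1 : 1 < p.

Lemma normH2Z (a : R) (psi : pt Y -> R) : test QT psi -> 0 <= a ->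
  normH2 T (fun z => a * psi z) = a * normH2 T psi.
Proof.
move=> tp a0.
have I (f g : pt Y -> R) : test QT f -> (forall z, g z = a * f z) ->
    \int[m]_(z in QT) (g z) ^+ 2 = a ^+ 2 * \int[m]_(z in QT) (f z) ^+ 2.
  move=> tf gE; have tg : test QT g by rewrite (_ : g = fun z => a * f z); [exact: testZ|exact/funext].
  rewrite (sqr_mkcond tg) (sqr_mkcond tf) -(Rint_scale _ (test_sqr_integrable mD finD cY tf)).
  by apply: eq_Rintegral => z _; rewrite gE exprMn.
have D1 (v : pt Y) (f : pt Y -> R) : test QT f ->
    'D_v (fun z => a * f z) = (fun z => a * 'D_v f z).
  by move=> tf; apply/funext => z; rewrite (derive_smoothZ _ _ _ (test_smooth tf)).
have E0 := I psi _ tp (fun z => erefl).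
have E1 : \sum_(v <- dirs Y) \int[m]_(z in QT) ('D_v (fun z => a * psi z) z) ^+ 2 =
    a ^+ 2 * \sum_(v <- dirs Y) \int[m]_(z in QT) ('D_v psi z) ^+ 2.
  rewrite mulr_sumr; apply: eq_bigr => v _; apply: I; first exact: test_derive.
  by move=> z; exact: (congr1 (fun g => g z) (D1 v psi tp)).
have E2 : \sum_(v <- dirs Y) \sum_(v2 <- dirs Y)
      \int[m]_(z in QT) ('D_v ('D_v2 (fun z => a * psi z)) z) ^+ 2 =
    a ^+ 2 * \sum_(v <- dirs Y) \sum_(v2 <- dirs Y) \int[m]_(z in QT) ('D_v ('D_v2 psi) z) ^+ 2.
  rewrite mulr_sumr; apply: eq_bigr => v _; rewrite mulr_sumr; apply: eq_bigr => v2 _.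
  apply: I; first by do 2 apply: test_derive.
  have E : 'D_v ('D_v2 (fun z => a * psi z)) = (fun z => a * 'D_v ('D_v2 psi) z).
    by rewrite (D1 v2 psi tp) (D1 v _ (test_derive _ tp)).
  by move=> z; exact: (congr1 (fun g => g z) E).
apply: (etrans (congr1 Num.sqrt (congr2 +%R (congr2 +%R E0 E1) E2))).
have sq (x y z : R) : Num.sqrt (a ^+ 2 * x + a ^+ 2 * y + a ^+ 2 * z) = a * Num.sqrt (x + y + z).
  by rewrite -!mulrDr sqrtrM ?sqr_ge0// sqrtr_sqr ger0_norm.
exact: sq.
Qed.

Lemma linear_on_scale (L0 : (pt Y -> R) -> R) (a : R) psi : linear_on QT L0 -> test QT psi ->
  L0 (fun z => a * psi z) = a * L0 psi.
Proof.
move=> lin tp; have t0 := test0 QT.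
have L00 : L0 (fun=> 0) = 0.
  have := lin 1 _ _ t0 t0; rewrite (_ : (fun _ => _) = (fun=> 0)); last first.
    by apply/funext => z; rewrite mulr0 addr0.
  by rewrite mul1r => /eqP; rewrite addrC -subr_eq subrr => /eqP.
have := lin a _ _ tp t0; rewrite (_ : (fun _ => _) = (fun z => a * psi z)); last first.
  by apply/funext => z; rewrite addr0.
by rewrite L00 addr0.
Qed.

(* Rescaling [psi] into the unit ball avoids pulling a constant out of the
   integral of [normHm2], which need not be measurable. *)
Lemma Hm2_pairing_bound (psi : pt Y -> R) : test QT psi -> exists2 K : R, 0 < K &
  forall g : rdistr Y Omega, inL2Hm2 T P g ->
    (\int[P]_w `|g w psi|%:E <= K%:E * normL2Hm2 T P g)%E.
Proof.
move=> tp; pose N := normH2 T psi; have N0 : 0 <= N by exact: sqrtr_ge0.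
have K0 : 0 < N + 1 by rewrite ltr_wpDl.
exists (N + 1) => // g [mg lg _]; have mgp := mg _ tp.
rewrite -(lee_pdivrMl _ _ K0).
have k0 : 0 <= (N + 1)^-1 by rewrite invr_ge0 ltW.
pose f w := (N + 1)^-1 * g w psi.
have mf : measurable_fun setT f by exact: measurable_funM.
have E : ((N + 1)^-1%:E * \int[P]_w `|g w psi|%:E = \int[P]_w `|f w|%:E)%E.
  rewrite -ge0_integralZl//; last by apply/measurable_EFinP; exact: measurableT_comp.
  by apply: eq_integral => w _; rewrite /f normrM (ger0_norm k0).
rewrite E.
have PT : (P setT <= 1%:E)%E by rewrite probability_setT.
apply: (le_trans (hoelder_finite (ltr1n R 2) measurableT PT mf (fun x nx => False_ind _ (nx I)))).
rewrite powR1 mul1e.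
have Nf0 : (0 <= 'N[P]_2%:E[EFin \o f])%E by exact: Lnorm_ge0.
have Ng0 : (0 <= normL2Hm2 T P g)%E by exact: Lnorm_ge0.
have two0 : (2 : R) != 0 by rewrite pnatr_eq0.
(* The two norms are compared through their squares, which are integrals and so can be compared
   pointwise. *)
have root (z : \bar R) : (0 <= z)%E -> z = ((z `^ 2) `^ 2^-1)%E.
  by move=> z0; rewrite -poweRrM mulfV// poweRe1.
rewrite [leLHS](root _ Nf0) [leRHS](root _ Ng0) /normL2Hm2 !poweR_Lnorm//.
apply: poweR_le => //; first by apply: integral_ge0 => w _; exact: poweR_ge0.
apply: ae_ge0_le_integral_sup.
- have -> : (fun w => (`|(EFin \o f) w| `^ 2)%E) = (fun w => (`|f w| `^ 2)%:E) by [].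
  exact: measurable_abs_powR.
- by move=> w; exact: poweR_ge0.
- by move=> w; exact: poweR_ge0.
apply: filterS lg => w [lw _].
apply: poweR_le => //; rewrite (gee0_abs (normHm2_ge0 _ _)).
have ts := testZ (N + 1)^-1 tp.
apply: le_ereal_sup_tmp; exists (`|g w (fun z => (N + 1)^-1 * psi z)|)%:E.
  exists (fun z => (N + 1)^-1 * psi z) => //; split => //.
  by rewrite normH2Z// mulrC ler_pdivrMr// mul1r lerDl.
by rewrite (linear_on_scale _ lw tp) lee_fin.
Qed.

(** [psi] is bounded and [Omega x Q] has finite measure, so the [L^p] norm controls the [L^1]
    norm. *)
Lemma E_pairing_bound (psi : pt Y -> R) : test QT psi -> exists2 K : R, 0 <= K &
  forall e : Omega -> pt Y -> R, inE T P p e ->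
    measurable_fun setT (fun w => regular QT (e w) psi) /\
    (\int[P]_w `|regular QT (e w) psi|%:E <= K%:E * normE T P p e)%E.
Proof.
move=> tp; have [b b0 Hb] := test_bounded tp; have mp := test_measurable cY tp.
have mQ := measurable_Q T mD.
have mPQ : measurable ([set: Omega] `*` QT) by exact: measurableX.
have fPQ : (PW (setT `*` QT) < +oo)%E.
  have -> : PW (setT `*` QT) = (P setT * m QT)%E by exact: product_measure1E.
  by rewrite probability_setT mul1e; exact: measure_QT_finite.
pose dl := fine (PW (setT `*` QT)).
have dlE : (PW (setT `*` QT) <= dl%:E)%E by rewrite fineK// ge0_fin_numE.
exists (b * dl `^ ((p - 1) / p)); first by rewrite mulr_ge0 ?powR_ge0.
move=> e [me _].
pose f := (fun z : Omega * pt Y => e z.1 z.2) \_ (setT `*` QT).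
have mf : measurable_fun setT f by apply/(measurable_restrictT _ mPQ).
have f0 q : ~ QT q.2 -> f q = 0 by move=> qQ; rewrite /f patchE memNset// => -[].
have rE w : regular QT (e w) psi = regular QT (fun z => f (w, z)) psi.
  apply: eq_Rintegral => z /set_mem zQ; rewrite /f patchE mem_set//.
have f0' q : ~ (setT `*` QT) q -> f q = 0 by move=> qQ; rewrite /f patchE memNset.
split.
  rewrite (_ : (fun w => _) = (fun w => regular QT (fun z => f (w, z)) psi)); last exact/funext.
  exact: (measurable_regular_section cY mf f0 tp).
have mfp w : measurable_fun setT (fun z => f (w, z) * psi z).
  by apply: measurable_funM => //; exact: section1.
have mabs : measurable_fun setT (fun q => `|f q|%:E) by apply/measurable_EFinP; exact: measurableT_comp.
apply: (@le_trans _ _ (b%:E * \int[PW]_q `|f q|%:E)%E); last first.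
  rewrite EFinM -muleA; apply: lee_wpmul2l => //.
  apply: (le_trans (hoelder_finite p1 mPQ dlE mf f0')).
  apply: lee_wpmul2l; first by rewrite lee_fin powR_ge0.
  rewrite /normE (_ : EFin \o f = (fun z => (e z.1 z.2)%:E) \_ (setT `*` QT))//.
  by apply/funext => q; rewrite /f /= !patchE; case: ifPn.
rewrite fubini_tonelli1//.
rewrite -ge0_integralZl//; last 2 first.
- by apply: measurable_fun_fubini_tonelli_F => // q; rewrite lee_fin.
- by move=> w _; apply: integral_ge0 => z _; rewrite lee_fin.
apply: ge0_le_integral_sup => w _; first by rewrite lee_fin.
have f0w z : ~ QT z -> f (w, z) = 0 by exact: (f0 (w, z)).
rewrite rE (regular_mkcond _ f0w); apply: (le_trans (abs_Rintegral_le m (mfp w))).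
rewrite /fubini_F -ge0_integralZl//; last by apply: (measurableT_comp mabs); exact: pair1_measurable.
apply: ge0_le_integral_sup => z _; first by rewrite lee_fin.
by rewrite -EFinM lee_fin normrM mulrC ler_wpM2r.
Qed.

(** Every admissible decomposition of [G] bounds the pairing with the same constant. Dividing by
    that constant first reduces the claim to a lower bound for the infimum, which also covers the
    case of no decomposition. *)
Lemma B_pairing_bound (psi : pt Y -> R) : test QT psi -> exists2 K : R, 0 < K &
  forall G : rdistr Y Omega, measurable_fun setT (fun w => G w psi) ->
    (\int[P]_w `|G w psi|%:E <= K%:E * normB T P p G)%E.
Proof.
move=> tp; have [K K0 HK] := Hm2_pairing_bound tp; have [K' K'0 HK'] := E_pairing_bound tp.
have KK : 0 < K + K' by rewrite ltr_wpDr.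
exists (K + K') => // G mG; rewrite -(lee_pdivrMl _ _ KK).
apply: le_ereal_inf_tmp => _ [g [e [ig ie Ge ->]]]; rewrite lee_pdivrMl//.
have [mr He] := HK' e ie; have Hg := HK g ig; have [mg _ _] := ig; have mgp := mg _ tp.
have abs_m (f : Omega -> R) : measurable_fun setT f -> measurable_fun setT (fun w => `|f w|%:E).
  by move=> mf; apply/measurable_EFinP; exact: measurableT_comp.
have Ng0 : (0 <= normL2Hm2 T P g)%E by exact: Lnorm_ge0.
have Ne0 : (0 <= normE T P p e)%E by exact: Lnorm_ge0.
apply: (@le_trans _ _ (\int[P]_w (`|g w psi|%:E + `|regular QT (e w) psi|%:E))%E).
  apply: ae_ge0_le_integral_sup => //; first exact: abs_m.
    by move=> w; rewrite adde_ge0.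
  by apply: filterS (Ge _ tp) => w ->; rewrite -EFinD lee_fin ler_normD.
rewrite ge0_integralD//; [|exact: abs_m|exact: abs_m].
rewrite ge0_muleDr//; apply: leeD.
  apply: (le_trans Hg); apply: lee_wpmul2r => //; by rewrite lee_fin lerDl.
apply: (le_trans He); apply: lee_wpmul2r => //; by rewrite lee_fin lerDr ltW.
Qed.

Lemma inB_integrable (G : rdistr Y Omega) psi : inB T P p G -> test QT psi ->
  P.-integrable setT (EFin \o (fun w => G w psi)).
Proof.
move=> [mG fG] tp; have [K K0 HK] := B_pairing_bound tp; have mGp := mG _ tp.
apply/integrableP; split; first exact/measurable_EFinP.
rewrite (eq_integral (fun w => `|G w psi|%:E))//.
by apply: (le_lt_trans (HK G mGp)); apply: lte_mul_pinfty => //; rewrite ?lee_fin// ltW.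
Qed.

Section Continuity.
Variables (A : set Omega) (psi : pt Y -> R).
Hypothesis mA : measurable A.
Hypothesis tp : test QT psi.

Lemma CxB_pairing_continuous (v : L -> rdistr Y Omega) x : CxB T P p v -> itvcc 1 x ->
  (fun x' => \int[P]_(w in A) v x' w psi) @ within (itvcc 1) (nbhs x) -->
  (\int[P]_(w in A) v x w psi : R).
Proof.
move=> cv xI; have [K K0 HK] := B_pairing_bound tp; have [bx cx] := cv x xI.
have FF : Filter (within (itvcc 1) (nbhs x)) by exact: within_filter.
apply/cvgrPdist_le => eps eps0.
have ek : 0 < eps / K by rewrite divr_gt0.
have U : nbhs (0 : \bar R) [set z | (z < (eps / K)%:E)%E].
  exists (eps / K) => //= r; rewrite /ball_/= sub0r normrN => rr.
  by rewrite lte_fin; exact: le_lt_trans (ler_norm r) rr.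
have H1 := cx _ U.
have H2 : within (itvcc 1) (nbhs x) (itvcc 1 : set L) by exact: withinT.
near=> x'.
have x'I : itvcc 1 x' by near: x'.
have Hx : (normB T P p (rsub (v x') (v x)) < (eps / K)%:E)%E by near: x'.
have i1 := inB_integrable bx tp; have i2 := inB_integrable (cv x' x'I).1 tp.
have sub (f : Omega -> R) : P.-integrable setT (EFin \o f) -> P.-integrable A (EFin \o f).
  exact: integrableS.
rewrite distrC -(RintegralB mA (sub _ i2) (sub _ i1)).
have i3 := integrableB measurableT i2 i1.
have m3 : measurable_fun setT (fun w => v x' w psi - v x w psi).
  exact: (integrable_measurable i3).
have i3A : P.-integrable A (EFin \o (fun w => v x' w psi - v x w psi)) by exact: (sub _ i3).
rewrite -lee_fin.
apply: (@le_trans _ _ (\int[P]_w `|rsub (v x') (v x) w psi|%:E)%E).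
  rewrite Rintegral_mkcond; apply: (le_trans (abs_Rintegral_le P _)).
    by apply/(measurable_restrictT _ mA); exact: measurable_funTS.
  apply: ge0_le_integral_sup => w _ //; rewrite patchE; case: ifPn => _ //.
  by rewrite normr0 lee_fin.
apply: (le_trans (HK (rsub (v x') (v x)) m3)).
apply: (@le_trans _ _ (K%:E * (eps / K)%:E)%E).
  by apply: lee_wpmul2l; [rewrite lee_fin ltW|exact: ltW].
by rewrite -EFinM lee_fin mulrC divfK// gt_eqF.
Unshelve. all: by end_near.
Qed.

Lemma continuous_unit_integrable (f : L -> R) :
  (forall x : L, itvcc 1 x -> f @ within (itvcc 1) (nbhs x) --> f x) ->
  mu.-integrable (itvoo 1) (EFin \o f).
Proof.
move=> cf; have ic : mu.-integrable (itvcc 1) (EFin \o f).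
  apply: continuous_compact_integrable; first exact: segment_compact.
  exact/subspace_continuousP.
apply: (integrableS _ _ _ ic); [exact: measurable_itv|exact: measurable_itvoo|].
by move=> x; rewrite /itvoo /itvcc /= !in_itv/= => /andP[/ltW -> /ltW ->].
Qed.

(** Continuity in [B] makes both pairings continuous on [[0, 1]]. The two weak identities share
    their left side, so the difference is orthogonal to all test functions, and [vanishing_of_test]
    reaches the endpoints. *)
Lemma weak_dx_unique k (W : L -> rdistr Y Omega) v1 v2 x : CxB T P p v1 -> CxB T P p v2 ->
  weak_dx T P k W v1 -> weak_dx T P k W v2 -> itvcc 1 x ->
  \int[P]_(w in A) v1 x w psi = \int[P]_(w in A) v2 x w psi.
Proof.
move=> c1 c2 w1 w2 xI.
pose F1 x := \int[P]_(w in A) v1 x w psi; pose F2 x := \int[P]_(w in A) v2 x w psi.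
have C1 (y : L) : itvcc 1 y -> F1 @ within (itvcc 1) (nbhs y) --> F1 y.
  by move=> yI; exact: CxB_pairing_continuous.
have C2 (y : L) : itvcc 1 y -> F2 @ within (itvcc 1) (nbhs y) --> F2 y.
  by move=> yI; exact: CxB_pairing_continuous.
suff : F1 x - F2 x = 0 by move/eqP; rewrite subr_eq0 => /eqP.
apply: (@vanishing_of_test _ (fun y => F1 y - F2 y)) => // [y yI|phi tphi].
  by apply: cvgB; [exact: C1|exact: C2].
have cphi (y : L) : itvcc 1 y -> phi @ within (itvcc 1) (nbhs y) --> phi y.
  by move=> _; apply: cvg_within_filter; exact: test_continuous tphi y.
have cM (F : L -> R) : (forall y : L, itvcc 1 y -> F @ within (itvcc 1) (nbhs y) --> F y) ->
    mu.-integrable (itvoo 1) (EFin \o (fun y => phi y * F y)).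
  move=> cF; apply: continuous_unit_integrable => y yI.
  by apply: cvgM; [exact: cphi|exact: cF].
transitivity (\int[mu]_(y in itvoo 1) (phi y * F1 y) - \int[mu]_(y in itvoo 1) (phi y * F2 y)).
  rewrite -(RintegralB (@measurable_itvoo R 1) (cM _ C1) (cM _ C2)).
  by apply: eq_Rintegral => y _; rewrite mulrBr.
have E1 := w1 A phi psi mA tphi tp; have E2 := w2 A phi psi mA tphi tp.
have s0 : (-1) ^+ k != 0 :> R by rewrite expf_neq0// oppr_eq0 oner_eq0.
have E : (-1) ^+ k * \int[mu]_(y in itvoo 1) (phi y * F1 y) =
    (-1) ^+ k * \int[mu]_(y in itvoo 1) (phi y * F2 y) := etrans (esym E1) E2.
by rewrite (mulfI s0 E) subrr.
Qed.

End Continuity.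

Lemma normB_ge0 (G : rdistr Y Omega) : (0 <= normB T P p G)%E.
Proof. by apply: le_ereal_inf_tmp => _ [g [h [_ _ _ ->]]]; apply: adde_ge0; exact: Lnorm_ge0. Qed.

Lemma normHm2_0 : @normHm2 R T Y (fun=> 0) = 0%E.
Proof.
apply/eqP; rewrite eq_le normHm2_ge0 andbT.
by apply: ge_ereal_sup => _ [psi _ <-]; rewrite normr0.
Qed.

(** Equal integrals over every event make the pairings with each [psi] equal almost surely, which is
    all that [normB] asks of a decomposition; [0 + 0] is then one for the difference. *)
Lemma trace_unique k (W : L -> rdistr Y Omega) v1 v2 x : CxB T P p v1 -> CxB T P p v2 ->
  weak_dx T P k W v1 -> weak_dx T P k W v2 -> itvcc 1 x ->
  normB T P p (rsub (v1 x) (v2 x)) = 0%E.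
Proof.
move=> c1 c2 w1 w2 xI; apply/eqP; rewrite eq_le normB_ge0 andbT.
have p0 : p != 0 by rewrite gt_eqF// (lt_trans ltr01).
have zL : normL2Hm2 T P ((fun _ => fun=> 0) : rdistr Y Omega) = 0%E.
  apply/eqP; rewrite eq_le Lnorm_ge0 andbT; apply: Lnorm_le => //.
  rewrite integral0_eq ?lee_fin ?powR_ge0// => w _.
  by rewrite normHm2_0 abse0 poweR_EFin powR0// pnatr_eq0.
have zE : normE T P p ((fun _ => fun=> 0) : Omega -> pt Y -> R) = 0%E.
  apply/eqP; rewrite eq_le Lnorm_ge0 andbT; apply: Lnorm_le => //.
    by rewrite (lt_trans ltr01).
  rewrite integral0_eq ?lee_fin ?powR_ge0// => w _.
  by rewrite patchE; case: ifPn => _; rewrite abse0 poweR_EFin powR0.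
apply: ge_ereal_inf; exists 0%E => //; exists (fun _ => fun=> 0), (fun _ => fun=> 0); split.
- split => //; last by rewrite zL ltry.
  apply: aeW => w; split; last by rewrite normHm2_0 ltry.
  by move=> a phi psi _ _; rewrite mulr0 addr0.
- by split => //; rewrite zE ltry.
- move=> psi tp.
  have i1 := inB_integrable (c1 x xI).1 tp; have i2 := inB_integrable (c2 x xI).1 tp.
  have E A : measurable A -> \int[P]_(w in A) v1 x w psi = \int[P]_(w in A) v2 x w psi.
    by move=> mA; exact: (weak_dx_unique mA tp c1 c2 w1 w2 xI).
  apply: filterS (ae_eq_of_integrals i1 i2 E) => w ew.
  rewrite /rsub ew subrr add0r /regular /Rintegral integral0_eq// => z _.
  by rewrite mul0r.
- by rewrite zL zE adde0.
Qed.

End TraceUniqueness.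

(** * The concrete cross sections and the conclusion *)

Lemma unit_bump (R : realType) : exists2 rho : line R -> R,
  test (itvoo 1) rho & \int[leb R]_x rho x = 1.
Proof.
have q0 : 0 < (4^-1 : R) by rewrite invr_gt0.
have qh : (4^-1 : R) < 2^-1 by rewrite ltf_pV2 ?posrE// ltr_nat.
have h1 : (2^-1 : R) < 1 by rewrite invf_lt1// ltr1n.
have [f [tf f0 _ fi]] := test_bump q0 qh h1.
exists (fun x => (\int[leb R]_x f x)^-1 * f x); first exact: testZ.
by rewrite (Rint_scale _ (test_integrable ltr01 tf)) mulVf// gt_eqF.
Qed.

Lemma measurable_half_pi_itv (R : realType) : measurable (half_pi_itv (R := R)).
Proof. exact: measurable_itv. Qed.

Lemma half_pi_itv_finite (R : realType) : (leb R (half_pi_itv (R := R)) < +oo)%E.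
Proof.
by rewrite /half_pi_itv /leb/= lebesgue_measure_itv/=; case: ifPn; rewrite // -EFinB ltry.
Qed.

Lemma continuous_measurable_line (R : realType) : @continuous_measurable R _ (line R).
Proof. by move=> f cf; exact: measurable_realfun.continuous_measurable_fun. Qed.

(** The general development treats an abstract cross section with these three properties; this is
    the one place where the two dimensions are distinguished. *)
Lemma cross_regular (R : realType) (d : nat) : d = 1%N \/ d = 2%N ->
  [/\ measurable (cs_dom (cross R d)),
      (cs_measure (cross R d) (cs_dom (cross R d)) < +oo)%E &
      continuous_measurable (cs_space (cross R d))].
Proof.
have mI := @measurable_half_pi_itv R; have fI := @half_pi_itv_finite R.
case=> ->; split.
- exact: mI.
- exact: fI.
- exact: continuous_measurable_line.
- exact: measurableX.
- have E : prod_measure (leb R) (leb R) (half_pi_itv (R := R) `*` half_pi_itv (R := R)) =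
      (leb R (half_pi_itv (R := R)) * leb R (half_pi_itv (R := R)))%E.
    exact: product_measure1E.
  apply: (eq_ind_r (fun z => (z < +oo)%E) _ E).
  by apply: lte_mul_pinfty => //; rewrite ge0_fin_numE.
- exact: continuous_measurable_prod (@continuous_measurable_line R).
Qed.

Theorem lemma5p3 (R : realType) (T c : R) (hT : 0 < T)
    (d : nat) (hd : d = 1%N \/ d = 2%N)
    (dO : measure_display) (Omega : measurableType dO)
    (P : probability Omega R)
    (p : R) (hp : 1 < p)
    (F u : process (cross R d) Omega)
    (hF : LpE T P p F)
    (hu : L2L2H1 T P u)
    (heq : solves T P c F u) :
  [/\ exists ux : line R -> rdistr (cross R d) Omega,
        dx_in_CxB T P p 1 u ux,
      exists uxx : line R -> rdistr (cross R d) Omega,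
        dx_in_CxB T P p 2 u uxx &
      forall (k : nat) (x : R), k = 1%N \/ k = 2%N -> x = 0 \/ x = 1 ->
        exists b : rdistr (cross R d) Omega, trace T P p k u x b].
Proof.
have [mD finD cY] := cross_regular R hd.
have [rho tr ri] := unit_bump R.
have [v [Lu Lv uv]] := L2L2H1_Lq mD hu; have LF := LpE_Lq mD hp hF.
have H1 : dx_in_CxB T P p 1 u (dx T c u v F rho).
  split; first exact: (CxB_dx mD finD cY c hp Lu Lv LF tr).
  exact: (weak_dx1 hT mD finD cY hp Lu Lv LF uv heq tr ri).
have H2 : dx_in_CxB T P p 2 u (dxx T c u v F rho).
  split; first exact: (CxB_dxx mD finD cY c hp Lu Lv LF tr).
  exact: (weak_dxx hT mD finD cY hp Lu Lv LF uv heq tr ri).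
split; [by exists (dx T c u v F rho)|by exists (dxx T c u v F rho)|].
move=> k x hk hx.
have xI : itvcc 1 (x : line R).
  by rewrite /itvcc /= in_itv/=; case: hx => ->; rewrite lexx ler01.
have [w [cw ww]] : exists w, dx_in_CxB T P p k u w.
  by case: hk => ->; [exists (dx T c u v F rho)|exists (dxx T c u v F rho)].
(* The value at [x] of the constructed representative is the trace; [trace_unique] compares it with
   any other representative. *)
exists (w x); split; first exact: (cw x xI).1.
by move=> z [cz wz]; exact: (trace_unique mD finD cY hp cz cw wz ww xI).
Qed.
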